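(* For each $n\ge 1$ let $z_0^n\in\mathbb{R}^n$ and let $Z^n=(Z^n_t)_{t\ge 0}$ be the Ornstein--Uhlenbeck process on $\mathbb{R}^n$ solving $\mathrm{d}Z^n_t=\sqrt{2/n}\,\mathrm{d}B^n_t-Z^n_t\,\mathrm{d}t$, $Z^n_0=z^n_0$, where $B^n$ is a standard $n$-dimensional Brownian motion. Let $P_n^0=\mathcal{N}(0,\frac1n I_n)$ be its invariant law. Suppose that \[ \liminf_{n\to\infty}\frac{|z^n_0|^2}{n}>0\quad\text{and}\quad \limsup_{n\to\infty}\frac{|z^n_0|^2}{n}<\infty . \] Let $\mathrm{dist}\in\{\mathrm{Wasserstein},\mathrm{TV},\mathrm{Hellinger},\mathrm{Kullback},\chi^2,\mathrm{Fisher}\}$. Then for all $\varepsilon\in(0,1)$, \[ \lim_{n\to\infty}\mathrm{dist}(\mathrm{Law}(Z^n_{t_n})\mid P_n^0)=\begin{cases}\max&\text{if }t_n=(1-\varepsilon)c_n\\ 0&\text{if }t_n=(1+\varepsilon)c_n\end{cases} \] where \[ c_n=\begin{cases}\frac12\log(n)&\text{if }\mathrm{dist}=\mathrm{Wasserstein},\\ \log(n)&\text{if }\mathrm{dist}\in\{\mathrm{TV},\mathrm{Hellinger},\mathrm{Kullback},\chi^2\},\\ \frac32\log(n)&\text{if }\mathrm{dist}=\mathrm{Fisher}.\end{cases} \]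
   Context: $|\cdot|$ is the Euclidean norm. For probability measures $\nu,\mu$ on $\mathbb{R}^n$, $\mathrm{dist}(\nu\mid\mu)$ denotes one of: $\mathrm{Wasserstein}(\nu,\mu)=(\inf\mathbb{E}|X-Y|^2)^{1/2}$, infimum over couplings $X\sim\nu$, $Y\sim\mu$; $\mathrm{TV}$: $\|\nu-\mu\|_{\mathrm{TV}}=\sup_A|\nu(A)-\mu(A)|$; $\mathrm{Hellinger}(\nu,\mu)=(1-\int\sqrt{f_\nu f_\mu}\,\mathrm{d}\lambda)^{1/2}$ where $f_\nu,f_\mu$ are densities with respect to a common reference measure $\lambda$; $\mathrm{Kullback}(\nu\mid\mu)=\int\log\frac{\mathrm{d}\nu}{\mathrm{d}\mu}\,\mathrm{d}\nu$; $\chi^2(\nu\mid\mu)=\int|\frac{\mathrm{d}\nu}{\mathrm{d}\mu}-1|^2\mathrm{d}\mu$; $\mathrm{Fisher}(\nu\mid\mu)=\int|\nabla\log\frac{\mathrm{d}\nu}{\mathrm{d}\mu}|^2\mathrm{d}\nu$; the last three are set to $+\infty$ when $\nu$ is not absolutely continuous with respect to $\mu$. The value $\max$ is $1$ if $\mathrm{dist}\in\{\mathrm{TV},\mathrm{Hellinger}\}$ and $+\infty$ if $\mathrm{dist}\in\{\mathrm{Wasserstein},\mathrm{Kullback},\chi^2,\mathrm{Fisher}\}$. *)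

(* Defs.v *)
From HB Require Import structures.
From mathcomp Require Import all_boot all_order all_algebra.
From mathcomp Require Import all_classical all_reals all_analysis.
From mathcomp Require Import measurable_realfun.
From mathcomp Require Import lra.

Set Implicit Arguments.
Unset Strict Implicit.
Unset Printing Implicit Defensive.

Import Order.TTheory GRing.Theory Num.Theory.
Import numFieldNormedType.Exports.

Local Open Scope classical_set_scope.
Local Open Scope ring_scope.

Definition borel_rV_display : measure_display. Proof. exact. Qed.

(* The library equips row vectors with a topology but no sigma-algebra: this is
   the Borel one, generated by the coordinate maps. *)
Section borel_rV.
Context (R : realType) (n : nat).

Let coord (i : 'I_n) (x : 'rV[R]_n) : measurableTypeR R := x ord0 i.

Let rV_set0 : g_sigma_preimage coord set0.
Proof. exact: sigma_algebra0. Qed.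

Let rV_setC A : g_sigma_preimage coord A -> g_sigma_preimage coord (~` A).
Proof. exact: sigma_algebraC. Qed.

Let rV_bigcup (F : _^nat) : (forall i, g_sigma_preimage coord (F i)) ->
  g_sigma_preimage coord (\bigcup_i (F i)).
Proof. exact: sigma_algebra_bigcup. Qed.

HB.instance Definition _ := @isMeasurable.Build borel_rV_display
  'rV[R]_n (g_sigma_preimage coord) rV_set0 rV_setC rV_bigcup.

Lemma measurable_coord (i : 'I_n) :
  measurable_fun [set: 'rV[R]_n] (fun x : 'rV[R]_n => x ord0 i).
Proof.
move=> _ Y mY; rewrite setTI; apply: sub_sigma_algebra => /=.
rewrite -bigcup_seq/=; exists i => /=; first by rewrite mem_index_enum.
by exists Y => //; rewrite setTI.
Qed.

Lemma measurable_rVP d (T : measurableType d) (f : T -> 'rV[R]_n) :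
  measurable_fun [set: T] f <->
  forall i, measurable_fun [set: T] (fun t => f t ord0 i).
Proof.
apply: (@iff_trans _ (g_sigma_preimage
    (fun i => coord i \o f) `<=` measurable)).
  rewrite g_sigma_preimage_comp; split=> [mf A [/= C preC <-]|prefS].
    exact: mf.
  by move=> _ A mA; apply: prefS; exists A.
split=> [fS i|mf].
- move=> _ A mA.
  apply: fS; apply: sub_sigma_algebra.
  rewrite -bigcup_seq/=; exists i => /=; first by rewrite mem_index_enum.
  by exists A.
- apply: smallest_sub; first exact: sigma_algebra_measurable.
  rewrite -bigcup_seq/=; apply: bigcup_sub => i Ii.
  by move=> A [B mB <-]; exact: mf.
Qed.

End borel_rV.


Section product_probability.
Context {R : realType}.

Definition rV_cons n (z : measurableTypeR R * 'rV[R]_n) : 'rV[R]_n.+1 :=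
  \row_i oapp (fun j => z.2 ord0 j) (z.1 : R) (unlift ord0 i).

Lemma measurable_rV_cons n : measurable_fun [set: _] (@rV_cons n).
Proof.
apply/measurable_rVP => i; rewrite /rV_cons.
under eq_fun do rewrite mxE.
case: unliftP => [j|] _ /=; last exact: measurable_fst.
exact: (measurableT_comp (measurable_coord j) measurable_snd).
Qed.

HB.instance Definition _ n :=
  isMeasurableFun.Build _ _ _ _ (@rV_cons n) (measurable_rV_cons (n:=n)).

(* The library has binary product measures only. *)
Fixpoint rV_prod n :
    ('I_n -> probability (measurableTypeR R) R) -> probability 'rV[R]_n R :=
  match n with
  | 0 => fun=> dirac (0 : 'rV[R]_0)
  | n.+1 => fun mu =>
      distribution (mu ord0 \x rV_prod (fun i => mu (lift ord0 i)))%E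
        (@rV_cons n)
  end.

Lemma rV_prodE n (mu : 'I_n -> probability (measurableTypeR R) R)
    (A : 'I_n -> set (measurableTypeR R)) : (forall i, measurable (A i)) ->
  rV_prod mu [set x | forall i, A i (x ord0 i)] = (\prod_i mu i (A i))%E.
Proof.
elim: n => [|n IH] in mu A * => mA.
  rewrite big_ord0 /= diracE mem_set//= => -[]//.
have mA' : measurable [set x : 'rV[R]_n | forall i, A (lift ord0 i) (x ord0 i)].
  have -> : [set x : 'rV[R]_n | forall i, A (lift ord0 i) (x ord0 i)] =
      \bigcap_(i in [set: 'I_n])
        ((fun x : 'rV[R]_n => x ord0 i : measurableTypeR R) @^-1`
           A (lift ord0 i)).
    apply/seteqP; split=> x /= h i; first by move=> _; exact: h.
    exact: h.
  apply: fin_bigcap_measurable => // i _.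
  rewrite -[X in measurable X]setTI.
  exact: (measurable_coord i measurableT (mA (lift ord0 i))).
rewrite big_ord_recl /= -(IH _ (fun i => A (lift ord0 i)))//.
rewrite -product_measure1E// /distribution /pushforward.
congr (_ _); apply/seteqP; split=> -[a x]/=.
  move=> h; split=> [|i].
    by have := h ord0; rewrite mxE unlift_none.
  by have := h (lift ord0 i); rewrite mxE liftK.
move=> [h0 h] i; rewrite mxE.
by case: unliftP => [j|] -> //=.
Qed.

(* N(m, s^2 I_n); s is a standard deviation, as in normal_prob, and has to be
   nonzero: normal_prob _ 0 is not the Dirac mass. *)
Definition gaussian n (m : 'rV[R]_n) (s : R) : probability 'rV[R]_n R :=
  rV_prod (fun i => normal_prob (m ord0 i) s).

End product_probability.

Definition enorm (R : realType) n (x : 'rV[R]_n) : R :=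
  Num.sqrt (\sum_i x ord0 i ^+ 2).

Definition gradient (R : realType) n (f : 'rV[R]_n -> R) (x : 'rV[R]_n) :
    'rV[R]_n :=
  \row_i 'D_(delta_mx ord0 i) f x.

Section measure_add_finite.
Context d (T : measurableType d) (R : realType).
Variables nu mu : {finite_measure set T -> \bar R}.

Let measure_add_fin : fin_num_fun (measure_add nu mu).
Proof.
by move=> A mA; rewrite measure_addE fin_numD !fin_num_measure.
Qed.

HB.instance Definition _ := Measure.on (measure_add nu mu).
HB.instance Definition _ :=
  Measure_isFinite.Build _ _ _ (measure_add nu mu) measure_add_fin.

End measure_add_finite.

Section distances.
Local Open Scope ereal_scope.
Local Open Scope charge_scope.
Context d (T : measurableType d) (R : realType).
Implicit Types nu mu : probability T R.

Definition density nu (la : {sigma_finite_measure set T -> \bar R}) :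
    T -> \bar R :=
  'd (charge_of_finite_measure nu) '/d la.

Definition total_variation_distance nu mu : \bar R :=
  ereal_sup [set `|nu A - mu A| | A in measurable].

Definition hellinger_wrt (la : {sigma_finite_measure set T -> \bar R})
    nu mu : \bar R :=
  (Num.sqrt (1 - \int[la]_x
     Num.sqrt (fine (density nu la x) * fine (density mu la x))))%R%:E.

(* nu + mu dominates both nu and mu, and the choice of the reference measure is
   immaterial by hellinger_wrtE. *)
Definition hellinger nu mu : \bar R :=
  hellinger_wrt (measure_add nu mu) nu mu.

Lemma hellinger_wrtE (la : {sigma_finite_measure set T -> \bar R}) nu mu :
  nu `<< la -> mu `<< la -> hellinger_wrt la nu mu = hellinger nu mu.
Proof.
move=> nula mula; rewrite /hellinger /hellinger_wrt.
set rho := measure_add nu mu.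
have rhoE A : rho A = nu A + mu A by exact: measure_addE.
have rho0 A : rho A = 0 -> nu A = 0 /\ mu A = 0.
  by move=> /eqP; rewrite rhoE padde_eq0// => /andP[/eqP-> /eqP->].
have nurho : nu `<< rho.
  by apply/null_content_dominatesP => A mA A0; have [] := rho0 A A0.
have murho : mu `<< rho.
  by apply/null_content_dominatesP => A mA A0; have [] := rho0 A A0.
have rhola : rho `<< la.
  move/null_content_dominatesP : nula => nula.
  move/null_content_dominatesP : mula => mula.
  apply/null_content_dominatesP => A mA A0.
  by rewrite [LHS]rhoE nula// mula// adde0.
pose g := density nu rho; pose h := density mu rho.
pose r := 'd (charge_of_finite_measure rho) '/d la.
have intg : rho.-integrable setT g by exact: Radon_Nikodym_integrable.
have inth : rho.-integrable setT h by exact: Radon_Nikodym_integrable.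
have mg : measurable_fun setT g by exact: measurable_int intg.
have mh : measurable_fun setT h by exact: measurable_int inth.
have gfin x : g x \is a fin_num by exact: Radon_Nikodym_fin_num.
have hfin x : h x \is a fin_num by exact: Radon_Nikodym_fin_num.
pose F x := (Num.sqrt (fine (g x) * fine (h x)))%R.
have mF : measurable_fun setT F.
  apply: (@measurableT_comp _ _ _ _ _ _ (@Num.sqrt R)) => //.
    by apply: continuous_measurable_fun; exact: sqrt_continuous.
  by apply: measurable_funM; exact: measurableT_comp.
have intF : rho.-integrable setT (EFin \o F).
  apply: (le_integrable measurableT _ _ (integrableD measurableT
    (integrable_abse intg) (integrable_abse inth))) => //.
    exact/measurable_EFinP.
  move=> x _ /=.
  rewrite -(fineK (gfin x)) -(fineK (hfin x)) /= lee_fin.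
  rewrite [in leRHS]ger0_norm; last exact: addr_ge0.
  rewrite ger0_norm ?sqrtr_ge0// /F.
  move: (fine (g x)) (fine (h x)) => a b.
  rewrite -(@ger0_norm _ (`|a| + `|b|)%R) ?addr_ge0// -sqrtr_sqr ler_wsqrtr//.
  rewrite (le_trans (ler_norm _))// normrM sqrrD.
  have a0 := normr_ge0 a; have b0 := normr_ge0 b; nra.
have r_ge0 : {ae la, forall x, 0 <= r x}.
  have := ae_eq_Radon_Nikodym_SigmaFinite rhola measurableT.
  apply: filterS => x /(_ I) E; rewrite -[r x]E.
  exact: Radon_Nikodym_SigmaFinite.f_ge0.
have nuE := @Radon_Nikodym_chain_rule _ _ _
  (charge_of_finite_measure nu) la rho nurho rhola.
have muE := @Radon_Nikodym_chain_rule _ _ _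
  (charge_of_finite_measure mu) la rho murho rhola.
have mr : measurable_fun setT r.
  exact: measurable_int (Radon_Nikodym_integrable _).
congr ((Num.sqrt (1 - fine _))%:E).
rewrite -[RHS](Radon_Nikodym_change_of_variables rhola measurableT intF).
apply: ae_eq_integral => //.
- apply/measurable_EFinP.
  apply: (@measurableT_comp _ _ _ _ _ _ (@Num.sqrt R)) => //.
    by apply: continuous_measurable_fun; exact: sqrt_continuous.
  by apply: measurable_funM; apply: measurableT_comp => //;
    exact: measurable_int (Radon_Nikodym_integrable _).
- by apply: emeasurable_funM => //; exact/measurable_EFinP.
- move: nuE muE r_ge0; apply: filterS3 => x /(_ I) nux /(_ I) mux rx _ /=.
  have -> : density nu la x = g x * r x by exact: nux.
  have -> : density mu la x = h x * r x by exact: mux.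
  have rfin : r x \is a fin_num by exact: Radon_Nikodym_fin_num.
  transitivity (F x * fine (r x))%:E; last by rewrite EFinM fineK.
  rewrite !fineM ?gfin ?hfin// /F.
  have {}rx : (0 <= fine (r x))%R by exact: fine_ge0.
  rewrite mulrACA -expr2 [(_ * _ ^+ 2)%R]mulrC sqrtrM ?sqr_ge0//.
  by rewrite sqrtr_sqr ger0_norm// mulrC.
Qed.

Definition kullback nu mu : \bar R :=
  if `[< nu `<< mu >] then \int[nu]_x lne (density nu mu x) else +oo.

Definition chi2 nu mu : \bar R :=
  if `[< nu `<< mu >] then \int[mu]_x (`|density nu mu x - 1| ^+ 2) else +oo.

End distances.

Section distances_rV.
Local Open Scope ereal_scope.
Context (R : realType) (n : nat).
Implicit Types nu mu : probability 'rV[R]_n R.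

Definition couplings nu mu : set (probability ('rV[R]_n * 'rV[R]_n)%type R) :=
  [set ga | (forall A, measurable A -> ga (fst @^-1` A) = nu A) /\
            (forall A, measurable A -> ga (snd @^-1` A) = mu A)].

Definition wasserstein nu mu : \bar R :=
  sqrte (ereal_inf [set \int[ga]_z ((enorm (z.1 - z.2) ^+ 2)%R)%:E
                   | ga in couplings nu mu]).

(* A density is only defined up to a null set while its gradient is pointwise:
   f ranges over the differentiable functions that represent dnu/dmu. There is
   at most one when mu charges every nonempty open set, and the infimum is +oo
   if there is none. *)
Definition differentiable_density nu mu (f : 'rV[R]_n -> R) : Prop :=
  [/\ forall x, (0 <= f x)%R, forall x, differentiable f x &
      forall A, measurable A -> nu A = \int[mu]_(x in A) (f x)%:E].

Definition fisher nu mu : \bar R :=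
  if `[< nu `<< mu >] then
    ereal_inf [set \int[nu]_x
                     ((enorm (gradient (fun y => ln (f y)) x) ^+ 2)%R)%:E
              | f in differentiable_density nu mu]
  else +oo.

End distances_rV.

Inductive distance := Wasserstein | TV | Hellinger | Kullback | Chi2 | Fisher.

Definition dist (k : distance) (R : realType) n
    (nu mu : probability 'rV[R]_n R) : \bar R :=
  match k with
  | Wasserstein => wasserstein nu mu
  | TV => total_variation_distance nu mu
  | Hellinger => hellinger nu mu
  | Kullback => kullback nu mu
  | Chi2 => chi2 nu mu
  | Fisher => fisher nu mu
  end.

Definition dist_max (R : realType) (k : distance) : \bar R :=
  match k with
  | TV | Hellinger => 1%E
  | Wasserstein | Kullback | Chi2 | Fisher => +oo%E
  end.

Definition cutoff (R : realType) (k : distance) (n : nat) : R :=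
  match k with
  | Wasserstein => 2^-1 * ln n%:R
  | TV | Hellinger | Kullback | Chi2 => ln n%:R
  | Fisher => 3 / 2 * ln n%:R
  end.

Section stochastic_processes.
Context d (T : measurableType d) (R : realType) (P : probability T R).

(* As A i can be the full space, the product rule for the whole family is also
   the one for its subfamilies. *)
Definition mutually_independent d' (T' : measurableType d') (I : finType)
    (X : I -> T -> T') : Prop :=
  forall A : I -> set T', (forall i, measurable (A i)) ->
    P [set w | forall i, A i (X i w)] = (\prod_i P (X i @^-1` A i))%E.

Variable n : nat.

Record brownian_motion (B : R -> {RV P >-> 'rV[R]_n}) : Prop := {
  brownian_start : {ae P, forall w, B 0 w = 0} ;
  brownian_continuous :
    {ae P, forall w, {within `[0%R, +oo[, continuous (fun t => B t w)}} ;
  brownian_increment : forall s t : R, 0 <= s < t ->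
    forall A, measurable A ->
      P [set w | A (B t w - B s w)] = gaussian 0 (Num.sqrt (t - s)) A ;
  brownian_independence : forall (m : nat) (t : nat -> R), 0 <= t 0%N ->
    (forall j, (j < m)%N -> t j <= t j.+1) ->
    mutually_independent (fun (j : 'I_m) w => B (t j.+1) w - B (t j) w) }.

(* The noise is additive, so that the stochastic differential equation
   dZ = sqrt(2/n) dB - Z dt is a pathwise integral equation. *)
Record ornstein_uhlenbeck (B : R -> {RV P >-> 'rV[R]_n}) (z0 : 'rV[R]_n)
    (Z : R -> {RV P >-> 'rV[R]_n}) : Prop := {
  ou_start : {ae P, forall w, Z 0 w = z0} ;
  ou_continuous :
    {ae P, forall w, {within `[0%R, +oo[, continuous (fun t => Z t w)}} ;
  ou_equation : {ae P, forall w, forall t : R, 0 <= t -> forall i : 'I_n,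
    Z t w ord0 i = Z 0 w ord0 i + Num.sqrt (2 / n%:R) * B t w ord0 i
      - \int[lebesgue_measure]_(s in `[0, t]) Z s w ord0 i} }.

End stochastic_processes.
Arguments brownian_motion {d T R} P {n} B.
Arguments ornstein_uhlenbeck {d T R} P {n} B z0 Z.

Definition ou_invariant (R : realType) (n : nat) : probability 'rV[R]_n R :=
  gaussian 0 (Num.sqrt n%:R^-1).

(* Main.v *)
(* The Euler scheme of step t/m driven by the increments of B is a Gaussian chain
   and converges pathwise to Z_t, so that Z_t has the law
   N(e^{-t} z0, (1 - e^{-2t})/n I_n). Write q = e^{-2t} and a = n q |z0|^2. The
   density f of this law with respect to N(0, I_n/n) is a product of explicit
   one-dimensional ratios, and under N(0, I_n/n)
     int sqrt f <= exp(-a/8)  and  int f^2 <= exp(n q^2 + a).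
   The inequalities 1 - int sqrt f <= TV, -2 ln (int sqrt f) <= Kullback <= chi2
   = int f^2 - 1, TV^2 <= chi2 and 2 Hellinger^2 <= chi2 then reduce TV,
   Hellinger, Kullback and chi2 to the behaviour of a, which is of order
   n^{2 - 2y} at time t = y log n: the cutoff is at y = 1. The Wasserstein
   distance is governed by the squared distance q |z0|^2 of the means, of order
   n^{1 - 2y}, and the Fisher information by n^2 q |z0|^2, of order n^{3 - 2y}. *)
Require Import Defs.
From HB Require Import structures.
From mathcomp Require Import all_boot all_order all_algebra.
From mathcomp Require Import all_classical all_reals all_analysis.
From mathcomp Require Import measurable_realfun.
From mathcomp Require Import ring lra.

Set Implicit Arguments.
Unset Strict Implicit.
Unset Printing Implicit Defensive.

Import Order.TTheory GRing.Theory Num.Theory.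
Import numFieldNormedType.Exports.

Local Open Scope classical_set_scope.
Local Open Scope ring_scope.

(** * One-dimensional and product Gaussian laws *)

(** The probabilistic input is the joint law of the increments of [B], while the equation for [Z] is
    a deterministic identity along each path. The Euler scheme joins the two: its value is linear in
    finitely many increments, and its error obeys a recursion from which the increments cancel. The
    laws of the schemes depend on the step; centred and divided by their standard deviation they all
    become N(0, I), and an almost sure limit of variables with one common law has that law. Equality
    of laws of row vectors is tested on products of open half-lines, where product laws factor.

    For the distances only powers of n matter, so every bound is a non-sharp inequality at fixed n
    in terms of q and |z0|^2/n. The condition q <= 1/2, true for large n, gives (1 - q^2)^(-1/2) <=
    exp(q^2), whence the term n q^2. This term, and the covariance terms q^2 for Wasserstein and n^2
    q^2 for Fisher, have a smaller power of n than the terms of the means at every y > 0, since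
    |z0|^2 is of order n: the means alone decide the cutoff. *)

Lemma integral_probability_cst d (T : measurableType d) (R : realType)
  (P : probability T R) (r : R) : (\int[P]_x r%:E = r%:E)%E.
Proof.
rewrite integral_cst// -[RHS]mule1; congr (_ * _)%E; exact: probability_setT.
Qed.

Section density.
Local Open Scope ereal_scope.
Context d (T : measurableType d) (R : realType).
Variables (nu : probability T R)
  (mu : {sigma_finite_measure set T -> \bar R}) (f : T -> R).
Hypotheses (mf : measurable_fun setT f) (f0 : forall x, (0 <= f x)%R).
Hypothesis nuE : forall A, measurable A -> nu A = \int[mu]_(x in A) (f x)%:E.

Lemma density_dominates : nu `<< mu.
Proof.
apply/null_content_dominatesP => A mA A0; rewrite nuE//.
by apply: null_set_integral => //; exact/measurable_funTS/measurable_EFinP.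
Qed.

Let dom := density_dominates.

Lemma density_ae_eq : ae_eq mu setT (density nu mu) (EFin \o f).
Proof.
apply: integral_ae_eq => //.
- exact: Radon_Nikodym_integrable.
- exact/measurable_EFinP.
- by move=> A _ mA; rewrite -Radon_Nikodym_integral//= -nuE.
Qed.

(** The change of variables holds for [Radon_Nikodym_SigmaFinite.f], which is nonnegative
    everywhere; it agrees almost everywhere with [density nu mu], hence with [f]. *)
Lemma ge0_integral_density D (g : T -> \bar R) : measurable D ->
  measurable_fun setT g -> (forall x, 0 <= g x) ->
  \int[nu]_(x in D) g x = \int[mu]_(x in D) (g x * (f x)%:E).
Proof.
move=> mD mg g0.
rewrite -(Radon_Nikodym_SigmaFinite.change_of_variables dom)//; last first.
  exact: measurable_funTS.
have mr : measurable_fun setT (Radon_Nikodym_SigmaFinite.f nu mu).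
  exact: measurable_int (Radon_Nikodym_SigmaFinite.f_integrable dom).
apply: ge0_ae_eq_integral => //.
- by apply: measurable_funTS; exact: emeasurable_funM.
- by apply: measurable_funTS; apply: emeasurable_funM => //; exact/measurable_EFinP.
- move=> x _; rewrite mule_ge0//; exact: Radon_Nikodym_SigmaFinite.f_ge0.
- by move=> x _; rewrite mule_ge0// lee_fin.
have := density_ae_eq; have := ae_eq_Radon_Nikodym_SigmaFinite dom measurableT.
by apply: filterS2 => x /(_ I) -> /(_ I) + _ => /= <-.
Qed.

End density.

Section lebesgue_affine.
Context (R : realType) (a b : R).
Hypothesis a0 : 0 < a.
Local Notation mu := (@lebesgue_measure R).

Let phi (x : measurableTypeR R) : measurableTypeR R := a * x + b.

Let mphi : measurable_fun setT phi.
Proof. by apply: measurable_funD => //; exact: measurable_funM. Qed.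

Let s : {nonneg R} := NngNum (ltW a0).
Let M : {measure set (measurableTypeR R) -> \bar R} :=
  mscale s (measure_function_pushforward__canonical__measure_function_Measure
    mu mphi).

(** The right-hand side is a measure [M] in [A], and the preimage of []x, y]] is an interval [a]
    times shorter, so [M] gives half-open intervals their length. *)
Lemma lebesgue_measure_affine (A : set (measurableTypeR R)) : measurable A ->
  mu A = (a%:E * mu ((fun x => (a * x + b)%R) @^-1` A))%E.
Proof.
move=> mA; apply: (@lebesgue_measure_unique _ M) => // _ [[x y]] _ <-.
rewrite -[RHS]/(a%:E * mu (phi @^-1` `]x, y]))%E lebesgue_measure_itv/=.
have -> : phi @^-1` `]x, y] = `]((x - b) / a), ((y - b) / a)]%classic.
  by apply/seteqP; split=> z /=; rewrite !in_itv/= /phi ltr_pdivrMr// ler_pdivlMr//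
    ltrBlDr lerBrDr mulrC.
rewrite lebesgue_measure_itv/= !lte_fin ltr_pM2r ?invr_gt0// ltrD2r.
case: ifPn => xy; last by rewrite mule0.
by rewrite -!EFinB -EFinM -mulrBl mulrCA divff ?gt_eqF// mulr1; congr EFin; ring.
Qed.

Lemma ge0_integral_affine (f : R -> \bar R) (A : set R) : measurable A ->
  measurable_fun setT f -> (forall x, 0 <= f x)%E ->
  (\int[mu]_(x in A) f x =
   a%:E * \int[mu]_(x in (fun x => (a * x + b)%R) @^-1` A) f (a * x + b)%R)%E.
Proof.
move=> mA mf f0.
rewrite (eq_measure_integral M); last first.
  by move=> B mB _; exact: lebesgue_measure_affine.
rewrite ge0_integral_mscale//; last exact: measurable_funTS.
rewrite ge0_integral_pushforward//; exact: measurable_funTS.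
Qed.

End lebesgue_affine.

Section gauss.
Context (R : realType).
Local Notation mu := (@lebesgue_measure R).

Lemma ge0_integral_normal_prob (m s : R) D (g : R -> \bar R) : measurable D ->
  measurable_fun setT g -> (forall x, 0 <= g x)%E ->
  (\int[normal_prob m s]_(x in D) g x = \int[mu]_(x in D) (g x * (normal_pdf m s x)%:E))%E.
Proof.
move=> mD mg g0; apply: ge0_integral_density => //.
- exact: measurable_normal_pdf.
- by move=> x; exact: normal_pdf_ge0.
Qed.

Lemma normal_peakE (s : R) : 0 < s -> normal_peak s = (s * Num.sqrt (2 * pi))^-1.
Proof.
move=> s0; rewrite /normal_peak -mulr_natr -mulrA sqrtrM ?sqr_ge0//.
by rewrite sqrtr_sqr gtr0_norm// [pi * _]mulrC.
Qed.

(** Completing the square makes the integrand a multiple of the normal density with mean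
    [b * r ^+ 2] and deviation [r]. The explicit Gaussian integrals below are all brought to this
    form, with [1 / r ^+ 2] the total precision of the exponent. *)
Lemma integral_expR_quadratic (r b c : R) : 0 < r ->
  (\int[mu]_x (expR (- x ^+ 2 / (2 * r ^+ 2) + b * x + c))%:E =
   (r * Num.sqrt (2 * pi) * expR (c + b ^+ 2 * r ^+ 2 / 2))%:E)%E.
Proof.
move=> r0; pose C := (normal_peak r)^-1 * expR (c + b ^+ 2 * r ^+ 2 / 2).
have pk0 : 0 < normal_peak r by rewrite normal_peak_gt0// gt_eqF.
have C0 : 0 <= C by rewrite mulr_ge0 ?expR_ge0// invr_ge0 ltW.
transitivity (\int[mu]_x (C%:E * (normal_pdf (b * r ^+ 2) r x)%:E))%E.
  apply: eq_integral => x _; rewrite normal_pdfE ?gt_eqF// /C -EFinM; congr EFin.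
  rewrite mulrACA mulVf ?gt_eqF// mul1r /normal_fun -expRD; congr expR.
  by field; rewrite gt_eqF.
rewrite ge0_integralZl//; last 2 first.
- by apply/measurable_EFinP; exact: measurable_normal_pdf.
- by move=> x _; rewrite lee_fin normal_pdf_ge0.
by rewrite integral_normal_pdf mule1 /C normal_peakE// invrK.
Qed.

Lemma normal_prob_affine (m s a b : R) (A : set (measurableTypeR R)) :
  0 < s -> 0 < a -> measurable A ->
  normal_prob m s ((fun x => a * x + b) @^-1` A) = normal_prob (a * m + b) (a * s) A.
Proof.
move=> s0 a0 mA; rewrite /normal_prob.
rewrite [RHS](@ge0_integral_affine _ a b)//; last 2 first.
- by apply/measurable_EFinP; exact: measurable_normal_pdf.
- by move=> x; rewrite lee_fin normal_pdf_ge0.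
rewrite -ge0_integralZl//; last 4 first.
- rewrite -[X in measurable X]setTI.
  have maff : measurable_fun setT (fun x : measurableTypeR R => a * x + b).
    by apply: measurable_funD => //; exact: measurable_funM.
  exact: maff.
- apply: measurable_funTS; apply/measurable_EFinP.
  apply: (measurableT_comp (measurable_normal_pdf _ _)).
  by apply: measurable_funD => //; exact: measurable_funM.
- by move=> x _; rewrite lee_fin normal_pdf_ge0.
- by rewrite lee_fin ltW.
apply: eq_integral => x _; rewrite -EFinM; congr EFin.
have as0 : 0 < a * s by rewrite mulr_gt0.
rewrite !normal_pdfE ?gt_eqF// !normal_peakE// mulrA; congr (_ * _).
  by rewrite -mulrA [in RHS]invfM mulrA divff ?gt_eqF// mul1r.
rewrite /normal_fun; congr expR; field; rewrite !gt_eqF//.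
Qed.

Lemma normal_pdf_expR (m s x : R) : 0 < s ->
  normal_pdf m s x =
  (s * Num.sqrt (2 * pi))^-1 * expR (- (x - m) ^+ 2 / (2 * s ^+ 2)).
Proof.
move=> s0; rewrite normal_pdfE ?gt_eqF// normal_peakE// /normal_fun.
by rewrite -[s ^+ 2 *+ 2]mulr_natl.
Qed.

Let sqrt2pi_gt0 : 0 < Num.sqrt (2 * pi) :> R.
Proof. by rewrite sqrtr_gt0 mulr_gt0// pi_gt0. Qed.

Lemma measurable_expR_quadratic (k b c : R) :
  measurable_fun setT (fun x : R => expR (- x ^+ 2 / k + b * x + c)).
Proof.
apply: (measurableT_comp (@measurable_expR R)).
have mx : measurable_fun setT (fun x : R => - x ^+ 2 / k).
  apply: measurable_funM => //; apply: (measurableT_comp (@oppr_measurable R setT)).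
  exact: measurable_funX.
by apply: measurable_funD => //; apply: measurable_funD => //; exact: measurable_funM.
Qed.

Lemma measurable_normal_pdf2 (a s : R) :
  measurable_fun [set: measurableTypeR R * measurableTypeR R]
    (fun z => normal_pdf (a * z.1) s z.2).
Proof.
(* At [s = 0] the function [normal_pdf] is the indicator of the unit interval. *)
rewrite /normal_pdf; have [_|_] := eqVneq s 0.
  apply: (@measurableT_comp _ _ _ _ _ _
    (\1_`[0, 1] : measurableTypeR R -> R)) => //.
apply: measurable_funM => //.
rewrite /normal_fun; apply: measurableT_comp => //=; apply: measurable_funM => //=.
apply: measurableT_comp => //=; apply: measurable_funX => //=.
by apply: measurable_funB => //; apply: measurable_funM.
Qed.

Lemma integral_normal_pdf_conv (m s t a z : R) : 0 < s -> 0 < t ->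
  (\int[mu]_x (normal_pdf (a * x) t z * normal_pdf m s x)%:E =
  (normal_pdf (a * m) (Num.sqrt (a ^+ 2 * s ^+ 2 + t ^+ 2)) z)%:E)%E.
Proof.
move=> s0 t0; set S2 := a ^+ 2 * s ^+ 2 + t ^+ 2.
have S20 : 0 < S2.
  by apply: ltr_wpDl; [rewrite mulr_ge0// sqr_ge0|exact: exprn_gt0].
pose S := Num.sqrt S2; rewrite -/S.
have S0 : 0 < S by rewrite sqrtr_gt0.
have SS : S ^+ 2 = a ^+ 2 * s ^+ 2 + t ^+ 2 by rewrite sqr_sqrtr// ltW.
pose C := (t * Num.sqrt (2 * pi))^-1 * (s * Num.sqrt (2 * pi))^-1.
have C0 : 0 <= C.
  by rewrite mulr_ge0// invr_ge0 ltW// mulr_gt0.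
(* As a function of [x] the product has precision [a^2 / t^2 + 1 / s^2], which is
   [S^2 / (t * s)^2]. *)
pose r := t * s / S.
have r0 : 0 < r by rewrite divr_gt0// mulr_gt0.
transitivity (\int[mu]_x (C%:E * (expR (- x ^+ 2 / (2 * r ^+ 2) +
  (a * z / t ^+ 2 + m / s ^+ 2) * x +
  (- z ^+ 2 / (2 * t ^+ 2) - m ^+ 2 / (2 * s ^+ 2))))%:E))%E.
  apply: eq_integral => x _; rewrite !normal_pdf_expR// -EFinM; congr EFin.
  rewrite mulrACA; congr (_ * _); rewrite -expRD; congr expR.
  rewrite /r expr_div_n SS; field.
  by rewrite (gt_eqF t0) (gt_eqF s0) exprMn -/S2 gt_eqF.
rewrite ge0_integralZl//; last first.
  by apply/measurable_EFinP; exact: measurable_expR_quadratic.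
rewrite integral_expR_quadratic// -EFinM; congr EFin.
rewrite normal_pdf_expR// mulrA; congr (_ * expR _).
  by rewrite /C /r; field; rewrite !gt_eqF.
rewrite /r expr_div_n SS; field.
by rewrite (gt_eqF t0) (gt_eqF s0) exprMn -/S2 gt_eqF.
Qed.

(** One step of the Euler scheme in one dimension. For fixed [x] the variable [a * x + c * y] is
    normal with mean [a * x]; Tonelli then moves the integral over [x] inside, onto the product of
    the two densities. *)
Lemma normal_prob_conv (m s s' a c : R) (A : set (measurableTypeR R)) :
  0 < s -> 0 < s' -> 0 < c -> measurable A ->
  (\int[normal_prob m s]_x
     normal_prob 0 s' ((fun y => (a * x + c * y)%R) @^-1` A) =
  normal_prob (a * m) (Num.sqrt (a ^+ 2 * s ^+ 2 + (c * s') ^+ 2)) A)%E.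
Proof.
move=> s0 s'0 c0 mA; set t := c * s'.
have t0 : 0 < t by rewrite mulr_gt0.
pose F (z : measurableTypeR R * measurableTypeR R) : \bar R :=
  (normal_pdf (a * z.1) t z.2 * \1_A z.2)%:E.
have mF : measurable_fun setT F.
  apply/measurable_EFinP; apply: measurable_funM; first exact: measurable_normal_pdf2.
  by apply: (@measurableT_comp _ _ _ _ _ _
    (\1_A : measurableTypeR R -> R)) => //.
have F0 z : (0 <= F z)%E by rewrite lee_fin mulr_ge0// normal_pdf_ge0.
pose G (z : measurableTypeR R * measurableTypeR R) : \bar R :=
  (F z * (normal_pdf m s z.1)%:E)%E.
have mG : measurable_fun setT G.
  apply: emeasurable_funM => //; apply/measurable_EFinP.
  exact: (measurableT_comp (measurable_normal_pdf _ _) measurable_fst).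
have G0 z : (0 <= G z)%E by rewrite mule_ge0// lee_fin normal_pdf_ge0.
transitivity (\int[normal_prob m s]_x \int[mu]_y F (x, y))%E.
  apply: eq_integral => x _.
  transitivity (normal_prob (a * x) t A).
    rewrite (_ : a * x = c * 0 + a * x); last by rewrite mulr0 add0r.
    rewrite -normal_prob_affine//.
    by congr (normal_prob _ _ _); apply/seteqP; split => y /=; rewrite addrC mulr0 add0r.
  rewrite /normal_prob integral_mkcond; apply: eq_integral => y _.
  by rewrite /F/= epatch_indic EFinM.
rewrite ge0_integral_normal_prob//; last 2 first.
- exact: measurable_fun_fubini_tonelli_F.
- by move=> x; exact: integral_ge0.
transitivity (\int[mu]_x \int[mu]_y G (x, y))%E.
  apply: eq_integral => x _; rewrite -ge0_integralZr//.
  - exact: measurableT_comp.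
  - by rewrite lee_fin normal_pdf_ge0.
rewrite fubini_tonelli//.
rewrite /normal_prob [RHS]integral_mkcond; apply: eq_integral => y _.
rewrite epatch_indic -integral_normal_pdf_conv// -ge0_integralZr//.
- by apply: eq_integral => x _; rewrite /G /F/= -!EFinM mulrAC.
- apply/measurable_EFinP; apply: measurable_funM; last exact: measurable_normal_pdf.
  exact: (measurableT_comp (measurable_normal_pdf2 a t) (measurable_pair2 y)).
- by move=> x _; rewrite lee_fin mulr_ge0// normal_pdf_ge0.
- by rewrite lee_fin.
Qed.

Lemma normal_prob_second_moment (m s : R) : 0 < s ->
  (\int[normal_prob m s]_x ((x - m) ^+ 2)%:E <= (8 * s ^+ 2)%:E)%E.
Proof.
(* [u <= expR u] for [u = (x - m)^2 / (4 s^2)] leaves a Gaussian integral; the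
   constant is not sharp. *)
move=> s0.
have mq (k : R) : measurable_fun [set: R] (fun x => (x - k) ^+ 2).
  by apply: measurable_funX; exact: measurable_funB.
rewrite ge0_integral_normal_prob//; last 2 first.
- by apply/measurable_EFinP; exact: mq.
- by move=> x; rewrite lee_fin sqr_ge0.
pose r := Num.sqrt 2 * s.
have r0 : 0 < r by rewrite mulr_gt0// sqrtr_gt0.
have r2 : r ^+ 2 = 2 * s ^+ 2 by rewrite /r exprMn sqr_sqrtr.
pose C := 4 * s ^+ 2 * (s * Num.sqrt (2 * pi))^-1.
have C0 : 0 <= C.
  by rewrite mulr_ge0// ?invr_ge0 ?mulr_ge0 ?sqr_ge0// ltW.
apply: (@le_trans _ _ (\int[mu]_x (C%:E * (expR (- x ^+ 2 / (2 * r ^+ 2) +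
   (m / (2 * s ^+ 2)) * x + - m ^+ 2 / (4 * s ^+ 2)))%:E))%E).
  apply: ge0_le_integral => //=.
  - by move=> x _; rewrite mule_ge0// lee_fin ?sqr_ge0 ?normal_pdf_ge0.
  - apply: emeasurable_funM; apply/measurable_EFinP; first exact: mq.
    exact: measurable_normal_pdf.
  - apply: emeasurable_funM => //; apply/measurable_EFinP.
    exact: measurable_expR_quadratic.
  move=> x _; rewrite -!EFinM lee_fin normal_pdf_expR//.
  rewrite mulrCA /C [4 * _ * _]mulrC -[leRHS]mulrA ler_wpM2l//.
    by rewrite invr_ge0 ltW// mulr_gt0.
  pose u := (x - m) ^+ 2 / (4 * s ^+ 2).
  have -> : (x - m) ^+ 2 = 4 * s ^+ 2 * u by rewrite /u; field; rewrite gt_eqF.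
  rewrite -[leLHS]mulrA ler_wpM2l ?mulr_ge0 ?sqr_ge0 ?(ltW s0)//.
  rewrite (_ : _ + _ + _ = u + (- (4 * s ^+ 2 * u) / (2 * s ^+ 2))); last first.
    by rewrite r2 /u; field; rewrite gt_eqF.
  rewrite expRD ler_wpM2r ?expR_ge0// (le_trans _ (expR_ge1Dx u))//.
  by rewrite lerDr.
rewrite ge0_integralZl//; last first.
  by apply/measurable_EFinP; exact: measurable_expR_quadratic.
rewrite integral_expR_quadratic// -EFinM lee_fin r2.
rewrite (_ : _ + _ = 0); last by field; rewrite gt_eqF.
rewrite expR0 mulr1 /C /r.
rewrite [leLHS](_ : _ = 4 * Num.sqrt 2 * s ^+ 2); last first.
  by field; rewrite (gt_eqF s0) gt_eqF.
rewrite ler_wpM2r ?sqr_ge0//.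
have : Num.sqrt 2 <= 2 :> R.
  by rewrite -[leRHS](ger0_norm (ler0n _ 2)) -sqrtr_sqr ler_wsqrtr//; lra.
lra.
Qed.

End gauss.

Section normal_ratio.
Context (R : realType).

Lemma sqrtr_expR (x : R) : Num.sqrt (expR x) = expR (x / 2).
Proof.
rewrite -[RHS]ger0_norm ?expR_ge0// -sqrtr_sqr -expRM_natl.
by congr (Num.sqrt (expR _)); field.
Qed.

(** The density of [normal_prob m s] with respect to [normal_prob 0 sigma]. In closed form its
    square root and its square are again exponentials of quadratic polynomials. *)
Definition normal_ratio (m s sigma x : R) : R :=
  sigma / s * expR (- (x - m) ^+ 2 / (2 * s ^+ 2) + x ^+ 2 / (2 * sigma ^+ 2)).

Let sqrt2pi_gt0 : 0 < Num.sqrt (2 * pi) :> R.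
Proof. by rewrite sqrtr_gt0 mulr_gt0// pi_gt0. Qed.

Lemma normal_ratio_gt0 m s sigma x : 0 < s -> 0 < sigma ->
  0 < normal_ratio m s sigma x.
Proof. by move=> s0 t0; rewrite mulr_gt0 ?divr_gt0 ?expR_gt0. Qed.

Lemma measurable_normal_ratio m s sigma : s != 0 -> sigma != 0 ->
  measurable_fun setT (normal_ratio m s sigma).
Proof.
move=> s0 t0; apply: measurable_funM => //.
apply: (measurableT_comp (@measurable_expR R)); apply: measurable_funD.
  apply: measurable_funM => //; apply: (measurableT_comp (@oppr_measurable R setT)).
  by apply: measurable_funX; exact: measurable_funB.
by apply: measurable_funM => //; exact: measurable_funX.
Qed.

Lemma normal_pdf_ratio m s sigma x : 0 < s -> 0 < sigma ->
  normal_pdf m s x = normal_ratio m s sigma x * normal_pdf 0 sigma x.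
Proof.
move=> s0 t0; rewrite !normal_pdf_expR// /normal_ratio subr0 mulrACA -expRD.
congr (_ * expR _); first by field; rewrite !gt_eqF.
by field; rewrite !gt_eqF.
Qed.

Lemma normal_prob_ratio m s sigma A : 0 < s -> 0 < sigma -> measurable A ->
  (normal_prob m s A =
   \int[normal_prob 0 sigma]_(x in A) (normal_ratio m s sigma x)%:E)%E.
Proof.
move=> s0 t0 mA; rewrite ge0_integral_normal_prob//.
- by apply: eq_integral => x _; rewrite (normal_pdf_ratio _ _ s0 t0) EFinM.
- by apply/measurable_EFinP; apply: measurable_normal_ratio; rewrite gt_eqF.
- by move=> x; rewrite lee_fin ltW// normal_ratio_gt0.
Qed.

(** The exact value is the right-hand side times the square root of
    [2 * s * sigma / (s^2 + sigma^2)], which is at most 1 by the arithmetic-geometric inequality. *)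
Lemma integral_sqrt_normal_ratio m s sigma : 0 < s -> 0 < sigma ->
  (\int[normal_prob 0 sigma]_x (Num.sqrt (normal_ratio m s sigma x))%:E <=
   (expR (- m ^+ 2 / (4 * (s ^+ 2 + sigma ^+ 2))))%:E)%E.
Proof.
move=> s0 t0.
have st0 : 0 < s ^+ 2 + sigma ^+ 2 by rewrite addr_gt0// exprn_gt0.
rewrite ge0_integral_normal_prob//; last first.
  apply/measurable_EFinP; apply: (@measurableT_comp _ _ _ _ _ _ (@Num.sqrt R)).
    by apply: continuous_measurable_fun; exact: sqrt_continuous.
  by apply: measurable_normal_ratio; rewrite gt_eqF.
(* The square root averages the two exponents: [1 / r2] is the half-sum of the precisions [1 / s^2]
   and [1 / sigma^2]. *)
pose r2 := 2 * s ^+ 2 * sigma ^+ 2 / (s ^+ 2 + sigma ^+ 2).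
have r20 : 0 < r2 by rewrite divr_gt0// !mulr_gt0// exprn_gt0.
pose r := Num.sqrt r2; have r0 : 0 < r by rewrite sqrtr_gt0.
have rr : r ^+ 2 = r2 by rewrite sqr_sqrtr// ltW.
pose C := Num.sqrt (sigma / s) * (sigma * Num.sqrt (2 * pi))^-1.
have C0 : 0 <= C.
  by rewrite mulr_ge0// invr_ge0 ltW// mulr_gt0.
rewrite (eq_integral (fun x : measurableTypeR R => C%:E * (expR (- x ^+ 2 / (2 * r ^+ 2) +
   (m / (2 * s ^+ 2)) * x + - m ^+ 2 / (4 * s ^+ 2)))%:E)%E); last first.
  move=> x _; rewrite -!EFinM normal_pdf_expR// /normal_ratio; congr EFin.
  rewrite sqrtrM ?divr_ge0 ?ltW// mulrACA; congr (_ * _).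
  rewrite sqrtr_expR -expRD; congr expR.
  rewrite rr /r2; field.
  by rewrite ?(gt_eqF s0) ?(gt_eqF t0) ?(gt_eqF st0).
rewrite ge0_integralZl//; last first.
  by apply/measurable_EFinP; exact: measurable_expR_quadratic.
rewrite integral_expR_quadratic// -EFinM lee_fin mulrA.
rewrite (_ : _ + _ * _ * _ / _ = - m ^+ 2 / (4 * (s ^+ 2 + sigma ^+ 2))); last first.
  rewrite rr /r2; field.
  by rewrite ?(gt_eqF s0) ?(gt_eqF t0) ?(gt_eqF st0).
rewrite ler_piMl ?expR_ge0// /C.
rewrite [leLHS](_ : _ = Num.sqrt (sigma / s) * r / sigma); last first.
  by field; rewrite !gt_eqF.
rewrite ler_pdivrMr// mul1r /r -sqrtrM; last by rewrite divr_ge0// ltW.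
rewrite -[leRHS]gtr0_norm// -sqrtr_sqr ler_wsqrtr// /r2.
rewrite [leLHS](_ : _ = 2 * s * sigma ^+ 3 / (s ^+ 2 + sigma ^+ 2)); last first.
  by field; rewrite !gt_eqF.
rewrite ler_pdivrMr//.
have := sqr_ge0 (s - sigma); have := sqr_ge0 sigma; nra.
Qed.

(** The exact value is [(1 - q^2)^(-1/2) * expR (m^2 / (sigma^2 * (1 + q)))]. The first factor is at
    most [expR (q^2)] because [(1 + 2 q^2) (1 - q^2) >= 1] as soon as [q^2 <= 1/2]; in the second
    the factor [1 / (1 + q)] is dropped. *)
Lemma integral_normal_ratio_sqr m s sigma q : 0 < s -> 0 < sigma ->
  0 <= q <= 2^-1 -> s ^+ 2 = (1 - q) * sigma ^+ 2 ->
  (\int[normal_prob 0 sigma]_x (normal_ratio m s sigma x ^+ 2)%:E <=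
   (expR (q ^+ 2 + m ^+ 2 / sigma ^+ 2))%:E)%E.
Proof.
move=> s0 t0 /andP[q0 q1] s2.
have q0' : 0 < 1 + q by rewrite ltr_wpDr.
have q1' : 0 < 1 - q by lra.
rewrite ge0_integral_normal_prob//; last 2 first.
- apply/measurable_EFinP; apply: measurable_funX.
  by apply: measurable_normal_ratio; rewrite gt_eqF.
- by move=> x; rewrite lee_fin sqr_ge0.
(* The precision left by the squared ratio is [2 / s^2 - 1 / sigma^2], that is [(1 + q) / s^2]. *)
pose r := s / Num.sqrt (1 + q).
have sq0 : 0 < Num.sqrt (1 + q) by rewrite sqrtr_gt0.
have r0 : 0 < r by rewrite divr_gt0.
have rr : r ^+ 2 = s ^+ 2 / (1 + q) by rewrite /r expr_div_n sqr_sqrtr// ltW.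
pose C := (sigma / s) ^+ 2 * (sigma * Num.sqrt (2 * pi))^-1.
have C0 : 0 <= C.
  by rewrite mulr_ge0 ?sqr_ge0// invr_ge0 ltW// mulr_gt0.
rewrite (eq_integral (fun x : measurableTypeR R => C%:E * (expR (- x ^+ 2 / (2 * r ^+ 2) +
   (2 * m / s ^+ 2) * x + - m ^+ 2 / s ^+ 2))%:E)%E); last first.
  move=> x _; rewrite -!EFinM normal_pdf_expR// /normal_ratio; congr EFin.
  rewrite exprMn mulrACA; congr (_ * _).
  rewrite -expRM_natl -expRD; congr expR.
  rewrite rr s2; field.
  by rewrite ?(gt_eqF t0) ?(gt_eqF q0') ?(gt_eqF q1').
rewrite ge0_integralZl//; last first.
  by apply/measurable_EFinP; exact: measurable_expR_quadratic.
rewrite integral_expR_quadratic// -EFinM lee_fin mulrA.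
rewrite (_ : _ + _ * _ * _ / _ = m ^+ 2 / sigma ^+ 2 * (1 + q)^-1); last first.
  rewrite rr s2; field.
  by rewrite ?(gt_eqF t0) ?(gt_eqF q0') ?(gt_eqF q1').
rewrite expRD ler_pM ?expR_ge0//.
- by rewrite mulr_ge0// mulr_ge0// ?(ltW r0) ?(ltW sqrt2pi_gt0).
- rewrite /C /r.
  rewrite [leLHS](_ : _ = sigma / (s * Num.sqrt (1 + q))); last first.
    by field; rewrite !gt_eqF.
  rewrite ler_pdivrMr ?mulr_gt0//.
  have E0 := expR_gt0 (q ^+ 2).
  rewrite -ler_sqr ?nnegrE ?mulr_ge0 ?(ltW t0) ?(ltW s0) ?(ltW E0) ?(ltW sq0)//.
  rewrite !exprMn s2 sqr_sqrtr ?(ltW q0')// -expRM_natl.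
  have := expR_ge1Dx (2%:R * q ^+ 2); set e := expR _ => He.
  rewrite [leRHS](_ : _ = sigma ^+ 2 * (e * (1 - q ^+ 2))); last by ring.
  rewrite ler_peMr ?sqr_ge0//.
  have u0 : 0 <= q ^+ 2 by exact: sqr_ge0.
  have u1 : q ^+ 2 <= 2^-1 by nra.
  have u2 : 0 <= (e - (1 + 2 * q ^+ 2)) * (1 - q ^+ 2).
    by rewrite mulr_ge0// subr_ge0//; lra.
  have u3 : 0 <= q ^+ 2 * (2^-1 - q ^+ 2) by rewrite mulr_ge0// subr_ge0.
  nra.
- rewrite ler_expR ler_piMr ?divr_ge0 ?sqr_ge0// invf_le1//; lra.
Qed.

End normal_ratio.

Section measure_density.
Local Open Scope ereal_scope.
Context d (T : measurableType d) (R : realType).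
Variables (mu : {measure set T -> \bar R}) (f : T -> R).
Hypotheses (mf : measurable_fun setT f) (f0 : forall x, (0 <= f x)%R).

Let m (A : set T) := \int[mu]_(x in A) (f x)%:E.

Let m0 : m set0 = 0. Proof. exact: integral_set0. Qed.

Let m_ge0 A : 0 <= m A.
Proof. by apply: integral_ge0 => x _; rewrite lee_fin. Qed.

Let m_additive : semi_sigma_additive m.
Proof.
move=> A mA tA mUA; rewrite /m ge0_integral_bigcup//.
- by apply: is_cvg_ereal_nneg_natsum_cond => n _ _; exact: m_ge0.
- by apply: measurable_funTS; exact/measurable_EFinP.
- by move=> x _; rewrite lee_fin.
Qed.

HB.instance Definition _ := isMeasure.Build _ _ _ m m0 m_ge0 m_additive.

(** Bundled as a measure so that a law given by a density can be compared with another one by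
    uniqueness of measures. *)
Definition measure_density : {measure set T -> \bar R} := m.

Lemma measure_densityE A : measure_density A = \int[mu]_(x in A) (f x)%:E.
Proof. by []. Qed.

End measure_density.

(** * Measures on row vectors: uniqueness on rays, product laws *)

Section rV.
Context (R : realType).

(** Thresholds are extended reals: [-oo] frees a coordinate, so the whole space and every coordinate
    half-space are rays, and coordinatewise maxima of thresholds give intersections. *)
Definition ray n (a : 'I_n -> \bar R) : set 'rV[R]_n :=
  [set x | forall i, (a i < (x ord0 i)%:E)%E].

Lemma measurable_box n (A : 'I_n -> set (measurableTypeR R)) :
  (forall i, measurable (A i)) ->
  measurable [set x : 'rV[R]_n | forall i, A i (x ord0 i)].
Proof.
move=> mA.
have -> : [set x : 'rV[R]_n | forall i, A i (x ord0 i)] =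
    \bigcap_(i in [set: 'I_n])
      ((fun x : 'rV[R]_n => x ord0 i : measurableTypeR R) @^-1` A i).
  by apply/seteqP; split=> x /= h i; [move=> _; exact: h|exact: h].
apply: fin_bigcap_measurable => // i _.
rewrite -[X in measurable X]setTI.
exact: (measurable_coord i measurableT (mA i)).
Qed.

Lemma measurable_lt_fin (a : \bar R) :
  measurable [set x : measurableTypeR R | (a < x%:E)%E].
Proof.
case: a => [r||] /=.
- rewrite (_ : [set _ | _] = `]r, +oo[%classic) //.
  by apply/seteqP; split => x /=; rewrite in_itv/= lte_fin andbT.
- rewrite (_ : [set _ | _] = set0) //.
  by apply/seteqP; split => x //=; rewrite ltNge leey.
- rewrite (_ : [set _ | _] = setT) //.
  by apply/seteqP; split => x //= _; rewrite ltNyr.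
Qed.

Lemma measurable_ray n (a : 'I_n -> \bar R) : measurable (ray a).
Proof. exact: (measurable_box (fun i => measurable_lt_fin (a i))). Qed.

(** The rays form a generating class closed under intersection and containing the whole space. Under
    a product law the mass of a ray is a product, which reduces identities between laws to one
    dimension. *)
Lemma ray_measure_unique n (m1 m2 : {measure set 'rV[R]_n -> \bar R}) :
  (m1 setT < +oo)%E -> (forall a, m1 (ray a) = m2 (ray a)) ->
  forall A, measurable A -> m1 A = m2 A.
Proof.
move=> m1T m12 A mA.
pose G : set (set 'rV[R]_n) := [set B | exists a, B = ray a].
have GT : ray (fun=> -oo%E) = [set: 'rV[R]_n].
  by apply/seteqP; split => x //= _ i; rewrite ltNyr.
apply: (@measure_unique _ R _ G (fun=> setT) _ _ _ _ m1 m2) => //.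
- apply/seteqP; split; last first.
    apply: smallest_sub; first exact: sigma_algebra_measurable.
    by move=> _ [a ->]; exact: measurable_ray.
  apply: smallest_sub; first exact: smallest_sigma_algebra.
  rewrite -bigcup_seq/=; apply: bigcup_sub => i Ii.
  have : measurable_fun setT (fun x : g_sigma_algebraType G => (x : 'rV[R]_n) ord0 i).
    apply: (measurability _ (RGenOInfty.measurableE R)).
    move=> _ [_ [r ->] <-]; rewrite setTI; apply: sub_sigma_algebra.
    exists (fun j => if j == i then r%:E else -oo%E).
    apply/seteqP; split => x /=.
      rewrite in_itv/= andbT => rx j; case: eqP => [->|_]; last by rewrite ltNyr.
      by rewrite lte_fin.
    by move=> /(_ i); rewrite eqxx lte_fin in_itv/= andbT.
  by move=> mi B [C mC <-]; exact: mi.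
- move=> _ _ [a ->] [b ->]; exists (fun i => maxe (a i) (b i)).
  apply/seteqP; split => x /=.
    by move=> [ha hb] i; rewrite gt_max ha hb.
  by move=> h; split => i; have := h i; rewrite gt_max => /andP[].
- by move=> _; exists (fun=> -oo%E); rewrite GT.
- by apply/seteqP; split => // x _; exists 0%N.
- by move=> _ [a ->]; exact: m12.
Qed.

(** Induction on the dimension: Tonelli separates the first coordinate, and the other factors come
    out of the inner integral by induction. *)
Lemma integral_rV_prod n (mu : 'I_n -> probability (measurableTypeR R) R)
    (g : 'I_n -> R -> R) :
  (forall i, measurable_fun setT (g i)) -> (forall i x, 0 <= g i x) ->
  (\int[rV_prod mu]_x (\prod_i g i (x ord0 i))%:E =
   \prod_i \int[mu i]_x (g i x)%:E)%E.
Proof.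
have mprod k (f : 'I_k -> R -> R) : (forall i, measurable_fun setT (f i)) ->
    measurable_fun setT (fun x : 'rV[R]_k => \prod_i f i (x ord0 i)).
  move=> mf; apply: measurable_prod => i _.
  exact: (measurableT_comp (mf i) (measurable_coord i)).
elim: n => [|n IH] in mu g * => mg g0.
  rewrite big_ord0/= integral_dirac//; last by apply/measurable_EFinP; exact: mprod.
  by rewrite diracT mul1e big_ord0.
rewrite big_ord_recl -IH//=.
rewrite ge0_integral_distribution//; last 2 first.
- by apply/measurable_EFinP; exact: mprod.
- by move=> x; rewrite lee_fin prodr_ge0.
pose f (z : measurableTypeR R * 'rV[R]_n) : \bar R :=
  (g ord0 z.1 * \prod_i g (lift ord0 i) (z.2 ord0 i))%:E.
have mf : measurable_fun setT f.
  apply/measurable_EFinP; apply: measurable_funM.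
    exact: (measurableT_comp (mg ord0) measurable_fst).
  exact: (measurableT_comp (mprod _ _ (fun i => mg (lift ord0 i))) measurable_snd).
have f0 z : (0 <= f z)%E by rewrite lee_fin mulr_ge0// prodr_ge0.
transitivity (\int[mu ord0 \x rV_prod (fun i => mu (lift ord0 i))]_z f z)%E.
  apply: eq_integral => z _; rewrite /f/= big_ord_recl; congr (_ * _)%:E.
    by rewrite /rV_cons mxE unlift_none.
  by apply: eq_bigr => i _; rewrite /rV_cons mxE liftK.
rewrite fubini_tonelli1//.
rewrite -ge0_integralZr//.
- apply: eq_integral => x _; rewrite /fubini_F /f/=.
  under eq_integral do rewrite EFinM.
  rewrite ge0_integralZl//.
  - apply/measurable_EFinP; exact: (mprod _ (fun i => g (lift ord0 i))).
  - by move=> y _; rewrite lee_fin prodr_ge0.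
  - by rewrite lee_fin.
- by apply/measurable_EFinP; exact: mg.
- by move=> x _; rewrite lee_fin.
- by apply: integral_ge0 => x _; rewrite lee_fin prodr_ge0.
Qed.

(** The indicator of a ray is itself a product of functions of one coordinate, so on rays both sides
    are products of one-dimensional integrals. *)
Lemma rV_prod_density n (nu mu : 'I_n -> probability (measurableTypeR R) R)
    (f : 'I_n -> R -> R) A :
  (forall i, measurable_fun setT (f i)) -> (forall i x, 0 <= f i x) ->
  (forall i B, measurable B -> nu i B = \int[mu i]_(x in B) (f i x)%:E)%E ->
  measurable A ->
  (rV_prod nu A = \int[rV_prod mu]_(x in A) (\prod_i f i (x ord0 i))%:E)%E.
Proof.
move=> mf f0 nuE mA.
have mF : measurable_fun setT (fun x : 'rV[R]_n => \prod_i f i (x ord0 i)).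
  apply: measurable_prod => i _.
  exact: (measurableT_comp (mf i) (measurable_coord i)).
have F0 (x : 'rV[R]_n) : 0 <= \prod_i f i (x ord0 i) by rewrite prodr_ge0.
rewrite -(measure_densityE (rV_prod mu) mF F0).
apply: ray_measure_unique => //.
  exact: (le_lt_trans (probability_le1 (rV_prod nu) measurableT) (ltry _)).
move=> a; rewrite measure_densityE integral_mkcond.
rewrite [LHS](rV_prodE nu (fun i => measurable_lt_fin (a i))).
rewrite (eq_bigr (fun i => \int[mu i]_x
    (f i x * \1_[set x : measurableTypeR R | (a i < x%:E)%E] x)%:E)%E); last first.
  move=> i _; rewrite nuE//; last exact: measurable_lt_fin.
  rewrite integral_mkcond; apply: eq_integral => x _.
  by rewrite epatch_indic EFinM.
rewrite -integral_rV_prod//; last 2 first.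
- move=> i; apply: measurable_funM => //; apply: measurable_indic.
  exact: measurable_lt_fin.
- by move=> i x; rewrite mulr_ge0.
apply: eq_integral => x _; rewrite epatch_indic -EFinM big_split/=; congr (_ * _)%:E.
rewrite [RHS]indicE; case: (boolP (x \in ray a)) => [|].
  rewrite inE => xa; rewrite big1// => i _.
  by rewrite indicE mem_set//; exact: xa.
rewrite notin_setE => /existsNP[i /negP xa].
by rewrite (bigD1 i)//= indicE memNset ?mul0r//=; exact/negP.
Qed.

End rV.

Section image.
Context d1 d2 (T1 : measurableType d1) (T2 : measurableType d2) (R : realType).
Variables (mu : {measure set T1 -> \bar R}) (f : T1 -> T2).
Hypothesis mf : measurable_fun setT f.

Definition image_measure : {measure set T2 -> \bar R} :=
  measure_function_pushforward__canonical__measure_function_Measure mu mf.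

Lemma image_measureE A : image_measure A = mu (f @^-1` A).
Proof. by []. Qed.

End image.

Section gaussian.
Context (R : realType).

Lemma measurable_rV_affine n (a : R) (b : 'rV[R]_n) :
  measurable_fun setT (fun x : 'rV[R]_n => a *: x + b).
Proof.
apply/measurable_rVP => i; under eq_fun do rewrite !mxE.
by apply: measurable_funD => //; apply: measurable_funM => //; exact: measurable_coord.
Qed.

Lemma measurable_rV_comb n (a c : R) :
  measurable_fun setT (fun z : 'rV[R]_n * 'rV[R]_n => a *: z.1 + c *: z.2).
Proof.
apply/measurable_rVP => i; under eq_fun do rewrite !mxE.
apply: measurable_funD; apply: measurable_funM => //.
  exact: (measurableT_comp (measurable_coord i) measurable_fst).
exact: (measurableT_comp (measurable_coord i) measurable_snd).
Qed.

Lemma measurable_affine_gt (a b : R) (t : \bar R) :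
  measurable [set x : measurableTypeR R | (t < (a * x + b)%:E)%E].
Proof.
rewrite -[X in measurable X]setTI.
have mab : measurable_fun [set: measurableTypeR R] (fun x : R => a * x + b).
  by apply: measurable_funD => //; exact: measurable_funM.
exact: (mab measurableT _ (measurable_lt_fin t)).
Qed.

Lemma gaussian_affine n (m b : 'rV[R]_n) (s a : R) A : 0 < s -> 0 < a ->
  measurable A ->
  gaussian m s ((fun x => a *: x + b) @^-1` A) = gaussian (a *: m + b) (a * s) A.
Proof.
move=> s0 a0 mA; rewrite -(image_measureE _ (measurable_rV_affine a b)).
apply: ray_measure_unique => //.
  rewrite image_measureE preimage_setT.
  exact: (le_lt_trans (probability_le1 (gaussian m s) measurableT) (ltry _)).
move=> t; rewrite image_measureE.
rewrite [RHS](rV_prodE _ (fun i => measurable_lt_fin (t i))).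
transitivity (gaussian m s
    [set x | forall i, (t i < (a * x ord0 i + b ord0 i)%:E)%E]).
  by congr (gaussian _ _ _); apply/seteqP; split=> x /= h i; have := h i; rewrite !mxE.
rewrite [LHS](rV_prodE _ (fun i => measurable_affine_gt a (b ord0 i) (t i))).
apply: eq_bigr => i _ /=; rewrite !mxE -normal_prob_affine//.
exact: measurable_lt_fin.
Qed.

Lemma centered_gaussian_affine n (b : 'rV[R]_n) (s a : R) A : 0 < s -> 0 < a ->
  measurable A ->
  gaussian 0 s ((fun x => a *: x + b) @^-1` A) = gaussian b (a * s) A.
Proof. by move=> s0 a0 mA; rewrite (gaussian_affine _ _ s0 a0 mA) scaler0 add0r. Qed.

(** For a ray, the section at [x] is a box whose mass is a product of functions [g i] of the single
    coordinates of [x]. Integrating over [x] gives a product of one-dimensional convolutions. *)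
Lemma gaussian_conv n (m : 'rV[R]_n) (s s' a c : R) A :
  0 < s -> 0 < s' -> 0 < c -> measurable A ->
  ((gaussian m s \x gaussian 0 s')
    ((fun z : 'rV[R]_n * 'rV[R]_n => (a *: z.1 + c *: z.2)%R) @^-1` A) =
  gaussian (a *: m) (Num.sqrt (a ^+ 2 * s ^+ 2 + (c * s') ^+ 2)) A)%E.
Proof.
move=> s0 s'0 c0 mA; rewrite -(image_measureE _ (measurable_rV_comb a c)).
apply/esym/ray_measure_unique => //.
  exact: (le_lt_trans (probability_le1 (gaussian _ _) measurableT) (ltry _)).
move=> t; rewrite image_measureE [LHS](rV_prodE _ (fun i => measurable_lt_fin (t i))).
have mS i : measurable [set z : measurableTypeR R * measurableTypeR R |
    (t i < (a * z.1 + c * z.2)%:E)%E].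
  rewrite -[X in measurable X]setTI.
  have mac : measurable_fun [set: measurableTypeR R * measurableTypeR R]
      (fun z => a * z.1 + c * z.2).
    by apply: measurable_funD => //; apply: measurable_funM.
  exact: (mac measurableT _ (measurable_lt_fin (t i))).
pose g i (x : R) : R := fine (normal_prob 0 s'
  [set y : measurableTypeR R | (t i < (a * x + c * y)%:E)%E]).
have mY i x : measurable [set y : measurableTypeR R | (t i < (a * x + c * y)%:E)%E].
  rewrite (_ : [set _ | _] = [set y | (t i < (c * y + a * x)%:E)%E]).
    exact: measurable_affine_gt.
  by apply/seteqP; split => y /=; rewrite addrC.
have gE i x : (g i x)%:E = normal_prob 0 s'
    [set y : measurableTypeR R | (t i < (a * x + c * y)%:E)%E].
  by rewrite /g fineK// fin_num_measure.
have mg i : measurable_fun setT (g i).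
  apply/measurable_EFinP; rewrite (_ : EFin \o _ = fun x => normal_prob 0 s'
    (xsection [set z : measurableTypeR R * measurableTypeR R |
    (t i < (a * z.1 + c * z.2)%:E)%E] x)); last first.
    apply/funext => x /=; rewrite gE; congr (normal_prob _ _ _).
    by apply/seteqP; split => y /=; rewrite /xsection/= inE.
  exact: (measurable_fun_xsection (normal_prob 0 s') (mS i)).
rewrite (eq_bigr (fun i => \int[normal_prob (m ord0 i) s]_x (g i x)%:E)%E); last first.
  move=> i _ /=; rewrite mxE -normal_prob_conv//; last exact: measurable_lt_fin.
  by apply: eq_integral => x _; rewrite gE.
rewrite -integral_rV_prod//; last by move=> i x; rewrite fine_ge0.
apply: eq_integral => x _ /=.
rewrite (_ : xsection _ _ =
    [set y : 'rV[R]_n | forall i, (t i < (a * x ord0 i + c * y ord0 i)%:E)%E]).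
  rewrite [RHS](rV_prodE _ (fun i => mY i (x ord0 i))) -prodEFin.
  by apply: eq_bigr => i _ /=; rewrite gE mxE.
apply/seteqP; split => y; rewrite /xsection/= inE/= => h i; have := h i;
  by rewrite !mxE.
Qed.

End gaussian.

(** * The law of the Ornstein-Uhlenbeck process *)

Section joint_law.
Local Open Scope ereal_scope.
Context d d1 d2 (T : measurableType d) (T1 : measurableType d1)
  (T2 : measurableType d2) (R : realType).
Variables (P : probability T R) (U : T -> T1) (V : T -> T2).
Hypotheses (mU : measurable_fun setT U) (mV : measurable_fun setT V).
Variables (E : set T) (g : probability T1 R) (mu : probability T2 R)
  (K : {nonneg R}).
Hypothesis mE : measurable E.

(** The event [E] will constrain the increments still to come, and [K] is its probability.
    Restricted to [E], the image of [P] is a measure on the product space determined by its values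
    on rectangles. *)
Lemma joint_law :
  (forall A B, measurable A -> measurable B ->
    P (U @^-1` A `&` V @^-1` B `&` E) = K%:num%:E * g A * mu B) ->
  forall S, measurable S ->
    P ((fun w => (U w, V w)) @^-1` S `&` E) = K%:num%:E * (g \x mu) S.
Proof.
move=> H S mS.
have mUV : measurable_fun setT (fun w => (U w, V w)).
  exact: measurable_fun_pair.
pose m' := image_measure (mrestr P mE) mUV.
have -> : P ((fun w => (U w, V w)) @^-1` S `&` E) = m' S by [].
rewrite -(@product_measure_unique _ _ _ _ _ (mscale K g) mu m')//.
rewrite /= /product_measure1 ge0_integral_mscale//.
exact: measurable_fun_xsection.
Qed.

End joint_law.

(** * Gaussian chains driven by independent increments *)

Section chain.
Context d (T : measurableType d) (R : realType) (P : probability T R).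
Variables (n m : nat) (D : nat -> T -> 'rV[R]_n) (a c delta : R)
  (z : 'rV[R]_n) (X : nat -> T -> 'rV[R]_n).
Hypotheses (a0 : 0 < a) (c0 : 0 < c) (delta0 : 0 < delta).
Hypothesis mD : forall j, (j < m)%N -> measurable_fun setT (D j).
Hypothesis lawD : forall j A, (j < m)%N -> measurable A ->
  P (D j @^-1` A) = gaussian 0 delta A.
Hypothesis indepD : mutually_independent P (fun j : 'I_m => D j).
Hypothesis X0 : forall w, X 0 w = z.
Hypothesis XS : forall j w, X j.+1 w = a *: X j w + c *: D j w.

(** The value 0 at index 0 only starts the recursion: the chain starts at a point, whose law is not
    a [gaussian], so the laws are stated for [0 < j]. *)
Fixpoint chain_sd j : R :=
  if j is j'.+1 then Num.sqrt (a ^+ 2 * chain_sd j' ^+ 2 + (c * delta) ^+ 2)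
  else 0.

Lemma chain_sd_gt0 j : (0 < j)%N -> 0 < chain_sd j.
Proof.
case: j => // j _ /=; rewrite sqrtr_gt0 ltr_wpDl//.
  by rewrite mulr_ge0// sqr_ge0.
by rewrite exprn_gt0// mulr_gt0.
Qed.

Let mX j : (j <= m)%N -> measurable_fun setT (X j).
Proof.
elim: j => [_|j IH jm].
  rewrite (_ : X 0 = cst z); last exact/funext.
  exact: measurable_cst.
rewrite (_ : X j.+1 = (fun z : 'rV[R]_n * 'rV[R]_n => a *: z.1 + c *: z.2) \o
   (fun w => (X j w, D j w))); last by apply/funext => w /=; rewrite XS.
apply: (measurableT_comp (measurable_rV_comb a c)).
by apply: measurable_fun_pair; [apply: IH; exact: ltnW|exact: mD].
Qed.

(* The future increments are part of the event: this makes the induction go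
   through with the product rule for all the increments as only hypothesis. *)
Lemma chain_joint_law j (A : set 'rV[R]_n) (F : 'I_m -> set 'rV[R]_n) :
  (0 < j <= m)%N -> measurable A -> (forall i, measurable (F i)) ->
  (P [set w | A (X j w) /\ forall i : 'I_m, (j <= i)%N -> F i (D i w)] =
   gaussian (a ^+ j *: z)%R (chain_sd j) A *
     \prod_(i < m | (j <= i)%N) P (D i @^-1` F i))%E.
Proof.
elim: j A F => // -[_|j IH] A F /andP[_ jm] mA mF.
  have mA' : measurable ((fun x => c *: x + a *: z) @^-1` A).
    by rewrite -[X in measurable X]setTI; exact: (measurable_rV_affine c (a *: z) measurableT mA).
  pose i0 : 'I_m := Ordinal jm.
  (* As [X 0] is constant, the constraint on [X 1] is a constraint on [D 0] alone, and the event
     becomes a product event for the increments. *)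
  pose F' (i : 'I_m) := if i == i0 then (fun x => c *: x + a *: z) @^-1` A else F i.
  have i0P (i : 'I_m) : (0 < i)%N = (i != i0) by rewrite lt0n.
  transitivity (P [set w | forall i : 'I_m, F' i (D i w)]).
    congr (P _); apply/seteqP; split => w /=.
      move=> [h1 h2] i; rewrite /F'; case: (eqVneq i i0) => [->|ii0].
        by move: h1; rewrite XS X0 addrC.
      by apply: h2; rewrite i0P.
    move=> h; split.
      by have := h i0; rewrite /F' eqxx/= XS X0 addrC.
    by move=> i; rewrite i0P => /negbTE ii0; have := h i; rewrite /F' ii0.
  rewrite indepD; last by move=> i; rewrite /F'; case: ifP.
  rewrite (bigD1 i0)//=; congr (_ * _)%E.
    rewrite /F' eqxx (lawD _ mA')// expr1.
    rewrite (centered_gaussian_affine _ delta0 c0 mA); congr (gaussian _ _ _).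
    by rewrite expr0n/= mulr0 add0r sqrtr_sqr gtr0_norm// mulr_gt0.
  apply: eq_big => i; first by rewrite -i0P.
  by move=> /negbTE ii0; rewrite /F' ii0.
have jm' : (j.+1 < m)%N by [].
pose i0 : 'I_m := Ordinal jm'.
pose E := [set w | forall i : 'I_m, (j.+2 <= i)%N -> F i (D i w)].
have mE : measurable E.
  have -> : E = \bigcap_(i in [set i : 'I_m | (j.+2 <= i)%N]) (D i @^-1` F i).
    by apply/seteqP; split => w /= h i; exact: h.
  apply: fin_bigcap_measurable => // i _.
  by rewrite -[X in measurable X]setTI; exact: (mD (ltn_ord i) measurableT (mF i)).
(* The probability of the constraints on the increments after [D j.+1]; it is finite, as the
   constant of [joint_law] has to be a nonnegative real. *)
pose k := \big[*%E/1%E]_(i < m | (j.+2 <= i)%N) P (D i @^-1` F i).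
have k0 : (0 <= k)%E by exact: prode_ge0.
have kfin : k \is a fin_num.
  rewrite /k; apply: prode_fin_num => i _; apply: fin_num_measure.
  by rewrite -[X in measurable X]setTI; exact: (mD (ltn_ord i) measurableT (mF i)).
pose K : {nonneg R} := NngNum (fine_ge0 k0).
have KE : K%:num%:E = k by rewrite /= fineK.
rewrite -/k.
pose S := (fun z : 'rV[R]_n * 'rV[R]_n => a *: z.1 + c *: z.2) @^-1` A.
have mS : measurable S.
  by rewrite -[X in measurable X]setTI; exact: (measurable_rV_comb a c measurableT mA).
transitivity (P ((fun w => (X j.+1 w, D j.+1 w)) @^-1` S `&` E)).
  by congr (P _); apply/seteqP; split => w /= -[h1 h2]; split => //; move: h1; rewrite (XS j.+1).
rewrite (@joint_law _ _ _ _ _ _ _ P _ _ _ _ E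
    (gaussian (a ^+ j.+1 *: z) (chain_sd j.+1)) (gaussian 0 delta) K)//.
- rewrite KE muleC; congr (_ * _)%E.
  have sd0 : 0 < chain_sd j.+1 by exact: chain_sd_gt0.
  apply: (eq_trans (gaussian_conv _ _ sd0 delta0 c0 mA)).
  by rewrite scalerA -exprS.
- by apply: mX; exact: ltnW.
- exact: mD.
move=> A1 B1 mA1 mB1.
(* The induction hypothesis for [X j.+1] covers the increment [D j.+1] too. With the constraint [B1]
   put on it, the hypothesis gives the mass of the rectangle [A1], [B1]. *)
pose F' (i : 'I_m) := if i == i0 then B1 else F i.
transitivity (P [set w | A1 (X j.+1 w) /\
    forall i : 'I_m, (j.+1 <= i)%N -> F' i (D i w)]).
  congr (P _); apply/seteqP; split => w /=.
    move=> [[h1 h2] h3]; split => // i ji; rewrite /F'.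
    case: (eqVneq i i0) => [->//|ii0]; apply: h3.
    by rewrite ltn_neqAle ji andbT; apply: contra ii0 => /eqP ij; apply/eqP/val_inj.
  move=> [h1 h2]; split; first split => //.
    by have := h2 i0; rewrite /F' eqxx; exact.
  move=> i ji; have := h2 i (ltnW ji); rewrite /F'; case: eqP => // ii0.
  by move: ji; rewrite ii0 ltnn.
rewrite IH//; last 2 first.
- exact: ltnW.
- by move=> i; rewrite /F'; case: ifP.
rewrite KE (bigD1 i0)//= {1}/F' eqxx lawD// muleA [LHS]muleC -[RHS]muleA.
congr (_ * _)%E.
apply: eq_big => i.
  by rewrite -val_eqE /= [RHS]ltn_neqAle andbC eq_sym.
by move=> /andP[_ /negbTE ii0]; rewrite /F' ii0.
Qed.

Lemma chain_law j A : (0 < j <= m)%N -> measurable A ->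
  P (X j @^-1` A) = gaussian (a ^+ j *: z) (chain_sd j) A.
Proof.
move=> jm mA; transitivity (P [set w | A (X j w) /\
    forall i : 'I_m, (j <= i)%N -> setT (D i w)]).
  by congr (P _); apply/seteqP; split => w //= [].
rewrite (chain_joint_law (F := fun=> setT))// big1 ?mule1// => i _.
by rewrite preimage_setT probability_setT.
Qed.

End chain.

(** * Pathwise convergence of the Euler scheme *)

Section euler.
Context (R : realType).

(** Uniform continuity on a segment, by compactness in its near-covering form. Around each point [f]
    varies by less than [e / 2] within some [d]; halving [d] leaves room for the second point. *)
Lemma within_segment_uniform (f : R -> R) (t e : R) :
  {within `[0, t], continuous f} -> 0 < e ->
  \forall h \near 0^'+, forall x y, 0 <= x <= t -> 0 <= y <= t ->
    `|x - y| < h -> `|f x - f y| < e.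
Proof.
move=> cf e0.
have /compact_near_coveringP ncov := @segment_compact R 0 t.
pose Q (h x : R) := 0 <= x <= t -> forall y, 0 <= y <= t ->
  `|x - y| < h -> `|f x - f y| < e.
have : \forall h \near 0^'+, `[0, t] `<=` Q h.
  apply: ncov => x /= xt.
  have : f y @[y --> within `[0, t] (nbhs x)] --> f x.
    by rewrite (@nbhs_subspace_in _ `[0, t]%classic x xt); exact: cf.
  move=> /cvgrPdist_lt /(_ (e / 2)); rewrite divr_gt0// => /(_ isT).
  rewrite near_withinE => /nbhs_ballP[d /= d0 fd].
  exists (ball x (d / 2), [set h : R | h < d / 2]).
    split => /=; first by apply: nbhsx_ballx; rewrite divr_gt0.
    by apply: nbhs_right_lt; rewrite divr_gt0.
  move=> [x' h] /= [xx' hd] x't y yt x'y.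
  have H1 : `|f x - f x'| < e / 2.
    apply: fd; last by rewrite in_itv.
    by apply: le_ball xx'; rewrite ler_pdivrMr// ler_peMr ?ler1n// ltW.
  have H2 : `|f x - f y| < e / 2.
    apply: fd; last by rewrite in_itv.
    rewrite /ball/= (splitr d) -(subrKA x') (le_lt_trans (ler_normD _ _))//.
    by rewrite ltrD// (lt_trans x'y).
  by rewrite (splitr e) -(subrKA (f x)) (le_lt_trans (ler_normD _ _))// ltrD// distrC.
apply: filterS => h H x y xt yt; apply: H => //=; by rewrite in_itv.
Qed.

(** The error of one Euler step for exponential decay is of order [h ^+ 2]; the upper bound goes
    through [expR (- h) <= (1 + h)^-1]. *)
Lemma expR_sub_le (h : R) : 0 <= h -> 1 - h <= expR (- h) <= 1 - h + h ^+ 2.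
Proof.
move=> h0; rewrite expR_ge1Dx/= expRN.
have h1 : 0 < 1 + h by rewrite ltr_wpDr.
apply: (@le_trans _ _ (1 + h)^-1).
  by rewrite lef_pV2 ?posrE ?expR_gt0// expR_ge1Dx.
rewrite -div1r ler_pdivrMr//.
have : 0 <= h ^+ 3 by rewrite exprn_ge0.
nra.
Qed.

Lemma ler_exp_sub (a b : R) m : 0 <= a -> a <= b -> b <= 1 ->
  b ^+ m - a ^+ m <= m%:R * (b - a).
Proof.
move=> a0 ab b1; elim: m => [|m IH]; first by rewrite !expr0 subrr mul0r.
rewrite !exprS.
have -> : b * b ^+ m - a * a ^+ m = b * (b ^+ m - a ^+ m) + a ^+ m * (b - a) by ring.
rewrite -natr1 mulrDl mul1r lerD//.
  apply: le_trans IH; rewrite ler_piMl// subr_ge0 lerXn2r// nnegrE//.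
  exact: le_trans ab.
rewrite ler_piMl ?subr_ge0// exprn_ile1//; exact: le_trans b1.
Qed.

Lemma cvg_divSn (t : R) : t / m.+1%:R @[m --> \oo] --> (0 : R).
Proof.
rewrite -[X in _ --> X](mulr0 t); apply: cvgMr; exact: cvg_harmonic.
Qed.

Lemma near_divSn (t : R) (A : set R) : 0 < t -> (\forall h \near 0^'+, A h) ->
  \forall m \near \oo, A (t / m.+1%:R).
Proof.
move=> t0; rewrite near_withinE => H.
have : \forall m \near \oo, 0 < t / m.+1%:R -> A (t / m.+1%:R).
  exact: (cvg_divSn t H).
by apply: filterS => m; apply; rewrite divr_gt0.
Qed.

(** By [ler_exp_sub] the errors of the steps, at most [h ^+ 2] each, only add up: [m.+1] of them
    amount to [t ^+ 2 / m.+1%:R]. *)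
Lemma euler_expR_cvg (t : R) : 0 < t ->
  (1 - t / m.+1%:R) ^+ m.+1 @[m --> \oo] --> expR (- t).
Proof.
move=> t0.
have : \forall m \near \oo,
    expR (- t) - t ^+ 2 / m.+1%:R <= (1 - t / m.+1%:R) ^+ m.+1 <= expR (- t).
  near=> m.
  have : t / m.+1%:R <= 1.
    near: m; apply: (near_divSn (A := fun h => h <= 1)) => //; exact: nbhs_right_le.
  set h := t / m.+1%:R => h1.
  have h0 : 0 <= h by rewrite divr_ge0// ltW.
  have /andP[e1 e2] := expR_sub_le h0.
  have et : expR (- t) = expR (- h) ^+ m.+1.
    by rewrite -expRM_natl; congr expR; rewrite /h; field.
  have H1 : 0 <= 1 - h by rewrite subr_ge0.
  apply/andP; split; last by rewrite et lerXn2r// nnegrE// expR_ge0.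
  rewrite lerBlDl -lerBlDr et (le_trans (ler_exp_sub _ H1 e1 _))//.
    by rewrite expR_le1 oppr_le0.
  rewrite (@le_trans _ _ (m.+1%:R * h ^+ 2))//.
    by rewrite ler_wpM2l//; lra.
  by rewrite /h expr_div_n; rewrite le_eqVlt; apply/orP; left; apply/eqP; field.
move=> H; apply: (squeeze_cvgr H); last exact: cvg_cst.
rewrite -[X in _ --> X]subr0; apply: cvgB; first exact: cvg_cst.
exact: cvg_divSn.
Unshelve. all: by end_near.
Qed.

End euler.

Section euler_scheme.
Context (R : realType).
Local Notation mu := (@lebesgue_measure R).

(** The error of the left-endpoint rule on [[s1, s2]] for an integrand varying by at most [e] from
    its initial value. *)
Lemma Rintegral_increment (f : R -> R) (t s1 s2 e : R) :
  {within `[0, t], continuous f} -> 0 <= s1 -> s1 <= s2 -> s2 <= t ->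
  (forall u, s1 <= u <= s2 -> `|f u - f s1| <= e) ->
  `|\int[mu]_(u in `[0, s2]) f u - \int[mu]_(u in `[0, s1]) f u
      - (s2 - s1) * f s1| <= e * (s2 - s1).
Proof.
move=> cf s10 s12 s2t fe.
have if2 : mu.-integrable `[0, s2] (EFin \o f).
  apply: continuous_compact_integrable; first exact: segment_compact.
  apply: continuous_subspaceW cf => x /=; rewrite !in_itv/= => /andP[-> /=].
  by move=> /le_trans; exact.
rewrite Rintegral_itvB ?bnd_simp//.
have if12 : mu.-integrable `]s1, s2] (EFin \o f).
  apply: integrableS if2 => // x /=; rewrite !in_itv/= => /andP[/ltW h ->].
  by rewrite (le_trans s10).
have mus : mu `]s1, s2] = (s2 - s1)%:E.
  rewrite lebesgue_measure_itv/= lte_fin; case: ltP => [_|s21]; first by rewrite EFinB.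
  by rewrite (@le_anti _ _ s1 s2) ?subrr// s12 s21.
have icst (k : R) : mu.-integrable `]s1, s2] (EFin \o cst k).
  apply/integrableP; split; first by apply/measurable_EFinP.
  by rewrite (eq_integral (cst `|k|%:E))// integral_cst//= mus -EFinM ltry.
have -> : (s2 - s1) * f s1 = \int[mu]_(u in `]s1, s2]) cst (f s1) u.
  by rewrite Rintegral_cst// mulrC; congr (_ * _); rewrite -[LHS]/(fine _%:E) -mus.
rewrite -RintegralB//.
have ifB : mu.-integrable `]s1, s2] (EFin \o (fun u => f u - cst (f s1) u)).
  by have : mu.-integrable `]s1, s2] ((EFin \o f) \- (EFin \o cst (f s1)))%E by exact: integrableB.
rewrite (le_trans (le_normr_Rintegral _ ifB))//.
have -> : e * (s2 - s1) = \int[mu]_(u in `]s1, s2]) cst e u.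
  by rewrite Rintegral_cst//; congr (_ * _); rewrite -[LHS]/(fine _%:E) -mus.
apply: le_Rintegral => //.
- exact: (integrable_norm ifB).
- by move=> x /=; rewrite in_itv/= => /andP[/ltW s1x xs2]; apply: fe; rewrite s1x.
Qed.

(** Subtracting the scheme from the equation cancels the increments of [b]. The error at step
    [j + 1] is [1 - h] times the error at step [j], minus a left-endpoint quadrature error of size
    at most [h * (e / t)]. As [0 <= 1 - h <= 1] these errors add up to at most [e] after [m + 1]
    steps of length [t / (m + 1)]. *)
Lemma euler_scheme_cvg (f b : R -> R) (sigma t : R) (x : nat -> nat -> R) :
  0 < t -> {within `[0, t], continuous f} ->
  (forall s, 0 <= s -> f s = f 0 + sigma * b s - \int[mu]_(u in `[0, s]) f u) ->
  (forall m, x m 0%N = f 0) ->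
  (forall m j, x m j.+1 = (1 - t / m.+1%:R) * x m j +
     sigma * (b (j.+1%:R * (t / m.+1%:R)) - b (j%:R * (t / m.+1%:R)))) ->
  x m m.+1 @[m --> \oo] --> f t.
Proof.
move=> t0 cf fE x0 xS; apply/cvgrPdist_le => e e0.
have e't : 0 < e / t by rewrite divr_gt0.
have unif := within_segment_uniform cf e't.
near=> m.
have : t / m.+1%:R <= 1.
  near: m; apply: (near_divSn (A := fun h => h <= 1)) => //; exact: nbhs_right_le.
(* The window of two steps is there because the comparison is strict, whereas points of one step can
   be at distance exactly [h]. *)
have : forall x y, 0 <= x <= t -> 0 <= y <= t ->
    `|x - y| < (t / m.+1%:R) *+ 2 -> `|f x - f y| < e / t.
  near: m.
  apply: (near_divSn (A := fun h => forall x y, 0 <= x <= t -> 0 <= y <= t ->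
    `|x - y| < h *+ 2 -> `|f x - f y| < e / t)) => //.
  move: unif; rewrite !near_withinE => /nbhs_ballP[d /= d0 fd].
  apply/nbhs_ballP; exists (d / 2) => /=; first by rewrite divr_gt0.
  move=> h; rewrite /ball/= sub0r normrN => hd h0; apply: (fd (h *+ 2)).
    rewrite /ball/= sub0r normrN -mulr_natr normrM (ger0_norm (ler0n _ 2)).
    by rewrite -ltr_pdivlMr.
  by rewrite mulrn_wgt0.
have mt : m.+1%:R * (t / m.+1%:R) = t by field.
set h := t / m.+1%:R in mt * => Hh h1.
have h0 : 0 < h by rewrite divr_gt0.
have jt (j : nat) : (j <= m.+1)%N -> 0 <= j%:R * h <= t.
  by move=> jm; rewrite mulr_ge0 ?(ltW h0)//= -mt ler_pM2r// ler_nat.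
suff H j : (j <= m.+1)%N -> `|f (j%:R * h) - x m j| <= j%:R * (h * (e / t)).
  have := H _ (leqnn m.+1); rewrite mt mulrA mt => /le_trans; apply.
  by rewrite mulrC divfK// gt_eqF.
elim: j => [|j IH] jm; first by rewrite !mul0r x0 subrr normr0.
have {IH} := IH (ltnW jm).
have /andP[s10 s1t] := jt j (ltnW jm); have /andP[s20 s2t] := jt j.+1 jm.
have s2E : j.+1%:R * h = j%:R * h + h by rewrite -natr1 mulrDl mul1r.
have hE : j.+1%:R * h - j%:R * h = h by rewrite s2E addrC addKr.
have s12 : j%:R * h <= j.+1%:R * h by rewrite s2E lerDl ltW.
have := @Rintegral_increment f t _ _ (e / t) cf s10 s12 s2t; rewrite hE => I.
have {}I : `|\int[mu]_(u in `[0, (j.+1%:R * h)]) f u -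
    \int[mu]_(u in `[0, (j%:R * h)]) f u - h * f (j%:R * h)| <= e / t * h.
  apply: I => u /andP[u1 u2]; apply/ltW; apply: Hh.
  - by rewrite (le_trans s10 u1) (le_trans u2 s2t).
  - exact: jt (ltnW jm).
  - rewrite ger0_norm ?subr_ge0// ltrBlDl (le_lt_trans u2)// s2E ltrD2l.
    by rewrite mulr2n ltrDl.
move=> E; rewrite xS.
have -> : f (j.+1%:R * h) - ((1 - h) * x m j + sigma * (b (j.+1%:R * h) - b (j%:R * h))) =
   (1 - h) * (f (j%:R * h) - x m j) - (\int[mu]_(u in `[0, (j.+1%:R * h)]) f u -
    \int[mu]_(u in `[0, (j%:R * h)]) f u - h * f (j%:R * h)).
  rewrite (fE _ s20).
  have -> : sigma * (b (j.+1%:R * h) - b (j%:R * h)) = sigma * b (j.+1%:R * h) -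
     (f (j%:R * h) - f 0 + \int[mu]_(u in `[0, (j%:R * h)]) f u).
    by rewrite [in RHS](fE _ s10); ring.
  by ring.
have -> : j.+1%:R * (h * (e / t)) = j%:R * (h * (e / t)) + e / t * h.
  by rewrite -natr1 mulrDl mul1r [e / t * h]mulrC.
rewrite (le_trans (ler_normB _ _))// lerD//.
rewrite normrM (le_trans _ E)// ler_piMl// ger0_norm ?subr_ge0//.
by rewrite lerBlDr lerDl ltW.
Unshelve. all: by end_near.
Qed.

End euler_scheme.

Lemma measurable_le_fin (R : realType) (a : \bar R) :
  measurable [set x : measurableTypeR R | (a <= x%:E)%E].
Proof.
case: a => [r||] /=.
- rewrite (_ : [set _ | _] = `[r, +oo[%classic) //.
  by apply/seteqP; split => x /=; rewrite in_itv/= lee_fin andbT.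
- rewrite (_ : [set _ | _] = set0) //.
  by apply/seteqP; split => x //=; rewrite leNgt ltry.
- rewrite (_ : [set _ | _] = setT) //.
  by apply/seteqP; split => x //= _; rewrite leNye.
Qed.

(** * Almost sure limits of variables with a common law *)

Section limit_law.
Context d (T : measurableType d) (R : realType) (P : probability T R) (n : nat).
Variables (X_ : nat -> T -> 'rV[R]_n) (X : T -> 'rV[R]_n)
  (mu : probability 'rV[R]_n R).
Hypotheses (mX_ : forall k, measurable_fun setT (X_ k))
  (mX : measurable_fun setT X).
Hypothesis cvgX : {ae P, forall w, forall i, X_ k w ord0 i @[k --> \oo] --> X w ord0 i}.
Hypothesis lawX_ : forall k A, measurable A -> P (X_ k @^-1` A) = mu A.

(** One half of the portmanteau theorem, for sets open under coordinatewise convergence. If the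
    limit is in [U], then [X_ k] is in [U] from some index on. The events [V N] that this holds from
    [N] on increase with [N], and each has probability at most that of [X_ N] being in [U], which is
    [mu U]. *)
Let le_law_open (U : set 'rV[R]_n) : measurable U ->
  (forall (x : nat -> 'rV[R]_n) (y : 'rV[R]_n),
    (forall i, x k ord0 i @[k --> \oo] --> y ord0 i) ->
    U y -> \forall k \near \oo, U (x k)) ->
  (P (X @^-1` U) <= mu U)%E.
Proof.
move=> mU oU.
have mXU : measurable (X @^-1` U) by rewrite -[X in measurable X]setTI; exact: mX.
have mXkU k : measurable (X_ k @^-1` U).
  by rewrite -[X in measurable X]setTI; exact: mX_.
pose V N := \bigcap_(k in [set k | (N <= k)%N]) (X_ k @^-1` U).
have mV N : measurable (V N) by exact: bigcap_measurableType.
have PV N : (P (V N) <= mu U)%E.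
  rewrite -(lawX_ N mU); apply: le_measure; rewrite ?inE//.
  by move=> w; apply; rewrite /= leqnn.
have mVU : measurable (\bigcup_N V N) by exact: bigcupT_measurable.
have ndV : nondecreasing_seq V.
  move=> p q pq; apply/subsetPset => w h k /= qk; apply: h => /=.
  exact: leq_trans qk.
have PVU : (P (\bigcup_N V N) <= mu U)%E.
  have cV := nondecreasing_cvg_mu (mu := P) mV mVU ndV.
  rewrite -(cvg_lim _ cV)//; apply: lime_le.
    by apply/cvg_ex; eexists; exact: cV.
  exact: nearW.
have [N [mN N0 sN]] := cvgX.
apply: (@le_trans _ _ (P (N `|` \bigcup_N V N))).
  apply: le_measure; rewrite ?inE//; first exact: measurableU.
  move=> w Uw; have [cw|ncw] := pselect (forall i, X_ k w ord0 i @[k --> \oo] --> X w ord0 i).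
    by right; have [K _ HK] := oU _ _ cw Uw; exists K.
  by left; exact: sN.
by rewrite (le_trans (measureU2 _ _ _))// [X in (X + _)%E](_ : _ = 0%E) ?add0e.
Qed.

(** A ray is open, which gives one inequality. It is also the increasing union of the closed sets
    [C j], whose complements are open; the bound on the complements gives the reverse inequality for
    each [C j], hence for the ray. *)
Lemma limit_law A : measurable A -> P (X @^-1` A) = mu A.
Proof.
rewrite -(image_measureE _ mX).
apply: ray_measure_unique.
  by rewrite image_measureE preimage_setT (le_lt_trans (probability_le1 P measurableT)) ?ltry.
move=> a; rewrite image_measureE.
apply/eqP; rewrite eq_le; apply/andP; split.
  apply: (le_law_open (measurable_ray a)).
  move=> x y xy ya.
  suff : \forall k \near \oo, forall i : 'I_n, (a i < (x k ord0 i)%:E)%E by [].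
  apply: filter_forall => i.
  have := ya i; case: (a i) => [r||].
  - rewrite lte_fin => ry.
    have : \forall k \near \oo, r < x k ord0 i by exact: (cvgr_gt _ (xy i)).
    by apply: filterS => k; rewrite lte_fin.
  - by rewrite ltNge leey.
  - by move=> _; apply: nearW => k; rewrite ltNyr.
pose C j : set 'rV[R]_n := [set x | forall i, (a i + (j.+1%:R^-1)%:E <= (x ord0 i)%:E)%E].
have mC j : measurable (C j).
  exact: (measurable_box (fun i => measurable_le_fin (a i + (j.+1%:R^-1)%:E)%E)).
have rayE : ray a = \bigcup_j C j.
  apply/seteqP; split => x.
    move=> xa; have : \forall j \near \oo, C j x.
      apply: filter_forall => i; have := xa i; case: (a i) => [r||].
      - rewrite lte_fin -subr_gt0 => ry.
        have : \forall j \near \oo, @harmonic R j < x ord0 i - r.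
          exact: (cvgr_lt _ (@cvg_harmonic R)).
        apply: filterS => j.
        by rewrite /harmonic/= -EFinD lee_fin ltrBrDl => /ltW.
      - by rewrite ltNge leey.
      - by move=> _; apply: nearW => j; rewrite leNye.
    by move=> /filter_ex[j Cj]; exists j.
  move=> [j _ Cj] i; have := Cj i; case: (a i) => [r||].
  - rewrite -EFinD lee_fin lte_fin; apply: lt_le_trans.
    by rewrite ltrDl invr_gt0.
  - by rewrite addye// leNgt ltry.
  - by rewrite ltNyr.
have mUC : measurable (\bigcup_j C j) by exact: bigcupT_measurable.
have ndC : nondecreasing_seq C.
  move=> p q pq; apply/subsetPset => x h i; apply: le_trans (h i).
  by rewrite leeD2l// lee_fin lef_pV2 ?posrE// ler_nat.
have cC := nondecreasing_cvg_mu (mu := mu) mC mUC ndC.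
rewrite -/(ray a) rayE -(cvg_lim _ cC)//; apply: lime_le.
  by apply/cvg_ex; eexists; exact: cC.
apply: nearW => j /=.
have mXA (S : set _) : measurable S -> measurable (X @^-1` S).
  by move=> mS; rewrite -[X in measurable X]setTI; exact: mX.
apply: (@le_trans _ _ (P (X @^-1` C j))); last first.
  apply: le_measure; rewrite ?inE; [exact: mXA|exact: mXA|].
  by apply: preimage_subset => x Cx; exists j.
have : (P (X @^-1` (~` C j)) <= mu (~` C j))%E.
  apply: le_law_open; first exact: measurableC.
  move=> x y xy /existsNP[i /negP]; rewrite -ltNge => yi.
  have : \forall k \near \oo, ((x k ord0 i)%:E < a i + (j.+1%:R^-1)%:E)%E.
    move: yi; case: (a i) => [r||]//=.
    - rewrite -EFinD lte_fin => yr.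
      have : \forall k \near \oo, x k ord0 i < r + j.+1%:R^-1.
        exact: (cvgr_lt _ (xy i)).
      by apply: filterS => k; rewrite lte_fin.
    - by move=> _; apply: nearW => k; rewrite addye// ltry.
  by apply: filterS => k xk h; have := h i; rewrite leNgt xk.
rewrite -preimage_setC !probability_setC//; last exact: mXA.
by rewrite leeD2lE// leeN2.
Qed.

End limit_law.

Lemma chain_sdE (R : realType) (a c delta : R) j : 0 < a < 1 ->
  chain_sd a c delta j ^+ 2 =
  (c * delta) ^+ 2 * (1 - (a ^+ j) ^+ 2) / (1 - a ^+ 2).
Proof.
move=> /andP[a0 a1].
have a2 : 0 < 1 - a ^+ 2 by rewrite subr_gt0 exprn_ilt1// ltW.
elim: j => [|j IH] /=; first by rewrite expr0 expr1n subrr mulr0 mul0r expr0n.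
rewrite sqr_sqrtr; last by apply: addr_ge0; [apply: mulr_ge0|]; exact: sqr_ge0.
rewrite IH [a ^+ j.+1]exprS; field. by rewrite gt_eqF.
Qed.

Section ou_law.
Context d (T : measurableType d) (R : realType) (P : probability T R).
Variables (n : nat) (B Z : R -> {RV P >-> 'rV[R]_n}) (z0 : 'rV[R]_n).
Hypotheses (n1 : (1 <= n)%N) (hB : brownian_motion P B)
  (hZ : ornstein_uhlenbeck P B z0 Z).
Variable t : R.
Hypothesis t0 : 0 < t.

Let sigma : R := Num.sqrt (2 / n%:R).
Let h m : R := t / m.+1%:R.
(* [W m] is the Euler scheme with [m.+1] steps on [0, t]. *)
Let D m j w := B (j.+1%:R * h m) w - B (j%:R * h m) w.
Let W := fix W m j w := if j is j'.+1 then
  (1 - h m) *: W m j' w + sigma *: D m j' w else z0.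
Let s m := chain_sd (1 - h m) sigma (Num.sqrt (h m)) m.+1.
Let S := Num.sqrt ((1 - expR (- t) ^+ 2) / n%:R).

Let n0 : 0 < n%:R :> R. Proof. by rewrite ltr0n. Qed.
Let h0 m : 0 < h m. Proof. by rewrite divr_gt0. Qed.
Let sigma0 : 0 < sigma. Proof. by rewrite sqrtr_gt0 divr_gt0. Qed.
Let S2_gt0 : 0 < (1 - expR (- t) ^+ 2) / n%:R.
Proof.
by rewrite divr_gt0// subr_gt0 exprn_ilt1// ?expR_ge0// expR_lt1 oppr_lt0.
Qed.
Let S0 : 0 < S. Proof. by rewrite sqrtr_gt0. Qed.

Let mD m j : measurable_fun setT (D m j).
Proof.
apply/measurable_rVP => i; under eq_fun do rewrite !mxE.
apply: measurable_funB.
  exact: (measurableT_comp (measurable_coord i) (measurable_funP (B _))).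
exact: (measurableT_comp (measurable_coord i) (measurable_funP (B _))).
Qed.

Let mW m j : measurable_fun setT (W m j).
Proof.
elim: j => [|j IH] /=; first exact: measurable_cst.
rewrite (_ : (fun w => _) =
  (fun z : 'rV[R]_n * 'rV[R]_n => (1 - h m) *: z.1 + sigma *: z.2) \o
  (fun w => (W m j w, D m j w)))//.
apply: (measurableT_comp (measurable_rV_comb _ _)).
exact: measurable_fun_pair.
Qed.

(** The condition on [m] makes the coefficient [1 - h m] of the chain positive. *)
Let lawW m A : t < m.+1%:R -> measurable A ->
  P (W m m.+1 @^-1` A) = gaussian ((1 - h m) ^+ m.+1 *: z0) (s m) A.
Proof.
move=> tm mA.
have hm1 : h m < 1 by rewrite ltr_pdivrMr// mul1r.
have t_le (j : nat) : j%:R * h m <= j.+1%:R * h m by rewrite ler_pM2r// ler_nat.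
apply: (@chain_law _ _ _ P n m.+1 (D m) (1 - h m) sigma (Num.sqrt (h m)) z0 (W m)) => //.
- by rewrite sqrtr_gt0.
- move=> j U jm mU; rewrite -[h m in RHS](_ : j.+1%:R * h m - j%:R * h m = _).
    rewrite -(brownian_increment hB _ mU)// mulr_ge0 ?(ltW (h0 m))//=.
    by rewrite ltr_pM2r// ltr_nat.
  by rewrite -mulrBl -natrB// subSnn mul1r.
- apply: (brownian_independence hB (t := fun j => j%:R * h m)) => //.
  by rewrite mul0r.
- by rewrite leqnn.
Qed.

Let cvgW : {ae P, forall w, forall i, W m m.+1 w ord0 i @[m --> \oo] --> Z t w ord0 i}.
Proof.
have := ou_start hZ; have := ou_continuous hZ; have := ou_equation hZ.
apply: filterS3 => w eqZ cZ Z0 i.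
apply: (@euler_scheme_cvg _ (fun s => Z s w ord0 i) (fun s => B s w ord0 i) sigma t
  (fun m j => W m j w ord0 i)) => //.
- have cZt : {within `[0, t], continuous (fun s => Z s w)}.
    apply: continuous_subspaceW cZ => x /=; rewrite !in_itv/= => /andP[-> _] //.
  move=> x; apply: (cvg_comp (fun s => Z s w) (fun M : 'rV[R]_n => M ord0 i)).
    exact: cZt.
  exact: coord_continuous.
- by move=> r r0; exact: eqZ.
- by move=> m /=; rewrite Z0.
- by move=> m j /=; rewrite /D !mxE.
Qed.

(** In [chain_sdE] the denominator [1 - (1 - h)^2] equals [h * (2 - h)], so the step cancels against
    the variance of an increment. This closed form asks for [h m < 1], hence holds for large [m]. *)
Let cvg_s : s m @[m --> \oo] --> S.
Proof.
have cs2 : (s m) ^+ 2 @[m --> \oo] --> (1 - expR (- t) ^+ 2) / n%:R.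
  have : \forall m \near \oo, 2 / n%:R * (1 - ((1 - h m) ^+ m.+1) ^+ 2) / (2 - h m) = s m ^+ 2.
    near=> m.
    have hm1 : h m < 1.
      by near: m; apply: (near_divSn (A := fun x => x < 1)) => //; exact: nbhs_right_lt.
    rewrite /s chain_sdE; last by rewrite subr_gt0 hm1 ltrBlDr ltrDl h0.
    have -> : (sigma * Num.sqrt (h m)) ^+ 2 = 2 / n%:R * h m.
      by rewrite exprMn !sqr_sqrtr// ?divr_ge0// ltW.
    have hm0 := h0 m.
    have -> : 1 - (1 - h m) ^+ 2 = h m * (2 - h m) by ring.
    field; rewrite !gt_eqF//; lra.
  move=> /near_eq_cvg H; apply: (cvg_trans H).
  rewrite (_ : (1 - expR (- t) ^+ 2) / n%:R =
      2 / n%:R * (1 - expR (- t) ^+ 2) / (2 - 0)); last first.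
    by rewrite subr0; field; rewrite gt_eqF.
  apply: cvgM.
    apply: cvgM; first exact: cvg_cst.
    apply: cvgB; first exact: cvg_cst.
    apply: (cvg_comp _ (fun x : R => x ^+ 2)); last exact: sqr_continuous.
    exact: euler_expR_cvg.
  apply: cvgV; first by rewrite subr0.
  by apply: cvgB; [exact: cvg_cst|exact: cvg_divSn].
have : Num.sqrt (s m ^+ 2) @[m --> \oo] --> S.
  exact: (cvg_comp _ _ cs2 (@sqrt_continuous R _)).
apply: cvg_trans; apply: near_eq_cvg; apply: nearW => m /=.
rewrite sqrtr_sqr ger0_norm// /s /=; exact: sqrtr_ge0.
Unshelve. all: by end_near.
Qed.

Lemma ou_law A : measurable A ->
  P (Z t @^-1` A) = gaussian (expR (- t) *: z0) S A.
Proof.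
move=> mA.
(* Normalised, the endpoints of the Euler schemes all have the same law, which
   is the situation of [limit_law]. *)
pose xi m w := (s m)^-1 *: W m m.+1 w + - ((s m)^-1 *: ((1 - h m) ^+ m.+1 *: z0)).
pose x w := S^-1 *: Z t w + - (S^-1 *: (expR (- t) *: z0)).
have mx : measurable_fun setT x.
  exact: (measurableT_comp (measurable_rV_affine _ _) (measurable_funP (Z t))).
have mxi m : measurable_fun setT (xi m).
  exact: (measurableT_comp (measurable_rV_affine _ _) (mW _ _)).
(* Shifting the index by [N] puts every scheme in the range [t < m.+1%:R] where [lawW] applies. *)
pose N := Num.bound t.
have tN m : t < (m + N).+1%:R.
  rewrite (lt_le_trans (archi_boundP (ltW t0)))// ler_nat.
  by rewrite (leq_trans (leq_addl m N)).
have s0 m : 0 < s m.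
  by apply: chain_sd_gt0 => //; rewrite sqrtr_gt0.
have lawx U : measurable U -> P (x @^-1` U) = gaussian 0 1 U.
  apply: (@limit_law _ _ _ P n (fun m => xi (m + N)%N)) => //.
    have := cvgW; apply: filterS => w cW i.
    suff : xi m w ord0 i @[m --> \oo] --> x w ord0 i by rewrite -(cvg_shiftn N).
    rewrite /x !mxE (_ : (fun m => _) = fun m => (s m)^-1 * W m m.+1 w ord0 i -
        (s m)^-1 * ((1 - h m) ^+ m.+1 * z0 ord0 i)); last first.
      by apply/funext => m; rewrite /xi; move: (W m m.+1 w) => y; rewrite !mxE.
    apply: cvgB.
      apply: cvgM; last exact: cW.
      by apply: cvgV => //; rewrite gt_eqF.
    apply: cvgM.
      by apply: cvgV => //; rewrite gt_eqF.
    apply: cvgM; last exact: cvg_cst.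
    exact: euler_expR_cvg.
  move=> m V mV; set k := (m + N)%N.
  have -> : xi k @^-1` V = W k k.+1 @^-1`
      ((fun y => (s k)^-1 *: y + - ((s k)^-1 *: ((1 - h k) ^+ k.+1 *: z0))) @^-1` V) by [].
  rewrite lawW; [|exact: tN|]; last first.
    by rewrite -[X in measurable X]setTI; exact: (measurable_rV_affine _ _ measurableT mV).
  have sk0 : 0 < (s k)^-1 by rewrite invr_gt0.
  apply: (eq_trans (gaussian_affine _ _ (s0 k) sk0 mV)).
  by rewrite subrr mulVf// gt_eqF.
have -> : Z t @^-1` A = x @^-1` ((fun y => S *: y + expR (- t) *: z0) @^-1` A).
  apply/seteqP; split => w; rewrite /= /x scalerDr scalerN !scalerA divff ?gt_eqF//;
  by rewrite mul1r scale1r subrK.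
rewrite lawx; last first.
  by rewrite -[X in measurable X]setTI; exact: (measurable_rV_affine _ _ measurableT mA).
by rewrite (centered_gaussian_affine _ ltr01 S0 mA) mulr1.
Qed.

End ou_law.

(** * Distances between laws with a density *)

Section density_distances.
Local Open Scope ereal_scope.
Context d (T : measurableType d) (R : realType).
Variables (nu mu : probability T R) (f : T -> R).
Hypotheses (mf : measurable_fun setT f) (f_gt0 : forall x, (0 < f x)%R).
Hypothesis nuE : forall A, measurable A -> nu A = \int[mu]_(x in A) (f x)%:E.
Variables beta c : R.
Hypotheses (betaE : \int[mu]_x (Num.sqrt (f x))%:E = beta%:E)
  (cE : \int[mu]_x (f x ^+ 2)%:E = (1 + c)%:E).

Let f0 x : (0 <= f x)%R. Proof. exact: ltW. Qed.
Let mEf : measurable_fun setT (EFin \o f). Proof. exact/measurable_EFinP. Qed.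
Let msqrt : measurable_fun setT (fun x => Num.sqrt (f x)).
Proof.
apply: (@measurableT_comp _ _ _ _ _ _ (@Num.sqrt R)) => //.
by apply: continuous_measurable_fun; exact: sqrt_continuous.
Qed.
Let dom := density_dominates mf nuE.
Let dens := density_ae_eq mf nuE.

Let int_f : \int[mu]_x (f x)%:E = 1.
Proof. by rewrite -nuE// probability_setT. Qed.

Let m_sqr_sub1 : measurable_fun setT (fun x => (f x - 1) ^+ 2)%R.
Proof. by apply: measurable_funX; exact: measurable_funB. Qed.

(** The identity [(f - 1)^2 + 2 f = f^2 + 1] is integrated with nonnegative terms on both sides,
    which avoids subtraction of extended reals. *)
Let int_sqr_sub1 : \int[mu]_x ((f x - 1) ^+ 2)%:E = c%:E.
Proof.
have : \int[mu]_x ((f x - 1) ^+ 2 + 2 * f x)%:E = \int[mu]_x (f x ^+ 2 + 1)%:E.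
  by apply: eq_integral => x _; congr EFin; ring.
under eq_integral do rewrite EFinD.
under [in RHS]eq_integral do rewrite EFinD.
rewrite ge0_integralD//; first last.
- by apply/measurable_EFinP; exact: measurable_funM.
- by move=> x _; rewrite lee_fin mulr_ge0.
- exact/measurable_EFinP.
- by move=> x _; rewrite lee_fin sqr_ge0.
rewrite ge0_integralD//; first last.
- by apply/measurable_EFinP; exact: measurable_funX.
- by move=> x _; rewrite lee_fin sqr_ge0.
rewrite cE integral_probability_cst; under [X in _ + X]eq_integral do rewrite EFinM.
rewrite ge0_integralZl//; last by move=> x _; rewrite lee_fin.
rewrite int_f mule1.
case: (\int[mu]_x _) => [r||]//= /eqP; rewrite -!EFinD eqe => /eqP E.
by congr EFin; lra.
Qed.

Let int_mean : \int[mu]_x ((1 + f x) / 2)%:E = 1.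
Proof.
under eq_integral do rewrite EFinM EFinD.
rewrite ge0_integralZr//; last 2 first.
- by apply: emeasurable_funD.
- by move=> x _; rewrite adde_ge0// lee_fin.
rewrite ge0_integralD//; last by move=> x _; rewrite lee_fin.
rewrite integral_probability_cst int_f -!EFinD -EFinM; congr EFin; lra.
Qed.

Lemma density_affinity_le1 : (beta <= 1)%R.
Proof.
rewrite -lee_fin -betaE -int_mean; apply: ge0_le_integral => //.
- exact/measurable_EFinP.
- by apply/measurable_EFinP; apply: measurable_funM => //; exact: measurable_funD.
move=> x _; rewrite lee_fin; have := sqr_sqrtr (f0 x).
have := sqr_ge0 (1 - Num.sqrt (f x)); nra.
Qed.

(** The pointwise inequality is [(1 + f) / 2 <= sqrt f + (f - 1)^2 / 2], and [(1 + f) / 2] has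
    integral 1. *)
Lemma density_affinity_ge : (1 - c / 2 <= beta)%R.
Proof.
rewrite lerBlDr -lee_fin EFinD -betaE.
have -> : (c / 2)%:E = \int[mu]_x ((f x - 1) ^+ 2 / 2)%:E.
  under eq_integral do rewrite EFinM.
  rewrite ge0_integralZr//; first by rewrite int_sqr_sub1.
  - exact/measurable_EFinP.
  - by move=> x _; rewrite lee_fin sqr_ge0.
rewrite -ge0_integralD//; first last.
- by apply/measurable_EFinP; exact: measurable_funM.
- by move=> x _; rewrite lee_fin divr_ge0// sqr_ge0.
- exact/measurable_EFinP.
rewrite -int_mean; apply: ge0_le_integral => //.
- by move=> x _; rewrite lee_fin divr_ge0// addr_ge0.
- by apply/measurable_EFinP; apply: measurable_funM => //; exact: measurable_funD.
- by apply: emeasurable_funD; apply/measurable_EFinP => //; exact: measurable_funM.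
move=> x _; rewrite -EFinD lee_fin.
have g0 : (0 <= Num.sqrt (f x))%R by [].
rewrite -(sqr_sqrtr (f0 x)) sqrtr_sqr (ger0_norm g0).
move: (Num.sqrt (f x)) g0 => g g0.
(* Twice the difference of the two sides, since [(1 + g)^2 - 1 = g * (2 + g)]. *)
have : (0 <= (1 - g) ^+ 2 * (g * (2 + g)))%R.
  by rewrite mulr_ge0 ?sqr_ge0// mulr_ge0// addr_ge0.
nra.
Qed.

Lemma tv_distance_le1 : total_variation_distance nu mu <= 1.
Proof.
apply: ge_ereal_sup => _ [A mA <-].
have : nu A \is a fin_num by rewrite fin_num_measure.
have : mu A \is a fin_num by rewrite fin_num_measure.
have : mu A <= 1 by exact: probability_le1.
have : nu A <= 1 by exact: probability_le1.
have : 0 <= mu A by exact: measure_ge0.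
have : 0 <= nu A by exact: measure_ge0.
case: (nu A) => [p||]//; case: (mu A) => [q||]//.
rewrite !lee_fin => p0 q0 p1 q1 _ _; rewrite ler_norml; apply/andP; split; lra.
Qed.

(** On the test set [f >= 1] the gap [nu A - mu A] is 1 minus the integral of the minimum of [f] and
    1, and this minimum is at most [sqrt f]. *)
Lemma tv_distance_ge : (1 - beta)%:E <= total_variation_distance nu mu.
Proof.
pose A := [set x | (1 <= f x)%R].
have mA : measurable A.
  rewrite -[X in measurable X]setTI.
  rewrite (_ : A = f @^-1` `[1%R, +oo[%classic).
    exact: mf.
  by apply/seteqP; split => x /=; rewrite in_itv/= andbT.
apply: (@le_trans _ _ `|nu A - mu A|); last first.
  by apply: ereal_sup_ubound; exists A.
have nuAf : nu A \is a fin_num by rewrite fin_num_measure.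
have muAf : mu A \is a fin_num by rewrite fin_num_measure.
have H : 1 + mu A <= beta%:E + nu A.
  have -> : mu A = \int[mu]_x (\1_A x)%:E by rewrite integral_indic// setIT.
  have -> : nu A = \int[mu]_x (f x * \1_A x)%:E.
    rewrite nuE// integral_mkcond; apply: eq_integral => x _.
    by rewrite epatch_indic EFinM.
  have m1A : measurable_fun setT (EFin \o \1_A : T -> \bar R).
    by apply/measurable_EFinP; exact: measurable_indic.
  have mfA : measurable_fun setT (fun x => (f x * \1_A x)%:E).
    by apply/measurable_EFinP; apply: measurable_funM => //; exact: measurable_indic.
  rewrite -betaE -int_f -!ge0_integralD//; first last.
  - by move=> x _; rewrite lee_fin.
  - by move=> x _; rewrite lee_fin mulr_ge0.
  - exact/measurable_EFinP.
  apply: ge0_le_integral => //.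
  - by move=> x _; rewrite adde_ge0// lee_fin.
  - exact: emeasurable_funD.
  - by apply: emeasurable_funD => //; exact/measurable_EFinP.
  move=> x _; rewrite -!EFinD lee_fin indicE; have g0 := sqrtr_ge0 (f x).
  have := sqr_sqrtr (f0 x); move: g0; set g := Num.sqrt (f x) => g0 gf.
  case: (boolP (x \in A)); rewrite ?inE ?notin_setE /A/=; last first.
    by move/negP; rewrite -ltNge => f1; nra.
  by move=> f1; nra.
move: H nuAf muAf; case: (nu A) => [p||]//; case: (mu A) => [q||]// + _ _.
rewrite -EFinD -EFinB !lee_fin => H.
by rewrite (le_trans _ (ler_norm _))//; lra.
Qed.

Lemma tv_distance_le delta : (0 < delta)%R -> (c <= delta ^+ 2)%R ->
  total_variation_distance nu mu <= delta%:E.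
Proof.
(* Cauchy-Schwarz is replaced by [`|f - 1| <= delta/2 + (f - 1)^2/(2 delta)]. *)
move=> d0 cd; pose g x : R := (delta / 2 + (f x - 1) ^+ 2 / (2 * delta))%R.
have g0 x : (0 <= g x)%R.
  by rewrite addr_ge0 ?divr_ge0 ?sqr_ge0 ?mulr_ge0// ltW.
have mg : measurable_fun setT (EFin \o g).
  apply/measurable_EFinP; apply: measurable_funD => //; exact: measurable_funM.
have int_g : \int[mu]_x (g x)%:E <= delta%:E.
  under eq_integral do rewrite EFinD [X in _ + X]EFinM.
  rewrite ge0_integralD//; first last.
  - by apply: emeasurable_funM => //; exact/measurable_EFinP.
  - by move=> x _; rewrite mule_ge0// lee_fin ?sqr_ge0 ?invr_ge0 ?mulr_ge0// ltW.
  - by move=> x _; rewrite lee_fin divr_ge0// ltW.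
  rewrite ge0_integralZr//; first last.
  - by rewrite lee_fin invr_ge0 mulr_ge0// ltW.
  - by move=> x _; rewrite lee_fin sqr_ge0.
  - exact/measurable_EFinP.
  rewrite int_sqr_sub1 integral_probability_cst -EFinM -EFinD lee_fin.
  have : (c / (2 * delta) <= delta / 2)%R.
    by rewrite ler_pdivrMr ?mulr_gt0//; nra.
  lra.
have fg x : (f x <= 1 + g x)%R /\ (1 <= f x + g x)%R.
  suff : (`|f x - 1| <= g x)%R by rewrite ler_norml => /andP[]; lra.
  have -> : g x = ((delta ^+ 2 + `|f x - 1| ^+ 2) / (2 * delta))%R.
    by rewrite real_normK ?num_real// /g; field; rewrite gt_eqF.
  rewrite ler_pdivlMr ?mulr_gt0//.
  have := sqr_ge0 (delta - `|f x - 1|)%R; nra.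
apply: ge_ereal_sup => _ [A mA <-].
have int_gA : \int[mu]_(x in A) (g x)%:E <= delta%:E.
  apply: le_trans int_g; apply: ge0_subset_integral => //.
  by move=> x _; rewrite lee_fin.
have muA1 : mu A = \int[mu]_(x in A) (cst 1 x) by rewrite integral_cst// mul1e.
have H1 : nu A <= mu A + delta%:E.
  apply: (@le_trans _ _ (mu A + \int[mu]_(x in A) (g x)%:E)); last exact: leeD2l.
  rewrite nuE// muA1 -ge0_integralD//; last 2 first.
  - by move=> x _; rewrite lee_fin.
  - exact: measurable_funTS.
  apply: ge0_le_integral => //.
  - by move=> x _; rewrite lee_fin.
  - exact: measurable_funTS.
  - by apply: emeasurable_funD => //; exact: measurable_funTS.
  - by move=> x _; rewrite -EFinD lee_fin; have [] := fg x.
have H2 : mu A <= nu A + delta%:E.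
  apply: (@le_trans _ _ (nu A + \int[mu]_(x in A) (g x)%:E)); last exact: leeD2l.
  rewrite nuE// muA1 -ge0_integralD//; first last.
  - exact: measurable_funTS.
  - by move=> x _; rewrite lee_fin.
  - exact: measurable_funTS.
  - by move=> x _; rewrite lee_fin.
  apply: ge0_le_integral => //.
  - by apply: emeasurable_funD => //; exact: measurable_funTS.
  - by move=> x _; rewrite -EFinD lee_fin; have [] := fg x.
have : nu A \is a fin_num by rewrite fin_num_measure.
have : mu A \is a fin_num by rewrite fin_num_measure.
move: H1 H2; case: (nu A) => [p||]//; case: (mu A) => [q||]//.
rewrite -!EFinD !lee_fin => H1 H2 _ _; rewrite ler_norml; apply/andP; split; lra.
Qed.

Let mdens (nu' : probability T R) : nu' `<< mu ->
  measurable_fun setT (density nu' mu).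
Proof. by move=> dom'; apply: (measurable_int mu); exact: Radon_Nikodym_integrable. Qed.

(** With [mu] as reference measure its own density is 1 almost everywhere, so that the integrand
    reduces to [sqrt f]. *)
Lemma hellinger_density : hellinger nu mu = (Num.sqrt (1 - beta))%:E.
Proof.
have mumu : mu `<< mu by apply/null_content_dominatesP.
rewrite -(hellinger_wrtE dom mumu) /hellinger_wrt.
congr (Num.sqrt (1 - _))%:E; rewrite /Rintegral.
have mrefl A : measurable A -> mu A = \int[mu]_(x in A) (cst 1%R x)%:E.
  by move=> mA; rewrite -[LHS]mul1e -integral_cst//.
have dens1 := density_ae_eq (f := cst 1%R) (measurable_cst _) mrefl.
rewrite (ae_eq_integral (fun x => (Num.sqrt (f x))%:E)) ?betaE//.
- apply/measurable_EFinP; apply: (@measurableT_comp _ _ _ _ _ _ (@Num.sqrt R)) => //.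
    by apply: continuous_measurable_fun; exact: sqrt_continuous.
  by apply: measurable_funM; apply: measurableT_comp => //; exact: mdens.
- exact/measurable_EFinP.
move: dens dens1; apply: filterS2 => x /(_ I) -> /(_ I) -> _ /=.
by rewrite mulr1.
Qed.

Lemma chi2_density : chi2 nu mu = c%:E.
Proof.
rewrite /chi2 asboolT// -int_sqr_sub1; apply: ae_eq_integral => //.
- under eq_fun do rewrite expe2.
  have mabs : measurable_fun setT (fun x => `|density nu mu x - 1|).
    by apply: measurableT_comp => //; apply: emeasurable_funB => //; exact: mdens.
  exact: emeasurable_funM.
- exact/measurable_EFinP.
move: dens; apply: filterS => x /(_ I) -> _ /=.
by rewrite -EFinM -expr2 real_normK ?num_real.
Qed.

Let int_nu (g : T -> R) : measurable_fun setT g -> (forall x, 0 <= g x)%R ->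
  \int[nu]_x (g x)%:E = \int[mu]_x (g x * f x)%:E.
Proof.
move=> mg g0; rewrite (ge0_integral_density mf f0 nuE)//; last exact/measurable_EFinP.
Qed.

Let int_nu_f : \int[nu]_x (f x)%:E = (1 + c)%:E.
Proof. by rewrite int_nu// -cE. Qed.

Let mln : measurable_fun setT (fun x => ln (f x)).
Proof. exact: (measurableT_comp (@measurable_ln R)). Qed.

(** The function [1 / sqrt f], whose [nu]-integral is the affinity [beta]; in this form the
    convexity of [expR] bounds [ln f] from below. *)
Let isqrt x : R := expR (- (ln (f x) / 2)).

Let m_isqrt : measurable_fun setT isqrt.
Proof.
apply: (measurableT_comp (@measurable_expR R)).
apply: (measurableT_comp (@oppr_measurable R setT)).
exact: measurable_funM.
Qed.

Let int_nu_isqrt : \int[nu]_x (isqrt x)%:E = beta%:E.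
Proof.
rewrite int_nu//; last by move=> x; exact: expR_ge0.
rewrite -betaE; apply: eq_integral => x _; congr EFin.
have fE : f x = expR (ln (f x)) by rewrite lnK// posrE.
rewrite {1 2}fE sqrtr_expR /isqrt -expRD; congr expR; lra.
Qed.

Let integrable_f : nu.-integrable setT (EFin \o f).
Proof.
apply/integrableP; split => //.
under eq_integral do rewrite /= ger0_norm//.
by rewrite int_nu_f ltry.
Qed.

Let integrable_isqrt : nu.-integrable setT (EFin \o isqrt).
Proof.
apply/integrableP; split; first exact/measurable_EFinP.
under eq_integral do rewrite /= ger0_norm ?expR_ge0//.
by rewrite int_nu_isqrt ltry.
Qed.

Let integrable_cst (r : R) : nu.-integrable setT (EFin \o cst r).
Proof. exact: finite_measure_integrable_cst. Qed.

(* The tangent of [ln] at [a] replaces Jensen's inequality in [kullback_ge]. *)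
Let ln_ge (a : R) x : (0 < a)%R ->
  (2 * (1 - ln a) - 2 / a * isqrt x <= ln (f x))%R.
Proof.
move=> a0; have := expR_ge1Dx (- (ln (f x) / 2) - ln a).
rewrite expRD -/(isqrt x) expRN lnK// => H.
have -> : (2 / a * isqrt x = 2 * (isqrt x / a))%R by field; rewrite gt_eqF.
lra.
Qed.

Let ln_le x : (ln (f x) <= f x - 1)%R.
Proof.
have := expR_ge1Dx (ln (f x)); rewrite lnK ?posrE//; lra.
Qed.

(** The logarithm lies between [2 - 2 * isqrt] and [f - 1], so [f + 2 * isqrt] dominates its
    absolute value. *)
Let integrable_ln : nu.-integrable setT (EFin \o (fun x => ln (f x))).
Proof.
have := integrableD measurableT integrable_f
  (integrableZl measurableT 2%R integrable_isqrt).
apply: le_integrable => //; first exact/measurable_EFinP.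
move=> x _ /=. rewrite lee_fin [leRHS]ger0_norm; last first.
  by rewrite addr_ge0// mulr_ge0// expR_ge0.
have i0 : (0 <= isqrt x)%R by exact: expR_ge0.
rewrite ler_norml; apply/andP; split.
  have := @ln_ge 1%R x ltr01; rewrite ln1 divr1; have := f0 x; lra.
have := ln_le x; lra.
Qed.

Let m_lne : measurable_fun setT (fun r : R => lne r%:E).
Proof.
apply: (measurable_fun_ifT (f := fun r : R => (r <= 0)%R) (g := cst -oo)
  (h := fun r : R => (ln r)%:E)).
- exact: measurable_fun_ler.
- exact: measurable_cst.
- by apply/measurable_EFinP; exact: measurable_ln.
Qed.

Let kullbackE : kullback nu mu = \int[nu]_x (ln (f x))%:E.
Proof.
rewrite /kullback asboolT//; apply: ae_eq_integral => //.
- rewrite (_ : (fun x => _) = (fun r : R => lne r%:E) \o fine \o density nu mu).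
    apply: (measurableT_comp m_lne); apply: measurableT_comp => //; exact: mdens.
  apply/funext => x; rewrite -[RHS]/(lne (fine (density nu mu x))%:E) fineK//.
  exact: Radon_Nikodym_fin_num.
- exact/measurable_EFinP.
have := null_dominates_ae_eq measurableT dom dens.
by apply: filterS => x /(_ I) -> _ /=; rewrite leNgt f_gt0.
Qed.

Lemma kullback_le : kullback nu mu <= c%:E.
Proof.
rewrite kullbackE; apply: (@le_trans _ _ (\int[nu]_x (f x - 1)%:E)).
  apply: le_integral => //.
    exact: (integrableB measurableT integrable_f (integrable_cst 1%R)).
  by move=> x _; rewrite lee_fin ln_le.
rewrite integralB_EFin//; last exact: (integrable_cst 1%R).
rewrite int_nu_f integral_cst//.
rewrite [X in _ - _ * X](_ : _ = 1); last exact: probability_setT.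
by rewrite mule1 -EFinB lee_fin; lra.
Qed.

(** The free parameter [a] accepts an upper bound of the affinity in place of its value; integrating
    the tangent inequality leaves [2 * (1 - ln a) - 2 * beta / a], and [beta / a <= 1]. *)
Lemma kullback_ge (a : R) : (0 < a)%R -> (beta <= a)%R ->
  (- 2 * ln a)%:E <= kullback nu mu.
Proof.
move=> a0 ba; rewrite kullbackE.
apply: (@le_trans _ _ (\int[nu]_x
    (2 * (1 - ln a) - 2 / a * isqrt x)%:E)); last first.
  apply: le_integral => //.
    exact: (integrableB measurableT (integrable_cst (2 * (1 - ln a))%R)
      (integrableZl measurableT (2 / a)%R integrable_isqrt)).
  by move=> x _; rewrite lee_fin ln_ge.
rewrite integralB_EFin//; last 2 first.
- exact: (integrable_cst _).
- exact: (integrableZl measurableT (2 / a)%R integrable_isqrt).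
under [X in _ - X]eq_integral do rewrite EFinM.
rewrite integralZl// int_nu_isqrt integral_cst//.
rewrite [X in _ * X - _](_ : _ = 1); last exact: probability_setT.
rewrite mule1 -EFinM -EFinB lee_fin.
have : (beta / a <= 1)%R by rewrite ler_pdivrMr// mul1r.
have -> : (2 / a * beta = 2 * (beta / a))%R by field; rewrite gt_eqF.
lra.
Qed.

End density_distances.

(** * Distances between Gaussian laws *)

Section gaussian_ratio.
Context (R : realType) (n : nat).
Implicit Types (m x : 'rV[R]_n) (s sigma : R).

Definition gaussian_ratio m s sigma x : R :=
  \prod_i normal_ratio (m ord0 i) s sigma (x ord0 i).

Lemma enorm_sqr x : enorm x ^+ 2 = \sum_i x ord0 i ^+ 2.
Proof. by rewrite /enorm sqr_sqrtr// sumr_ge0// => i _; exact: sqr_ge0. Qed.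

Lemma gaussian0E sigma :
  gaussian (0 : 'rV[R]_n) sigma = rV_prod (fun=> normal_prob 0 sigma).
Proof. by congr rV_prod; apply/funext => i; rewrite mxE. Qed.

Lemma gaussian_ratio_gt0 m s sigma x : 0 < s -> 0 < sigma ->
  0 < gaussian_ratio m s sigma x.
Proof. by move=> s0 t0; apply: prodr_gt0 => i _; exact: normal_ratio_gt0. Qed.

Lemma measurable_gaussian_ratio m s sigma : 0 < s -> 0 < sigma ->
  measurable_fun setT (gaussian_ratio m s sigma).
Proof.
move=> s0 t0; apply: measurable_prod => i _.
apply: (measurableT_comp (f := normal_ratio (m ord0 i) s sigma)
  _ (measurable_coord i)).
by apply: measurable_normal_ratio; rewrite gt_eqF.
Qed.

Lemma gaussian_density m s sigma A : 0 < s -> 0 < sigma -> measurable A ->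
  (gaussian m s A =
   \int[gaussian 0 sigma]_(x in A) (gaussian_ratio m s sigma x)%:E)%E.
Proof.
move=> s0 t0 mA; rewrite gaussian0E.
apply: (rV_prod_density (f := fun i => normal_ratio (m ord0 i) s sigma)) => //.
- by move=> i; apply: measurable_normal_ratio; rewrite gt_eqF.
- by move=> i x; rewrite ltW// normal_ratio_gt0.
- by move=> i B mB; exact: normal_prob_ratio.
Qed.

Lemma sqrtr_prod (I : finType) (F : I -> R) : (forall i, 0 <= F i) ->
  Num.sqrt (\prod_i F i) = \prod_i Num.sqrt (F i).
Proof.
move=> F0; elim/big_rec2 : _ => [|i y1 y2 _ <-]; first exact: sqrtr1.
by rewrite sqrtrM.
Qed.

Lemma lee_prod (I : finType) (F G : I -> \bar R) :
  (forall i, (0 <= F i <= G i)%E) -> (\prod_i F i <= \prod_i G i)%E.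
Proof.
move=> FG; suff : (0 <= \prod_i F i <= \prod_i G i)%E by case/andP.
elim/big_rec2 : _ => [|i y1 y2 _ /andP[y0 y12]]; first by rewrite lexx lee01.
by have /andP[F0 Fi] := FG i; rewrite mule_ge0//= lee_pmul.
Qed.

Lemma integral_sqrt_gaussian_ratio m s sigma : 0 < s -> 0 < sigma ->
  (\int[gaussian 0 sigma]_x (Num.sqrt (gaussian_ratio m s sigma x))%:E <=
   (expR (- enorm m ^+ 2 / (4 * (s ^+ 2 + sigma ^+ 2))))%:E)%E.
Proof.
move=> s0 t0; rewrite gaussian0E.
rewrite (eq_integral (fun x : 'rV[R]_n => (\prod_i Num.sqrt
   (normal_ratio (m ord0 i) s sigma (x ord0 i)))%:E)); last first.
  move=> x _; rewrite /gaussian_ratio sqrtr_prod// => i.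
  by rewrite ltW// normal_ratio_gt0.
rewrite (integral_rV_prod _
  (g := fun i (x : R) => Num.sqrt (normal_ratio (m ord0 i) s sigma x)))//; last first.
  move=> i; apply: (@measurableT_comp _ _ _ _ _ _ (@Num.sqrt R)).
    by apply: continuous_measurable_fun; exact: sqrt_continuous.
  by apply: measurable_normal_ratio; rewrite gt_eqF.
rewrite enorm_sqr -sumrN mulr_suml expR_sum -prodEFin; apply: lee_prod => i.
rewrite integral_sqrt_normal_ratio// andbT.
by apply: integral_ge0 => x _; rewrite lee_fin.
Qed.

Lemma integral_gaussian_ratio_sqr m s sigma q : 0 < s -> 0 < sigma ->
  0 <= q <= 2^-1 -> s ^+ 2 = (1 - q) * sigma ^+ 2 ->
  (\int[gaussian 0 sigma]_x (gaussian_ratio m s sigma x ^+ 2)%:E <=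
   (expR (n%:R * q ^+ 2 + enorm m ^+ 2 / sigma ^+ 2))%:E)%E.
Proof.
move=> s0 t0 q01 s2; rewrite gaussian0E.
rewrite (eq_integral (fun x : 'rV[R]_n => (\prod_i
   (normal_ratio (m ord0 i) s sigma (x ord0 i) ^+ 2))%:E)); last first.
  by move=> x _; rewrite /gaussian_ratio prodrXl.
rewrite (integral_rV_prod _
  (g := fun i (x : R) => normal_ratio (m ord0 i) s sigma x ^+ 2))//; first last.
- by move=> i x; exact: sqr_ge0.
- move=> i; apply: measurable_funX.
  by apply: measurable_normal_ratio; rewrite gt_eqF.
have -> : n%:R * q ^+ 2 + enorm m ^+ 2 / sigma ^+ 2 =
    \sum_(i < n) (q ^+ 2 + m ord0 i ^+ 2 / sigma ^+ 2).
  by rewrite big_split/= sumr_const card_ord mulr_natl enorm_sqr mulr_suml.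
rewrite expR_sum -prodEFin; apply: lee_prod => i.
rewrite integral_normal_ratio_sqr// andbT.
by apply: integral_ge0 => x _; rewrite lee_fin sqr_ge0.
Qed.

Lemma integral_rV_coord (mu : 'I_n -> probability (measurableTypeR R) R)
    (g : R -> R) i : measurable_fun setT g -> (forall y, 0 <= g y) ->
  (\int[rV_prod mu]_x (g (x ord0 i))%:E = \int[mu i]_y (g y)%:E)%E.
Proof.
move=> mg g0.
transitivity (\int[rV_prod mu]_x
    (\prod_j (if j == i then g else cst 1) (x ord0 j))%:E)%E.
  apply: eq_integral => x _; rewrite (bigD1 i)//= eqxx big1 ?mulr1//.
  by move=> j /negbTE ->.
rewrite (integral_rV_prod _ (g := fun j => if j == i then g else cst 1)).
- rewrite (bigD1 i)//= eqxx big1 ?mule1// => j /negbTE -> /=.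
  rewrite integral_cst// mul1e; exact: probability_setT.
- by move=> j; case: ifP.
- by move=> j x; case: ifP.
Qed.

Lemma measurable_enorm_sqr_sub m :
  measurable_fun setT (fun x => enorm (x - m) ^+ 2).
Proof.
under eq_fun do rewrite enorm_sqr.
apply: measurable_sum => i; apply: measurable_funX.
under eq_fun do rewrite !mxE.
by apply: measurable_funB => //; exact: measurable_coord.
Qed.

Lemma gaussian_second_moment m s : 0 < s ->
  (\int[gaussian m s]_x (enorm (x - m) ^+ 2)%:E <= (8 * n%:R * s ^+ 2)%:E)%E.
Proof.
move=> s0; under eq_integral do rewrite enorm_sqr -sumEFin.
have mq (k : R) : measurable_fun [set: R] (fun y : R => (y - k) ^+ 2).
  by apply: measurable_funX; exact: measurable_funB.
rewrite ge0_integral_sum//; last 2 first.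
- move=> i; apply/measurable_EFinP; under eq_fun do rewrite !mxE.
  exact: (measurableT_comp (mq (m ord0 i)) (measurable_coord i)).
- by move=> i x _; rewrite lee_fin sqr_ge0.
rewrite (_ : (8 * n%:R * s ^+ 2)%:E = (\sum_(i < n) (8 * s ^+ 2)%:E)%E); last first.
  by rewrite sumEFin sumr_const card_ord -mulr_natr; congr EFin; ring.
apply: lee_sum => i _; under eq_integral do rewrite !mxE.
rewrite (integral_rV_coord _ (g := fun y => (y - m ord0 i) ^+ 2))//; last first.
  by move=> x; exact: sqr_ge0.
exact: normal_prob_second_moment.
Qed.

End gaussian_ratio.

(** * Wasserstein distance between Gaussian laws *)

Section wasserstein_gaussian.
Local Open Scope ereal_scope.
Context (R : realType) (n : nat).
Variables (nu mu : probability 'rV[R]_n R) (m : 'rV[R]_n) (a sigma : R).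
Hypotheses (a0 : (0 < a)%R) (sigma0 : (0 < sigma)%R).
Hypothesis lawnu : forall A, measurable A -> nu A = gaussian m (a * sigma)%R A.
Hypothesis lawmu : forall A, measurable A -> mu A = gaussian 0%R sigma A.

(** The coupling of a variable of law [mu] with its image under the affine map sending [mu] to
    [nu]. *)
Let transport (y : 'rV[R]_n) := (a *: y + m, y)%R.

Let m_transport : measurable_fun setT transport.
Proof. by apply: measurable_fun_pair => //; exact: measurable_rV_affine. Qed.

HB.instance Definition _ := isMeasurableFun.Build _ _ _ _ transport m_transport.

Let transport_coupling : couplings nu mu (distribution (gaussian 0%R sigma) transport).
Proof.
split => A mA.
  rewrite (lawnu mA) -[LHS]/(gaussian 0%R sigma ((fun y => (a *: y + m)%R) @^-1` A)).
  exact: centered_gaussian_affine.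
by rewrite lawmu.
Qed.

Let m_enorm_sqr_diff : measurable_fun [set: 'rV[R]_n * 'rV[R]_n]
  (fun z => (enorm (z.1 - z.2) ^+ 2)%R).
Proof.
under eq_fun do rewrite enorm_sqr.
apply: measurable_sum => i; apply: measurable_funX.
under eq_fun do rewrite !mxE.
apply: measurable_funB.
  exact: (measurableT_comp (measurable_coord i) measurable_fst).
exact: (measurableT_comp (measurable_coord i) measurable_snd).
Qed.

(** The cost of [transport] at [y] is the squared norm of [(a - 1) y + m], at most twice the sum of
    the squared norms; 16 is 2 times the 8 of [gaussian_second_moment]. *)
Lemma wasserstein_gaussian_le :
  wasserstein nu mu <=
  (Num.sqrt (2 * enorm m ^+ 2 + 16 * n%:R * (a - 1) ^+ 2 * sigma ^+ 2))%:E.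
Proof.
rewrite /wasserstein
  -[leRHS]/(sqrte (2 * enorm m ^+ 2 + 16 * n%:R * (a - 1) ^+ 2 * sigma ^+ 2)%:E).
rewrite lee_sqrt; last first.
  by rewrite lee_fin; do ?[apply: sqr_ge0|apply: addr_ge0|apply: mulr_ge0|exact: ler0n].
apply: ge_ereal_inf; eexists.
  by exists (distribution (gaussian 0%R sigma) transport).
have mEz : measurable_fun setT
    (fun z : 'rV[R]_n * 'rV[R]_n => (enorm (z.1 - z.2) ^+ 2)%:E).
  exact/measurable_EFinP.
have E0 (z : 'rV[R]_n * 'rV[R]_n) : 0 <= (enorm (z.1 - z.2) ^+ 2)%:E.
  by rewrite lee_fin sqr_ge0.
rewrite (ge0_integral_distribution (P := gaussian 0%R sigma) transport mEz E0).
have mE : measurable_fun setT (fun y : 'rV[R]_n => enorm (y - 0) ^+ 2)%R.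
  exact: measurable_enorm_sqr_sub.
apply: (@le_trans _ _ (\int[gaussian 0%R sigma]_y
   ((2 * enorm m ^+ 2)%:E + (2 * (a - 1) ^+ 2)%:E * (enorm (y - 0) ^+ 2)%:E))).
  apply: ge0_le_integral => //.
  - by move=> y _; exact: (E0 (transport y)).
  - exact: (measurableT_comp mEz m_transport).
  - by apply: emeasurable_funD => //; apply: emeasurable_funM => //; exact/measurable_EFinP.
  move=> y _; rewrite -EFinM -EFinD lee_fin !enorm_sqr !mulr_sumr -big_split/=.
  apply: ler_sum => i _; rewrite !mxE subr0.
  have := sqr_ge0 (m ord0 i - (a - 1) * y ord0 i)%R; nra.
have mEy : measurable_fun setT (fun y : 'rV[R]_n => (enorm (y - 0) ^+ 2)%:E).
  exact/measurable_EFinP.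
have Ey0 (y : 'rV[R]_n) : 0 <= (enorm (y - 0) ^+ 2)%:E by rewrite lee_fin sqr_ge0.
have k1 : (0 <= 2 * enorm m ^+ 2)%R by rewrite mulr_ge0// sqr_ge0.
have k2 : (0 <= 2 * (a - 1) ^+ 2)%R by rewrite mulr_ge0// sqr_ge0.
rewrite ge0_integralD//; last 2 first.
- by move=> y _; rewrite mule_ge0// lee_fin.
- exact: emeasurable_funM.
rewrite ge0_integralZl// integral_probability_cst EFinD leeD2l//.
apply: (@le_trans _ _ ((2 * (a - 1) ^+ 2)%:E * (8 * n%:R * sigma ^+ 2)%:E)).
  by apply: lee_wpmul2l; [rewrite lee_fin|exact: gaussian_second_moment].
by rewrite -EFinM lee_fin le_eqVlt; apply/orP; left; apply/eqP; ring.
Qed.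

(** For any coupling (X, Y), [m] is the sum of the three vectors X - Y, - (X - m) and Y, so its
    squared norm is at most 3 times the sum of theirs. The expectations of the last two depend on
    the marginals only. *)
Lemma wasserstein_gaussian_ge :
  (Num.sqrt (enorm m ^+ 2 / 3 - 8 * n%:R * (a ^+ 2 + 1) * sigma ^+ 2))%:E
  <= wasserstein nu mu.
Proof.
rewrite /wasserstein
  -[leLHS]/(sqrte (enorm m ^+ 2 / 3 - 8 * n%:R * (a ^+ 2 + 1) * sigma ^+ 2)%:E).
rewrite lee_sqrt; last first.
  apply: le_ereal_inf_tmp => _ [ga _ <-].
  by apply: integral_ge0 => z _; rewrite lee_fin sqr_ge0.
apply: le_ereal_inf_tmp => _ [ga [ga1 ga2] <-].
have as0 : (0 < a * sigma)%R by exact: mulr_gt0.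
have mE := @measurable_enorm_sqr_sub R n.
have int_marginal (p : 'rV[R]_n * 'rV[R]_n -> 'rV[R]_n) (v : 'rV[R]_n) (s : R) : (0 < s)%R ->
    measurable_fun setT p ->
    (forall A, measurable A -> ga (p @^-1` A) = gaussian v s A) ->
    \int[ga]_z (enorm (p z - v) ^+ 2)%:E <= (8 * n%:R * s ^+ 2)%:E.
  move=> s0 mp gap; apply: le_trans (gaussian_second_moment v s0).
  rewrite [leRHS](eq_measure_integral (image_measure ga mp)); last first.
    by move=> A mA _; exact/esym/gap.
  rewrite ge0_integral_pushforward//; first exact/measurable_EFinP.
  by move=> y _; rewrite lee_fin sqr_ge0.
have int1 := @int_marginal fst m _ as0 measurable_fst
  (fun A mA => etrans (ga1 A mA) (lawnu mA)).
have int2 := @int_marginal snd 0%R _ sigma0 measurable_snd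
  (fun A mA => etrans (ga2 A mA) (lawmu mA)).
have m1 : measurable_fun setT (fun z : 'rV[R]_n * 'rV[R]_n => enorm (z.1 - m) ^+ 2)%R.
  exact: (measurableT_comp (mE m) measurable_fst).
have m2 : measurable_fun setT (fun z : 'rV[R]_n * 'rV[R]_n => enorm (z.2 - 0) ^+ 2)%R.
  exact: (measurableT_comp (mE 0%R) measurable_snd).
have mEz : measurable_fun setT
    (fun z : 'rV[R]_n * 'rV[R]_n => (enorm (z.1 - z.2) ^+ 2)%:E).
  exact/measurable_EFinP.
have mE1 : measurable_fun setT
    (fun z : 'rV[R]_n * 'rV[R]_n => (enorm (z.1 - m) ^+ 2)%:E).
  exact/measurable_EFinP.
have mE2 : measurable_fun setT
    (fun z : 'rV[R]_n * 'rV[R]_n => (enorm (z.2 - 0) ^+ 2)%:E).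
  exact/measurable_EFinP.
have E0 (x : 'rV[R]_n) : 0 <= (enorm x ^+ 2)%:E by rewrite lee_fin sqr_ge0.
have sum3 : (enorm m ^+ 2 / 3)%:E <= \int[ga]_z (enorm (z.1 - z.2) ^+ 2)%:E +
    (\int[ga]_z (enorm (z.1 - m) ^+ 2)%:E + \int[ga]_z (enorm (z.2 - 0) ^+ 2)%:E).
  rewrite -(integral_probability_cst ga) -ge0_integralD// -ge0_integralD//; last 2 first.
  - by move=> z _; rewrite adde_ge0.
  - exact: emeasurable_funD.
  apply: ge0_le_integral => //.
  - by move=> z _; rewrite lee_fin divr_ge0// sqr_ge0.
  - by apply: emeasurable_funD => //; exact: emeasurable_funD.
  move=> z _; rewrite -!EFinD lee_fin !enorm_sqr mulr_suml -!big_split/=.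
  apply: ler_sum => i _; rewrite !mxE subr0.
  move: (m ord0 i) (z.1 ord0 i) (z.2 ord0 i) => x y w.
  (* The first three squares add up to 3 times the right-hand side minus [x ^+ 2]. *)
  have := sqr_ge0 ((y - w) + (y - x))%R; have := sqr_ge0 ((y - w) - w)%R.
  have := sqr_ge0 ((y - x) + w)%R; have := sqr_ge0 ((y - w) - (x - y))%R.
  have := sqr_ge0 ((y - w) + w)%R; have := sqr_ge0 ((y - x) - w)%R; nra.
move: sum3 int1 int2.
have : 0 <= \int[ga]_z (enorm (z.1 - m) ^+ 2)%:E by apply: integral_ge0.
have : 0 <= \int[ga]_z (enorm (z.2 - 0) ^+ 2)%:E by apply: integral_ge0.
have : 0 <= \int[ga]_z (enorm (z.1 - z.2) ^+ 2)%:E by apply: integral_ge0.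
case: (\int[ga]_z (enorm (z.1 - z.2) ^+ 2)%:E) => [i0||]//; last by move=> *; exact: leey.
case: (\int[ga]_z _) => [i1||]//; case: (\int[ga]_z _) => [i2||]//.
rewrite -!EFinD !lee_fin exprMn => _ _ _; lra.
Qed.

End wasserstein_gaussian.

Section integral_mono.
Local Open Scope ereal_scope.
Context d (T : measurableType d) (R : realType) (mu : {measure set T -> \bar R}).

(* [ge0_le_integral] without its measurability hypotheses: here [f] or [g] may
   be a density of which only the differentiability is known. *)
Lemma ge0_integral_mono (D : set T) (f g : T -> \bar R) :
  (forall x, D x -> 0 <= f x) -> (forall x, D x -> f x <= g x) ->
  \int[mu]_(x in D) f x <= \int[mu]_(x in D) g x.
Proof.
move=> f0 fg.
have g0 x : D x -> 0 <= g x by move=> Dx; exact: le_trans (f0 x Dx) (fg x Dx).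
rewrite !ge0_integralE//; apply: ereal_sup_le => _ [h /= hf <-].
exists h => //= x; apply: le_trans (hf x) _; rewrite !patchE.
by case: ifPn => // /set_mem/fg.
Qed.

End integral_mono.

(** * Uniqueness of the differentiable density, Fisher information *)

Section continuous_density.
Context (R : realType) (n : nat) (nu mu : probability 'rV[R]_n R) (sigma : R).
Hypothesis sigma0 : 0 < sigma.
Hypothesis lawmu : forall A, measurable A -> mu A = gaussian 0 sigma A.

Lemma normal_prob_itv_gt0 (a b : R) : a < b -> (0 < normal_prob 0%R sigma `]a, b[)%E.
Proof.
move=> ab; pose M := Num.max `|a| `|b|.
pose c := (sigma * Num.sqrt (2 * pi))^-1 * expR (- M ^+ 2 / (2 * sigma ^+ 2)).
have c0 : 0 < c.
  by rewrite mulr_gt0 ?expR_gt0// invr_gt0 mulr_gt0// sqrtr_gt0 mulr_gt0// pi_gt0.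
apply: (@lt_le_trans _ _ (\int[lebesgue_measure]_(x in `]a, b[) (cst c%:E x))%E).
  rewrite integral_cst//= lebesgue_measure_itv/= lte_fin ab -EFinB -EFinM lte_fin.
  by rewrite mulr_gt0// subr_gt0.
rewrite /normal_prob; apply: ge0_integral_mono.
  by move=> x _; rewrite lee_fin ltW.
move=> x /=; rewrite in_itv/= => /andP[ax xb]; rewrite lee_fin normal_pdf_expR//.
rewrite subr0 /c ler_wpM2l//.
  by rewrite invr_ge0 mulr_ge0// ?ltW// mulr_gt0// pi_gt0.
rewrite ler_expR ler_wpM2r ?invr_ge0 ?mulr_ge0 ?(ltW sigma0)// lerN2.
have aM : `|a| <= M by rewrite le_max lexx.
have bM : `|b| <= M by rewrite le_max lexx orbT.
have xM : `|x| <= M.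
  by have := ler_norm b; have := ler_norm (- a); rewrite normrN ler_norml; lra.
by rewrite -(real_normK (num_real x)) lerXn2r// nnegrE (le_trans _ xM).
Qed.

Lemma measurable_itv_box (x : 'rV[R]_n) (e : R) :
  measurable [set y : 'rV[R]_n | forall i, `]x ord0 i - e, x ord0 i + e[%classic (y ord0 i)].
Proof.
apply: (measurable_box (A := fun i => `]x ord0 i - e, x ord0 i + e[%classic)) => i.
exact: measurable_itv.
Qed.

Lemma gaussian_box_gt0 (x : 'rV[R]_n) (e : R) : 0 < e ->
  (0 < mu [set y : 'rV[R]_n | forall i,
    `](x ord0 i - e)%R, (x ord0 i + e)%R[%classic (y ord0 i)])%E.
Proof.
move=> e0; rewrite lawmu; last exact: measurable_itv_box.
rewrite gaussian0E.
rewrite (rV_prodE _ (A := fun i => `]x ord0 i - e, x ord0 i + e[%classic)); last first.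
  by move=> i; exact: measurable_itv.
elim/big_ind : _ => //; first by move=> u v u0 v0; exact: mule_gt0.
by move=> i _; apply: normal_prob_itv_gt0; rewrite ltrBlDr -addrA ltrDl addr_gt0.
Qed.

(** If [f x < g x], two levels [k < k'] separate [f] from [g] on a box around [x]. The mass of the
    box under [nu] is then at most [k] times and at least [k'] times its positive mass under
    [mu]. *)
Lemma continuous_density_le (f g : 'rV[R]_n -> R) :
  (forall x, 0 <= f x) -> (forall x, 0 <= g x) -> continuous f -> continuous g ->
  (forall A, measurable A -> nu A = \int[mu]_(x in A) (f x)%:E)%E ->
  (forall A, measurable A -> nu A = \int[mu]_(x in A) (g x)%:E)%E ->
  forall x, g x <= f x.
Proof.
move=> f0 g0 cf cg nuf nug x; rewrite leNgt; apply/negP => fg.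
pose k := (f x + g x) / 2; pose k' := (k + g x) / 2.
have fk : f x < k by rewrite /k; lra.
have kk' : k < k' by rewrite /k' /k; lra.
have k'g : k' < g x by rewrite /k' /k; lra.
have : \forall y \near x, f y < k by exact: (cvgr_lt _ (cf x)).
have : \forall y \near x, k' < g y by exact: (cvgr_gt _ (cg x)).
move=> H1 H2; have : \forall y \near x, f y < k /\ k' < g y.
  by near=> y; split; near: y.
move=> /nbhs_ballP[e /= e0 xe].
pose U := [set y : 'rV[R]_n | forall i, `]x ord0 i - e, x ord0 i + e[%classic (y ord0 i)].
have mU : measurable U by exact: measurable_itv_box.
have Uball y : U y -> ball x e y.
  move=> Uy; split => // i j; rewrite (ord1 i); have := Uy j.
  by rewrite /= in_itv/= /ball/= ltr_distlC.
have muU : (0 < mu U)%E by exact: gaussian_box_gt0.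
have k0 : 0 <= k by rewrite (le_trans (f0 x))// ltW.
have k'0 : 0 <= k' by rewrite (le_trans k0)// ltW.
have H3 : (nu U <= k%:E * mu U)%E.
  rewrite nuf// -integral_cst//; apply: ge0_integral_mono => y Uy; rewrite lee_fin//.
  by have [/ltW] := xe y (Uball y Uy).
have H4 : (k'%:E * mu U <= nu U)%E.
  rewrite nug// -integral_cst//; apply: ge0_integral_mono => y Uy; rewrite lee_fin//.
  by have [_ /ltW] := xe y (Uball y Uy).
have muUf : mu U \is a fin_num by rewrite fin_num_measure.
move: muU (le_trans H4 H3) muUf; case: (mu U) => [u||]//.
rewrite lte_fin -!EFinM lee_fin => u0 + _; nra.
Unshelve. all: by end_near.
Qed.

End continuous_density.

Section fisher_gaussian.
Context (R : realType) (n : nat) (m : 'rV[R]_n) (s sigma : R).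
Hypotheses (s0 : 0 < s) (sigma0 : 0 < sigma).

Let logratio_coord (i : 'I_n) (y : R) : R :=
  ln (sigma / s) + (- (y - m ord0 i) ^+ 2 / (2 * s ^+ 2) + y ^+ 2 / (2 * sigma ^+ 2)).

Let logratio (x : 'rV[R]_n) : R := \sum_i logratio_coord i (x ord0 i).

Let kappa : R := (sigma ^+ 2)^-1 - (s ^+ 2)^-1.

Let gaussian_ratioE x : gaussian_ratio m s sigma x = expR (logratio x).
Proof.
rewrite /gaussian_ratio /logratio expR_sum; apply: eq_bigr => i _.
by rewrite /logratio_coord expRD lnK// posrE divr_gt0.
Qed.

Let differentiable_logratio x : differentiable logratio x.
Proof.
suff H (r : seq 'I_n) :
    differentiable (fun x : 'rV[R]_n => \sum_(i <- r) logratio_coord i (x ord0 i)) x.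
  exact: H.
elim: r => [|i r IH].
  rewrite (_ : (fun y => _) = cst 0); first exact: differentiable_cst.
  by apply/funext => y; rewrite big_nil.
rewrite (_ : (fun y => _) = (fun y : 'rV[R]_n => logratio_coord i (y ord0 i)) +
    (fun y : 'rV[R]_n => \sum_(j <- r) logratio_coord j (y ord0 j))); last first.
  by apply/funext => y; rewrite big_cons.
apply: differentiableD => //.
have dc : differentiable (fun x : 'rV[R]_n => x ord0 i) x by exact: differentiable_coord.
have cst_diff (c : R) : differentiable (cst c : 'rV[R]_n -> R) x.
  exact: differentiable_cst.
have dB := differentiableB dc (cst_diff (m ord0 i)).
have d1 := differentiableM (differentiableN (differentiableM dB dB))
  (cst_diff (2 * s ^+ 2)^-1).
have d2 := differentiableM (differentiableM dc dc) (cst_diff (2 * sigma ^+ 2)^-1).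
exact: (differentiableD (cst_diff (ln (sigma / s))) (differentiableD d1 d2)).
Qed.

Lemma differentiable_gaussian_ratio x : differentiable (gaussian_ratio m s sigma) x.
Proof.
rewrite (_ : gaussian_ratio m s sigma = expR \o logratio); last exact/funext.
apply: differentiable_comp => //.
by apply/derivable1_diffP; exact: derivable_expR.
Qed.

(** The log-ratio is a quadratic polynomial: its increment along a basis vector is exactly
    [h * D + h ^+ 2 * (kappa / 2)], and the difference quotient tends to [D]. Centring at [m]
    separates the contribution of the mean from that of the variance mismatch [kappa]. *)
Lemma gradient_ln_gaussian_ratio x :
  gradient (fun y => ln (gaussian_ratio m s sigma y)) x =
  (sigma ^+ 2)^-1 *: m + kappa *: (x - m).
Proof.
apply/rowP => i; rewrite !mxE.
rewrite (_ : (fun y => ln _) = logratio); last first.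
  by apply/funext => y; rewrite gaussian_ratioE expRK.
apply: cvg_lim => //.
set D := (X in _ --> X).
have E h : logratio (h *: delta_mx ord0 i + x) - logratio x = h * D + h ^+ 2 * (kappa / 2).
  rewrite /logratio -sumrB (bigD1 i)//= big1 => [|j /negbTE ji]; last first.
    by rewrite !mxE eqxx ji mulr0 add0r subrr.
  rewrite addr0 !mxE !eqxx mulr1 /logratio_coord /D /kappa; field.
  by rewrite (gt_eqF s0) (gt_eqF sigma0).
have : D + h * (kappa / 2) @[h --> 0^'] --> D.
  have c0 : h * (kappa / 2) @[h --> 0^'] --> 0 * (kappa / 2).
    by apply: cvgM; [move=> A; exact: nbhs_dnbhs|exact: cvg_cst].
  rewrite mul0r in c0; rewrite -[X in _ --> X]addr0; apply: cvgD => //.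
  exact: cvg_cst.
apply: cvg_trans; apply: near_eq_cvg; near=> h.
have h0 : h != 0 by near: h; exact: nbhs_dnbhs_neq.
by rewrite /= E /GRing.scale/= mulrDr expr2 !mulrA mulVf// !mul1r.
Unshelve. all: by end_near.
Qed.

Variables nu mu : probability 'rV[R]_n R.
Hypothesis lawnu : forall A, measurable A -> nu A = gaussian m s A.
Hypothesis lawmu : forall A, measurable A -> mu A = gaussian 0 sigma A.

Let nuE A : measurable A ->
  (nu A = \int[mu]_(x in A) (gaussian_ratio m s sigma x)%:E)%E.
Proof.
move=> mA; rewrite lawnu// (gaussian_density m s0 sigma0 mA).
by apply: eq_measure_integral => B mB _; exact/esym/lawmu.
Qed.

Lemma fisher_gaussianE : (fisher nu mu =
  \int[nu]_x (enorm (((sigma ^+ 2)^-1 *: m + kappa *: (x - m))%R) ^+ 2)%:E)%E.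
Proof.
rewrite /fisher asboolT; last first.
  apply: (density_dominates (measurable_gaussian_ratio m s0 sigma0) nuE).
rewrite [X in ereal_inf X](_ : _ = [set \int[nu]_x
  (enorm (((sigma ^+ 2)^-1 *: m + kappa *: (x - m))%R) ^+ 2)%:E]%E) ?ereal_inf1//.
have G0 x : 0 <= gaussian_ratio m s sigma x by rewrite ltW// gaussian_ratio_gt0.
apply/seteqP; split => [_ [f [f0 df fE] <-]|_ ->] /=.
  (* [fisher] is an infimum over the differentiable densities: there is only
     one, as [mu] charges every box. *)
  suff -> : f = gaussian_ratio m s sigma.
    by apply: eq_integral => x _; rewrite gradient_ln_gaussian_ratio.
  have cf : continuous f by move=> x; exact: differentiable_continuous.
  have cg : continuous (gaussian_ratio m s sigma).
    by move=> x; apply: differentiable_continuous; exact: differentiable_gaussian_ratio.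
  apply/funext => x; apply/eqP; rewrite eq_le; apply/andP; split.
    exact: (continuous_density_le sigma0 lawmu G0 f0 cg cf nuE fE).
  exact: (continuous_density_le sigma0 lawmu f0 G0 cf cg fE nuE).
exists (gaussian_ratio m s sigma).
  by split => //; exact: differentiable_gaussian_ratio.
by apply: eq_integral => x _; rewrite gradient_ln_gaussian_ratio.
Qed.

Let second_moment :
  (\int[nu]_x (enorm (x - m) ^+ 2)%:E <= (8 * n%:R * s ^+ 2)%:E)%E.
Proof.
apply: le_trans (gaussian_second_moment m s0).
by rewrite (eq_measure_integral (gaussian m s))// => A mA _; exact: lawnu.
Qed.

Let mE : measurable_fun setT (fun x : 'rV[R]_n => (enorm (x - m) ^+ 2)%:E).
Proof. by apply/measurable_EFinP; exact: measurable_enorm_sqr_sub. Qed.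

Let E0 (x : 'rV[R]_n) : (0 <= (enorm x ^+ 2)%:E)%E.
Proof. by rewrite lee_fin sqr_ge0. Qed.

Let mG : measurable_fun setT
  (fun x : 'rV[R]_n => (enorm ((sigma ^+ 2)^-1 *: m + kappa *: (x - m)) ^+ 2)%:E).
Proof.
apply/measurable_EFinP.
rewrite (_ : (fun x : 'rV[R]_n => _) = (fun y : 'rV[R]_n => enorm (y - 0) ^+ 2) \o
  (fun x => kappa *: x + ((sigma ^+ 2)^-1 *: m - kappa *: m))); last first.
  apply/funext => x /=; congr (enorm _ ^+ 2).
  by rewrite subr0 scalerBr addrCA.
exact: (measurableT_comp (measurable_enorm_sqr_sub _) (measurable_rV_affine _ _)).
Qed.

Lemma fisher_gaussian_le : (fisher nu mu <=
  (2 * enorm m ^+ 2 / sigma ^+ 4 +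
   16 * n%:R * ((sigma ^+ 2)^-1 - (s ^+ 2)^-1) ^+ 2 * s ^+ 2)%:E)%E.
Proof.
rewrite fisher_gaussianE -/kappa.
have k1 : 0 <= 2 * enorm m ^+ 2 / sigma ^+ 4.
  by apply: divr_ge0; [apply: mulr_ge0 => //; exact: sqr_ge0|exact/exprn_ge0/ltW].
have k2 : 0 <= 2 * kappa ^+ 2 by rewrite mulr_ge0// sqr_ge0.
apply: (@le_trans _ _ (\int[nu]_x ((2 * enorm m ^+ 2 / sigma ^+ 4)%:E +
    (2 * kappa ^+ 2)%:E * (enorm (x - m)%R ^+ 2)%:E))%E).
  apply: ge0_le_integral => //.
    by apply: emeasurable_funD => //; exact: emeasurable_funM.
  move=> x _; rewrite -EFinM -EFinD lee_fin !enorm_sqr !mulr_sumr mulr_suml -big_split/=.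
  apply: ler_sum => i _; rewrite !mxE.
  have -> : 2 * m ord0 i ^+ 2 / sigma ^+ 4 = 2 * ((sigma ^+ 2)^-1 * m ord0 i) ^+ 2.
    by field; rewrite gt_eqF.
  move: ((sigma ^+ 2)^-1 * m ord0 i) (x ord0 i - m ord0 i) => u v.
  have := sqr_ge0 (u - kappa * v); nra.
rewrite ge0_integralD//; last 2 first.
- by move=> x _; rewrite mule_ge0// lee_fin.
- exact: emeasurable_funM.
rewrite ge0_integralZl// integral_probability_cst EFinD leeD2l//.
apply: (@le_trans _ _ ((2 * kappa ^+ 2)%:E * (8 * n%:R * s ^+ 2)%:E)%E).
  by apply: lee_wpmul2l => //; rewrite lee_fin.
by rewrite -EFinM lee_fin le_eqVlt; apply/orP; left; apply/eqP; ring.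
Qed.

(** With [u] the mean part and [v] the centred part, [u^2 / 2 <= (u + kappa v)^2 + kappa^2 v^2],
    because twice the difference is [(u + 2 kappa v)^2]. Adding the second moment on the right
    avoids expanding a cross term under the integral. *)
Lemma fisher_gaussian_ge : ((enorm m ^+ 2 / (2 * sigma ^+ 4) -
   8 * n%:R * ((sigma ^+ 2)^-1 - (s ^+ 2)^-1) ^+ 2 * s ^+ 2)%:E <= fisher nu mu)%E.
Proof.
rewrite fisher_gaussianE -/kappa.
have k1 : 0 <= enorm m ^+ 2 / (2 * sigma ^+ 4).
  by apply: divr_ge0; [exact: sqr_ge0|apply: mulr_ge0 => //; exact/exprn_ge0/ltW].
have k2 : 0 <= kappa ^+ 2 by exact: sqr_ge0.
set I := (X in (_ <= X)%E).
have : ((enorm m ^+ 2 / (2 * sigma ^+ 4))%:E <= I +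
    (kappa ^+ 2)%:E * (8 * n%:R * s ^+ 2)%:E)%E.
  apply: (@le_trans _ _ (I + (kappa ^+ 2)%:E * \int[nu]_x (enorm (x - m)%R ^+ 2)%:E)%E); last first.
    by rewrite leeD2l// lee_wpmul2l// lee_fin.
  rewrite -ge0_integralZl// -(integral_probability_cst nu) /I -ge0_integralD//; last 2 first.
  - by move=> x _; rewrite mule_ge0// lee_fin.
  - exact: emeasurable_funM.
  apply: ge0_le_integral => //.
    by apply: emeasurable_funD => //; exact: emeasurable_funM.
  move=> x _; rewrite -EFinM -EFinD lee_fin !enorm_sqr !mulr_sumr mulr_suml -big_split/=.
  apply: ler_sum => i _; rewrite !mxE.
  have -> : m ord0 i ^+ 2 / (2 * sigma ^+ 4) = 2^-1 * ((sigma ^+ 2)^-1 * m ord0 i) ^+ 2.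
    by field; rewrite gt_eqF.
  move: ((sigma ^+ 2)^-1 * m ord0 i) (x ord0 i - m ord0 i) => u v.
  have := sqr_ge0 (u + kappa * v + kappa * v); nra.
rewrite -EFinM -leeBlDr// -EFinB; apply: le_trans.
by rewrite lee_fin le_eqVlt; apply/orP; left; apply/eqP; ring.
Qed.

End fisher_gaussian.

(** * Bounds for the law at a fixed time *)

Section ou_bounds.
Context (R : realType) (n : nat) (z : 'rV[R]_n) (E : R).
Variable nu : probability 'rV[R]_n R.
Hypotheses (n_gt0 : (0 < n)%N) (E_gt0 : 0 < E)
  (q_le : E ^+ 2 <= 2^-1).
Hypothesis lawnu : forall A, measurable A ->
  nu A = gaussian (E *: z) (Num.sqrt ((1 - E ^+ 2) / n%:R)) A.
(** Here [E] stands for the decay factor of the mean, [W] is the quantity controlled by the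
    assumptions on the starting points, and [a] is the squared distance of the means in units of the
    invariant variance. *)
Let q : R := E ^+ 2.
Let W : R := enorm z ^+ 2 / n%:R.
Let a : R := n%:R ^+ 2 * q * W.
Let s : R := Num.sqrt ((1 - E ^+ 2) / n%:R).
Let sigma : R := Num.sqrt n%:R^-1.
Let mu : probability 'rV[R]_n R := ou_invariant R n.
Let F := gaussian_ratio (E *: z) s sigma.

Let N_gt0 : 0 < n%:R :> R. Proof. by rewrite ltr0n. Qed.
Let q_gt0 : 0 < q. Proof. by rewrite exprn_gt0. Qed.
Let q_le' : q <= 2^-1. Proof. exact: q_le. Qed.
Let W_ge0 : 0 <= W. Proof. by rewrite divr_ge0 ?sqr_ge0// ltW. Qed.
Let a_ge0 : 0 <= a.
Proof. by rewrite mulr_ge0// mulr_ge0 ?sqr_ge0// ltW. Qed.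
Let s2E : s ^+ 2 = (1 - q) * sigma ^+ 2.
Proof.
rewrite !sqr_sqrtr ?invr_ge0 ?ler0n// divr_ge0// subr_ge0.
by rewrite (le_trans q_le')// invf_le1// ler1n.
Qed.
Let sigma2E : sigma ^+ 2 = n%:R^-1. Proof. by rewrite sqr_sqrtr// invr_ge0. Qed.
Let sigma_gt0 : 0 < sigma. Proof. by rewrite sqrtr_gt0 invr_gt0. Qed.
Let s_gt0 : 0 < s.
Proof. by rewrite sqrtr_gt0 divr_gt0// subr_gt0; have := q_le'; rewrite /q; lra. Qed.
Let enorm_mean : enorm (E *: z) ^+ 2 = q * n%:R * W.
Proof.
have -> : q * n%:R * W = q * enorm z ^+ 2 by rewrite /W; field; rewrite gt_eqF.
rewrite !enorm_sqr mulr_sumr.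
by apply: eq_bigr => i _; rewrite mxE exprMn.
Qed.

Let nuE A : measurable A -> (nu A = \int[mu]_(x in A) (F x)%:E)%E.
Proof. by move=> mA; rewrite lawnu// (gaussian_density (E *: z) s_gt0 sigma_gt0 mA). Qed.
Let mF : measurable_fun setT F. Proof. exact: measurable_gaussian_ratio. Qed.
Let F_gt0 x : 0 < F x. Proof. exact: gaussian_ratio_gt0. Qed.

(** The exponent of the Gaussian bound is [a / (4 * (2 - q))], at least [a / 8]. The integral is
    returned as a real number, as the distance estimates expect. *)
Let affinity : {beta : R | (\int[mu]_x (Num.sqrt (F x))%:E = beta%:E)%E &
  beta <= expR (- (a / 8))}.
Proof.
have le1 := integral_sqrt_gaussian_ratio (E *: z) s_gt0 sigma_gt0.
have ge0 : (0 <= \int[mu]_x (Num.sqrt (F x))%:E)%E.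
  by apply: integral_ge0 => x _; rewrite lee_fin.
have fin : (\int[mu]_x (Num.sqrt (F x))%:E)%E \is a fin_num.
  by rewrite ge0_fin_numE// (le_lt_trans le1)// ltry.
exists (fine (\int[mu]_x (Num.sqrt (F x))%:E)); first by rewrite fineK.
rewrite -lee_fin fineK// (le_trans le1)// lee_fin ler_expR.
rewrite enorm_mean s2E sigma2E mulNr lerN2 /a ler_pdivlMr; last first.
  by rewrite mulr_gt0// addr_gt0 ?mulr_gt0 ?invr_gt0//; have := q_le'; lra.
have -> : n%:R ^+ 2 * q * W / 8 * (4 * ((1 - q) / n%:R + n%:R^-1)) =
    q * n%:R * W * ((2 - q) / 2) by field; rewrite gt_eqF.
have h0 : 0 <= q * n%:R * W by apply: mulr_ge0 => //; apply: mulr_ge0 => //; exact: ltW.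
rewrite ler_piMr//; have := q_gt0; lra.
Qed.

Let chi : {c : R | (\int[mu]_x (F x ^+ 2)%:E = (1 + c)%:E)%E &
  c <= expR (n%:R * q ^+ 2 + a) - 1}.
Proof.
have le1 := integral_gaussian_ratio_sqr (E *: z) s_gt0 sigma_gt0 _ s2E.
have q01 : 0 <= q <= 2^-1 by rewrite (ltW q_gt0).
have {}le1 := le1 q01.
have ge0 : (0 <= \int[mu]_x (F x ^+ 2)%:E)%E.
  by apply: integral_ge0 => x _; rewrite lee_fin sqr_ge0.
have fin : (\int[mu]_x (F x ^+ 2)%:E)%E \is a fin_num.
  by rewrite ge0_fin_numE// (le_lt_trans le1)// ltry.
exists (fine (\int[mu]_x (F x ^+ 2)%:E) - 1); first by rewrite addrC subrK fineK.
rewrite lerD2r -lee_fin fineK// (le_trans le1)// lee_fin ler_expR lerD2l.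
rewrite enorm_mean sigma2E /a invrK le_eqVlt; apply/orP; left; apply/eqP; ring.
Qed.

Lemma ou_tv_ge : ((1 - expR (- (a / 8)))%:E <= total_variation_distance nu mu)%E.
Proof.
have [beta betaE ble] := affinity.
apply: le_trans (tv_distance_ge mF F_gt0 nuE betaE).
by rewrite lee_fin lerD2l lerN2.
Qed.

Lemma ou_tv_le1 : (total_variation_distance nu mu <= 1)%E.
Proof. exact: tv_distance_le1. Qed.

Lemma ou_tv_le delta : 0 < delta -> expR (n%:R * q ^+ 2 + a) - 1 <= delta ^+ 2 ->
  (total_variation_distance nu mu <= delta%:E)%E.
Proof.
move=> d0 cd; have [c cE cle] := chi.
by apply: (tv_distance_le mF F_gt0 nuE cE) => //; exact: le_trans cd.
Qed.

(** A number in [[0, 1]] is at most its square root, so the lower bound for total variation serves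
    again. *)
Lemma ou_hellinger_ge : ((1 - expR (- (a / 8)))%:E <= hellinger nu mu)%E.
Proof.
have [beta betaE ble] := affinity; have [c cE cle] := chi.
rewrite (hellinger_density mF nuE betaE) lee_fin.
have e0 := expR_ge0 (- (a / 8)).
have e1 : expR (- (a / 8)) <= 1 by rewrite expR_le1 oppr_le0 divr_ge0.
have x0 : 0 <= 1 - expR (- (a / 8)) by rewrite subr_ge0.
rewrite -(ger0_norm x0) -sqrtr_sqr ler_wsqrtr//; nra.
Qed.

Lemma ou_hellinger_le1 : (hellinger nu mu <= 1)%E.
Proof.
have [beta betaE ble] := affinity.
rewrite (hellinger_density mF nuE betaE) lee_fin -[leRHS]sqrtr1 ler_wsqrtr//.
rewrite gerDl oppr_le0 -lee_fin -betaE.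
by apply: integral_ge0 => x _; rewrite lee_fin.
Qed.

Lemma ou_hellinger_le delta : 0 < delta -> expR (n%:R * q ^+ 2 + a) - 1 <= delta ^+ 2 ->
  (hellinger nu mu <= delta%:E)%E.
Proof.
move=> d0 cd; have [beta betaE ble] := affinity; have [c cE cle] := chi.
rewrite (hellinger_density mF nuE betaE) lee_fin.
have bc := density_affinity_ge mF F_gt0 nuE betaE cE.
rewrite -[leRHS](gtr0_norm d0) -sqrtr_sqr ler_wsqrtr//.
have := density_affinity_le1 mF F_gt0 nuE betaE; nra.
Qed.

Lemma ou_kullback_ge : ((a / 4)%:E <= kullback nu mu)%E.
Proof.
have [beta betaE ble] := affinity; have [c cE cle] := chi.
apply: le_trans (kullback_ge mF F_gt0 nuE betaE cE (expR_gt0 _) ble).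
by rewrite expRK lee_fin; lra.
Qed.

Lemma ou_kullback_le_chi2 : (kullback nu mu <= chi2 nu mu)%E.
Proof.
have [beta betaE ble] := affinity; have [c cE cle] := chi.
by rewrite (chi2_density mF F_gt0 nuE cE) (kullback_le mF F_gt0 nuE betaE cE).
Qed.

Lemma ou_chi2_le : (chi2 nu mu <= (expR (n%:R * q ^+ 2 + a) - 1)%:E)%E.
Proof. by have [c cE cle] := chi; rewrite (chi2_density mF F_gt0 nuE cE) lee_fin. Qed.

(** The ratio of deviations is [b = sqrt (1 - q)], and [(1 - b) * (1 + b) = q] gives [1 - b <= q].
    The factor [n] of the second moment cancels against the variance [1 / n]. *)
Lemma ou_wasserstein_le :
  (wasserstein nu mu <= (Num.sqrt (2 * (q * n%:R * W) + 16 * q ^+ 2))%:E)%E.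
Proof.
pose b := Num.sqrt (1 - q).
have b_gt0 : 0 < b by rewrite sqrtr_gt0; have := q_le'; lra.
have bs : s = b * sigma.
  by rewrite /s /b /sigma -sqrtrM//; have := q_le'; lra.
have lawnu' A : measurable A -> nu A = gaussian (E *: z) (b * sigma) A.
  by move=> mA; rewrite (lawnu mA) -bs.
have lawmu A : measurable A -> mu A = gaussian 0 sigma A by [].
apply: le_trans (wasserstein_gaussian_le b_gt0 sigma_gt0 lawnu' lawmu) _.
rewrite lee_fin ler_wsqrtr// enorm_mean lerD2l.
have -> : 16 * n%:R * (b - 1) ^+ 2 * sigma ^+ 2 = 16 * (b - 1) ^+ 2.
  by rewrite sigma2E; field; rewrite gt_eqF.
rewrite ler_wpM2l//.
have b2 : b ^+ 2 = 1 - q by rewrite sqr_sqrtr//; have := q_le'; lra.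
have : (1 - b) * (1 + b) = q by rewrite -subr_sqr expr1n b2; ring.
have : b <= 1 by rewrite -[leRHS]sqrtr1 ler_wsqrtr//; have := q_gt0; lra.
nra.
Qed.

Lemma ou_wasserstein_ge :
  ((Num.sqrt (q * n%:R * W / 3 - 16))%:E <= wasserstein nu mu)%E.
Proof.
pose b := Num.sqrt (1 - q).
have b_gt0 : 0 < b by rewrite sqrtr_gt0; have := q_le'; lra.
have bs : s = b * sigma.
  by rewrite /s /b /sigma -sqrtrM//; have := q_le'; lra.
have lawnu' A : measurable A -> nu A = gaussian (E *: z) (b * sigma) A.
  by move=> mA; rewrite (lawnu mA) -bs.
have lawmu A : measurable A -> mu A = gaussian 0 sigma A by [].
apply: le_trans (wasserstein_gaussian_ge b_gt0 sigma_gt0 lawnu' lawmu).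
rewrite lee_fin ler_wsqrtr// enorm_mean lerD2l lerN2.
have -> : 8 * n%:R * (b ^+ 2 + 1) * sigma ^+ 2 = 8 * (b ^+ 2 + 1).
  by rewrite sigma2E; field; rewrite gt_eqF.
have b2 : b ^+ 2 = 1 - q by rewrite sqr_sqrtr//; have := q_le'; lra.
rewrite b2; have := q_gt0; lra.
Qed.

(** The part of the Fisher information due to the variance mismatch, up to constants; for [q <= 1/2]
    it is at most [2 n^2 q^2]. *)
Let fisher_rest : n%:R * ((sigma ^+ 2)^-1 - (s ^+ 2)^-1) ^+ 2 * s ^+ 2 =
  n%:R ^+ 2 * q ^+ 2 / (1 - q).
Proof.
have q1 : 0 < 1 - q by have := q_le'; lra.
by rewrite s2E sigma2E; field; rewrite ?(gt_eqF q1) ?(gt_eqF N_gt0).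
Qed.

Let fisher_rest_le : n%:R ^+ 2 * q ^+ 2 / (1 - q) <= 2 * (n%:R ^+ 2 * q ^+ 2).
Proof.
have q1 : 0 < 1 - q by have := q_le'; lra.
rewrite ler_pdivrMr//.
have : 0 <= n%:R ^+ 2 * q ^+ 2 by rewrite mulr_ge0 ?sqr_ge0.
have := q_le'; nra.
Qed.

Let sigma4 : sigma ^+ 4 = n%:R ^- 2.
Proof. by rewrite (exprM _ 2 2) sigma2E exprVn. Qed.

Lemma ou_fisher_le : (fisher nu mu <=
  (2 * (n%:R ^+ 3 * q * W) + 32 * (n%:R ^+ 2 * q ^+ 2))%:E)%E.
Proof.
have lawmu A : measurable A -> mu A = gaussian 0 sigma A by [].
apply: le_trans (fisher_gaussian_le s_gt0 sigma_gt0 lawnu lawmu) _.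
rewrite lee_fin enorm_mean sigma4.
have -> : 16 * n%:R * ((sigma ^+ 2)^-1 - (s ^+ 2)^-1) ^+ 2 * s ^+ 2 =
   16 * (n%:R ^+ 2 * q ^+ 2 / (1 - q)) by rewrite -fisher_rest; ring.
have -> : 2 * (q * n%:R * W) / n%:R ^- 2 = 2 * (n%:R ^+ 3 * q * W).
  by field; rewrite gt_eqF.
have := fisher_rest_le; lra.
Qed.

Lemma ou_fisher_ge : ((n%:R ^+ 3 * q * W / 2 - 16 * (n%:R ^+ 2 * q ^+ 2))%:E <=
  fisher nu mu)%E.
Proof.
have lawmu A : measurable A -> mu A = gaussian 0 sigma A by [].
apply: le_trans (fisher_gaussian_ge s_gt0 sigma_gt0 lawnu lawmu).
rewrite lee_fin enorm_mean sigma4.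
have -> : 8 * n%:R * ((sigma ^+ 2)^-1 - (s ^+ 2)^-1) ^+ 2 * s ^+ 2 =
   8 * (n%:R ^+ 2 * q ^+ 2 / (1 - q)) by rewrite -fisher_rest; ring.
have -> : q * n%:R * W / (2 * n%:R ^- 2) = n%:R ^+ 3 * q * W / 2.
  by field; rewrite gt_eqF.
have := fisher_rest_le; lra.
Qed.

End ou_bounds.

(** * Asymptotics *)

Section asymptotics.
Context (R : realType).

Lemma limn_einf_gt0 (u : nat -> \bar R) : (0 < limn_einf u)%E ->
  exists2 c : R, 0 < c & \forall n \near \oo, (c%:E <= u n)%E.
Proof.
move=> u0; apply: contrapT => H; move: u0; rewrite ltNge => /negP; apply.
apply/lee_addgt0Pr => e e0; rewrite add0e limn_einf_lim; apply: lime_le.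
  exact: is_cvg_einfs.
apply: nearW => N; rewrite leNgt; apply/negP => eN; apply: H; exists e => //.
exists N => // n /= Nn; apply/ltW/(lt_le_trans eN).
by apply: ereal_inf_lbound; exists n.
Qed.

Lemma limn_esup_lty (u : nat -> \bar R) : (limn_esup u < +oo)%E ->
  exists C : R, \forall n \near \oo, (u n <= C%:E)%E.
Proof.
move=> uy; apply: contrapT => H; move: uy; rewrite limn_esup_lim ltNge => /negP; apply.
apply: lime_ge; first exact: is_cvg_esups.
apply: nearW => N; rewrite leNgt; apply/negP => uN; apply: H.
(* The maximum with 0 keeps the bound finite when the tail supremum is [-oo]. *)
exists (fine (maxe (esups u N) 0%E)); exists N => // n /= Nn.
rewrite fineK; last first.
  rewrite fin_numElt gt_max lt_max uN ltry/=; apply/andP; split => //.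
  by rewrite ltNyr orbT.
by rewrite le_max; apply/orP; left; apply: ereal_sup_ubound; exists n.
Qed.

Lemma near_ln_ge (A : R) : \forall n \near \oo, A <= ln (n%:R : R).
Proof.
have : \forall n \near \oo, expR A <= n%:R :> R by exact: nbhs_infty_ger.
apply: filterS => n An; rewrite -[A]expRK ler_ln// posrE ?expR_gt0//.
exact: lt_le_trans (expR_gt0 _) An.
Qed.

Lemma near_expR_ge (b c A : R) : 0 < b -> 0 < c ->
  \forall n \near \oo, A <= c * expR (b * ln (n%:R : R)).
Proof.
move=> b0 c0; have := near_ln_ge (A / c / b); apply: filterS => n.
rewrite !ler_pdivrMr// => h; have := expR_ge1Dx (b * ln (n%:R : R)).
move: (ln _) (expR _) h => l e h1 h2; apply: (le_trans h1); nra.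
Qed.

Lemma near_expR_le (b C d : R) : 0 < b -> 0 < d ->
  \forall n \near \oo, C * expR (- (b * ln (n%:R : R))) <= d.
Proof.
move=> b0 d0; have C0 : 0 < `|C| + 1 by rewrite ltr_wpDl.
have := near_ln_ge (- ln (d / (`|C| + 1)) / b); apply: filterS => n.
rewrite ler_pdivrMr// => h.
have : expR (- (b * ln (n%:R : R))) <= d / (`|C| + 1).
  by rewrite -[leRHS]lnK ?posrE ?divr_gt0// ler_expR; lra.
rewrite ler_pdivlMr// => H; apply: le_trans H.
by rewrite mulrC ler_wpM2l ?expR_ge0// (le_trans (ler_norm C))// lerDl.
Qed.

(** At time [y log n] every term of the bounds is a power of n; the sign of [i - j y] decides
    whether it vanishes or diverges. *)
Lemma natr_expR n i j (y : R) : (0 < n)%N ->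
  n%:R ^+ i * expR (- (y * ln n%:R)) ^+ j = expR ((i%:R - j%:R * y) * ln n%:R).
Proof.
move=> n0; rewrite -[n%:R in LHS]lnK ?posrE ?ltr0n// -!expRM_natl -expRD.
by rewrite expRK; congr expR; ring.
Qed.

Lemma cvge_near_fin (u : nat -> \bar R) (l : R) :
  (forall d : R, 0 < d ->
    \forall n \near \oo, ((l - d)%:E <= u n)%E /\ (u n <= (l + d)%:E)%E) ->
  u n @[n --> \oo] --> l%:E.
Proof.
move=> H; apply/fine_cvgP; split.
  have := H 1 ltr01; apply: filterS => n [h1 h2].
  by rewrite fin_numElt (lt_le_trans _ h1) ?ltNyr// (le_lt_trans h2) ?ltry.
apply/cvgrPdist_le => e e0; have := H e e0; apply: filterS => n [].
rewrite /=; case: (u n) => [r||]//; rewrite !lee_fin => h1 h2.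
by rewrite ler_distlC; apply/andP; split.
Qed.

End asymptotics.

(** * The two regimes for each distance *)

Section cutoff.
Context (R : realType) (d : nat -> measure_display)
  (T : forall n, measurableType (d n)) (P : forall n, probability (T n) R)
  (z0 : forall n, 'rV[R]_n) (B Z : forall n, R -> {RV (P n) >-> 'rV[R]_n}).
Hypotheses (hB : forall n, (1 <= n)%N -> brownian_motion (P n) (B n))
  (hZ : forall n, (1 <= n)%N -> ornstein_uhlenbeck (P n) (B n) (z0 n) (Z n))
  (hliminf : (0 < limn_einf (fun n => (enorm (z0 n) ^+ 2 / n%:R)%:E))%E)
  (hlimsup : (limn_esup (fun n => (enorm (z0 n) ^+ 2 / n%:R)%:E) < +oo)%E).

Let W n : R := enorm (z0 n) ^+ 2 / n%:R.
Let E (y : R) n : R := expR (- (y * ln n%:R)).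
Let nu (y : R) n : probability 'rV[R]_n R := distribution (P n) (Z n (y * ln n%:R)).
Let mu n : probability 'rV[R]_n R := ou_invariant R n.
Let a (y : R) n : R := n%:R ^+ 2 * E y n ^+ 2 * W n.

Let lower : exists2 c : R, 0 < c & \forall n \near \oo, c <= W n.
Proof. exact: limn_einf_gt0 hliminf. Qed.

Let upper : exists C : R, \forall n \near \oo, W n <= C.
Proof. exact: limn_esup_lty hlimsup. Qed.

(** For large [n] the time [y * ln n] is positive, as [ou_law] requires, and the decay factor is at
    most 1/2, which puts [q] in the range of the bounds. *)
Let near_regime y : 0 < y -> \forall n \near \oo,
  [/\ (0 < n)%N, E y n ^+ 2 <= 2^-1 &
      forall A, measurable A -> nu y n A =
        gaussian (E y n *: z0 n) (Num.sqrt ((1 - E y n ^+ 2) / n%:R)) A].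
Proof.
move=> y0; near=> n.
have n0 : (0 < n)%N by near: n; exact: nbhs_infty_gt.
have t0 : 0 < y * ln n%:R.
  rewrite mulr_gt0//; apply: (@lt_le_trans _ _ 1) => //.
  by near: n; exact: near_ln_ge.
have E2 : 1 * E y n <= 2^-1 by near: n; exact: near_expR_le.
have E0 := expR_gt0 (- (y * ln n%:R)).
have E1 : E y n < 1 by rewrite expR_lt1 oppr_lt0.
split => //; first by rewrite /E in E1 E2 *; nra.
by move=> A mA; exact: (ou_law n0 (hB n0) (hZ n0) t0 mA).
Unshelve. all: by end_near.
Qed.

Let near_a_ge y (A : R) : 0 < y < 1 -> \forall n \near \oo, A <= a y n.
Proof.
move=> /andP[y0 y1]; have [c c0 cW] := lower; near=> n.
have n0 : (0 < n)%N by near: n; exact: nbhs_infty_gt.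
apply: (@le_trans _ _ (c * expR ((2 - 2 * y) * ln n%:R))).
  by near: n; apply: near_expR_ge => //; lra.
rewrite /a natr_expR// mulrC ler_wpM2l ?expR_ge0//.
by near: n.
Unshelve. all: by end_near.
Qed.

(** The term [n q^2] is n^(1 - 4y), dominated by the order n^(2 - 2y) of [a], so one exponential
    controls both. *)
Let near_a_le y (e : R) : 1 < y -> 0 < e ->
  \forall n \near \oo, n%:R * (E y n ^+ 2) ^+ 2 + a y n <= e.
Proof.
move=> y1 e0; have [C CW] := upper; near=> n.
have n0 : (0 < n)%N by near: n; exact: nbhs_infty_gt.
have L0 : 0 <= ln n%:R :> R by near: n; exact: near_ln_ge.
apply: (@le_trans _ _ ((1 + C) * expR (- ((2 * y - 2) * ln n%:R)))); last first.
  by near: n; apply: near_expR_le => //; lra.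
rewrite mulrDl mul1r lerD//.
  have -> : n%:R * (E y n ^+ 2) ^+ 2 = expR ((1 - 4 * y) * ln n%:R).
    by rewrite -exprM -(natr_expR 1 4).
  by rewrite ler_expR -[leRHS]mulNr ler_wpM2r//; lra.
rewrite /a natr_expR// mulrC.
have -> : (2 - 2 * y) * ln n%:R = - ((2 * y - 2) * ln n%:R) by ring.
by rewrite ler_wpM2r ?expR_ge0//; near: n.
Unshelve. all: by end_near.
Qed.

Let near_expR_a_le y (e : R) : 1 < y -> 0 < e ->
  \forall n \near \oo, expR (n%:R * (E y n ^+ 2) ^+ 2 + a y n) - 1 <= e.
Proof.
move=> y1 e0; have e1 : 0 < 1 + e by rewrite addr_gt0.
have l0 : 0 < ln (1 + e) by rewrite ln_gt0// ltrDl.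
have := near_a_le y1 l0; apply: filterS => n h.
by rewrite lerBlDl -[1 + e]lnK ?posrE// ler_expR.
Qed.

Let near_expRN_a_le y (e : R) : 0 < y < 1 -> 0 < e ->
  \forall n \near \oo, 1 - e <= 1 - expR (- (a y n / 8)).
Proof.
move=> y01 e0; have := near_a_ge (- ln e * 8) y01; apply: filterS => n h.
rewrite lerD2l lerN2 -[leRHS]lnK ?posrE// ler_expR lerNl ler_pdivlMr//.
Qed.

Lemma cvg_tv_max y : 0 < y < 1 ->
  total_variation_distance (nu y n) (mu n) @[n --> \oo] --> 1%E.
Proof.
move=> y01; have /andP[y0 y1] := y01; apply: cvge_near_fin => e e0.
have := near_expRN_a_le y01 e0; have := near_regime y0.
apply: filterS2 => n [n0 E2 law] h; split.
  by apply: le_trans (ou_tv_ge n0 (expR_gt0 _) E2 law); rewrite lee_fin.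
by rewrite (le_trans (ou_tv_le1 _))// lee_fin lerDl ltW.
Qed.

Lemma cvg_hellinger_max y : 0 < y < 1 ->
  hellinger (nu y n) (mu n) @[n --> \oo] --> 1%E.
Proof.
move=> y01; have /andP[y0 y1] := y01; apply: cvge_near_fin => e e0.
have := near_expRN_a_le y01 e0; have := near_regime y0.
apply: filterS2 => n [n0 E2 law] h; split.
  by apply: le_trans (ou_hellinger_ge n0 (expR_gt0 _) E2 law); rewrite lee_fin.
rewrite (le_trans (ou_hellinger_le1 n0 (expR_gt0 _) E2 law))//.
by rewrite lee_fin lerDl ltW.
Qed.

Let near_kullback_ge y (A : R) : 0 < y < 1 ->
  \forall n \near \oo, (A%:E <= kullback (nu y n) (mu n))%E.
Proof.
move=> y01; have /andP[y0 y1] := y01.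
have := near_a_ge (A * 4) y01; have := near_regime y0.
apply: filterS2 => n [n0 E2 law] h.
apply: le_trans (ou_kullback_ge n0 (expR_gt0 _) E2 law).
by rewrite lee_fin ler_pdivlMr.
Qed.

Lemma cvg_kullback_max y : 0 < y < 1 ->
  kullback (nu y n) (mu n) @[n --> \oo] --> +oo%E.
Proof. by move=> y01; apply/cvgeyPge => A; exact: near_kullback_ge. Qed.

Lemma cvg_chi2_max y : 0 < y < 1 -> chi2 (nu y n) (mu n) @[n --> \oo] --> +oo%E.
Proof.
move=> y01; have /andP[y0 y1] := y01; apply/cvgeyPge => A.
have := near_kullback_ge A y01; have := near_regime y0.
apply: filterS2 => n [n0 E2 law] h; apply: (le_trans h).
exact: (ou_kullback_le_chi2 n0 (expR_gt0 _) E2 law).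
Qed.

Let cvge0 (u : nat -> \bar R) :
  (forall e : R, 0 < e -> \forall n \near \oo, (0 <= u n)%E /\ (u n <= e%:E)%E) ->
  u n @[n --> \oo] --> 0%E.
Proof.
move=> H; apply: cvge_near_fin => e e0; have := H e e0; apply: filterS => n [u0 ue].
by split; [apply: le_trans u0; rewrite lee_fin sub0r oppr_le0 ltW|rewrite add0r].
Qed.

Let tv_ge0 y n : (0 <= total_variation_distance (nu y n) (mu n))%E.
Proof.
apply: (@le_trans _ _ `|nu y n set0 - mu n set0|%E); first exact: abse_ge0.
by apply: ereal_sup_ubound; exists set0.
Qed.

Lemma cvg_tv_0 y : 1 < y ->
  total_variation_distance (nu y n) (mu n) @[n --> \oo] --> 0%E.
Proof.
move=> y1; have y0 : 0 < y by exact: lt_trans y1.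
apply: cvge0 => e e0; have e2 : 0 < e ^+ 2 by rewrite exprn_gt0.
have := near_expR_a_le y1 e2; have := near_regime y0.
apply: filterS2 => n [n0 E2 law] h; split=> //.
exact: (ou_tv_le n0 (expR_gt0 _) E2 law e0 h).
Qed.

Lemma cvg_hellinger_0 y : 1 < y ->
  hellinger (nu y n) (mu n) @[n --> \oo] --> 0%E.
Proof.
move=> y1; have y0 : 0 < y by exact: lt_trans y1.
apply: cvge0 => e e0; have e2 : 0 < e ^+ 2 by rewrite exprn_gt0.
have := near_expR_a_le y1 e2; have := near_regime y0.
apply: filterS2 => n [n0 E2 law] h; split; first by rewrite lee_fin sqrtr_ge0.
exact: (ou_hellinger_le n0 (expR_gt0 _) E2 law e0 h).
Qed.

(** Nonnegativity is read off the lower bound by a quarter of [a y n]; for chi-square it then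
    follows by comparison. *)
Let kullback_ge0 y n : (0 < n)%N -> E y n ^+ 2 <= 2^-1 ->
  (forall A, measurable A -> nu y n A =
     gaussian (E y n *: z0 n) (Num.sqrt ((1 - E y n ^+ 2) / n%:R)) A) ->
  (0 <= kullback (nu y n) (mu n))%E.
Proof.
move=> n0 E2 law; apply: le_trans (ou_kullback_ge n0 (expR_gt0 _) E2 law).
rewrite lee_fin; apply: divr_ge0 => //; apply: mulr_ge0.
  by apply: mulr_ge0; exact: sqr_ge0.
by apply: divr_ge0 => //; exact: sqr_ge0.
Qed.

Lemma cvg_chi2_0 y : 1 < y -> chi2 (nu y n) (mu n) @[n --> \oo] --> 0%E.
Proof.
move=> y1; have y0 : 0 < y by exact: lt_trans y1.
apply: cvge0 => e e0; have := near_expR_a_le y1 e0; have := near_regime y0.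
apply: filterS2 => n [n0 E2 law] h; split.
  apply: le_trans (ou_kullback_le_chi2 n0 (expR_gt0 _) E2 law).
  exact: kullback_ge0.
by apply: (le_trans (ou_chi2_le n0 (expR_gt0 _) E2 law)); rewrite lee_fin.
Qed.

Lemma cvg_kullback_0 y : 1 < y -> kullback (nu y n) (mu n) @[n --> \oo] --> 0%E.
Proof.
move=> y1; have y0 : 0 < y by exact: lt_trans y1.
apply: cvge0 => e e0; have := near_expR_a_le y1 e0; have := near_regime y0.
apply: filterS2 => n [n0 E2 law] h; split; first exact: kullback_ge0.
apply: (le_trans (ou_kullback_le_chi2 n0 (expR_gt0 _) E2 law)).
by apply: (le_trans (ou_chi2_le n0 (expR_gt0 _) E2 law)); rewrite lee_fin.
Qed.

Lemma cvg_wasserstein_max y : 0 < y < 2^-1 ->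
  wasserstein (nu y n) (mu n) @[n --> \oo] --> +oo%E.
Proof.
move=> /andP[y0 y1]; apply/cvgeyPge => A; have [c c0 cW] := lower; near=> n.
have [n0 E2 law] : [/\ (0 < n)%N, E y n ^+ 2 <= 2^-1 &
      forall A, measurable A -> nu y n A =
        gaussian (E y n *: z0 n) (Num.sqrt ((1 - E y n ^+ 2) / n%:R)) A].
  by near: n; exact: near_regime.
apply: le_trans (ou_wasserstein_ge n0 (expR_gt0 _) E2 law).
rewrite lee_fin (le_trans (ler_norm A))// -sqrtr_sqr ler_wsqrtr//.
rewrite lerBrDr ler_pdivlMr//.
(* The constants invert the lower bound [sqrt (q n W / 3 - 16)]; [A] was replaced by the square root
   of [A ^+ 2], as it may be negative. *)
have h : (A ^+ 2 + 16) * 3 <= c * expR ((1 - 2 * y) * ln n%:R).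
  by near: n; apply: near_expR_ge => //; lra.
apply: (le_trans h); rewrite [E y n ^+ 2 * _]mulrC.
rewrite -[n%:R in leRHS]expr1 natr_expR// mulrC ler_wpM2l ?expR_ge0//.
by near: n.
Unshelve. all: by end_near.
Qed.

Lemma cvg_wasserstein_0 y : 2^-1 < y ->
  wasserstein (nu y n) (mu n) @[n --> \oo] --> 0%E.
Proof.
move=> y1; have y0 : 0 < y by exact: lt_trans y1.
apply: cvge0 => e e0; have [C CW] := upper; near=> n.
have [n0 E2 law] : [/\ (0 < n)%N, E y n ^+ 2 <= 2^-1 &
      forall A, measurable A -> nu y n A =
        gaussian (E y n *: z0 n) (Num.sqrt ((1 - E y n ^+ 2) / n%:R)) A].
  by near: n; exact: near_regime.
split; first exact: sqrte_ge0.
apply: (le_trans (ou_wasserstein_le n0 (expR_gt0 _) E2 law)).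
rewrite lee_fin -[leRHS]gtr0_norm// -sqrtr_sqr ler_wsqrtr//.
have L0 : 0 <= ln n%:R :> R by near: n; exact: near_ln_ge.
have h : (2 * C + 16) * expR (- ((2 * y - 1) * ln n%:R)) <= e ^+ 2.
  by near: n; apply: near_expR_le; [lra|rewrite exprn_gt0].
apply: le_trans h; rewrite [leRHS](mulrDl (2 * C)) lerD//.
  rewrite -[leRHS]mulrA ler_wpM2l// [E y n ^+ 2 * _]mulrC.
  rewrite -[n%:R in leLHS]expr1 natr_expR// mulrC.
  have -> : (1 - 2 * y) * ln n%:R = - ((2 * y - 1) * ln n%:R) by ring.
  by rewrite ler_wpM2r ?expR_ge0//; near: n.
(* The covariance term [q^2] is n^(-4y), below n^(1 - 2y); the factor [n ^+ 0] brings it to the form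
   of [natr_expR]. *)
rewrite ler_wpM2l// -exprM -[leLHS]mul1r -[1 in leLHS](expr0 n%:R) natr_expR//.
by rewrite ler_expR -[leRHS]mulNr ler_wpM2r//; lra.
Unshelve. all: by end_near.
Qed.

Lemma cvg_fisher_max y : 0 < y < 3 / 2 ->
  fisher (nu y n) (mu n) @[n --> \oo] --> +oo%E.
Proof.
move=> /andP[y0 y1]; apply/cvgeyPge => A; have [c c0 cW] := lower; near=> n.
have [n0 E2 law] : [/\ (0 < n)%N, E y n ^+ 2 <= 2^-1 &
      forall A, measurable A -> nu y n A =
        gaussian (E y n *: z0 n) (Num.sqrt ((1 - E y n ^+ 2) / n%:R)) A].
  by near: n; exact: near_regime.
apply: le_trans (ou_fisher_ge n0 E2 law).
have n1 : 1 <= n%:R :> R by rewrite ler1n.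
(* After the common factor [n^2 q] the bound is [n W / 2 - 16 q]. Since [W >= c] and [q <= 1], the
   condition [n c / 4 >= 16] leaves at least [n c / 4]. *)
have n2 : 16 / (c / 4) <= n%:R :> R by near: n; exact: nbhs_infty_ger.
have Wc : c <= W n by near: n.
have h : A <= c / 4 * expR ((3 - 2 * y) * ln n%:R).
  by near: n; apply: near_expR_ge; lra.
rewrite lee_fin (le_trans h)// -(natr_expR 3 2)// -/(E y n) -/(W n).
have q0 : 0 <= E y n ^+ 2 by rewrite sqr_ge0.
have c4 : 0 < c / 4 by rewrite divr_gt0.
move: n2; rewrite ler_pdivrMr// => n2.
have X0 : 0 <= n%:R ^+ 2 * E y n ^+ 2 by rewrite mulr_ge0 ?sqr_ge0.
have -> : n%:R ^+ 3 * E y n ^+ 2 * W n / 2 = n%:R * W n / 2 * (n%:R ^+ 2 * E y n ^+ 2).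
  by ring.
have -> : c / 4 * (n%:R ^+ 3 * E y n ^+ 2) = n%:R * (c / 4) * (n%:R ^+ 2 * E y n ^+ 2).
  by ring.
have -> : 16 * (n%:R ^+ 2 * (E y n ^+ 2) ^+ 2) = 16 * E y n ^+ 2 * (n%:R ^+ 2 * E y n ^+ 2).
  by ring.
rewrite -mulrBl ler_wpM2r//; nra.
Unshelve. all: by end_near.
Qed.

Lemma cvg_fisher_0 y : 3 / 2 < y ->
  fisher (nu y n) (mu n) @[n --> \oo] --> 0%E.
Proof.
move=> y1; have y0 : 0 < y by lra.
apply: cvge0 => e e0; have [C CW] := upper; near=> n.
have [n0 E2 law] : [/\ (0 < n)%N, E y n ^+ 2 <= 2^-1 &
      forall A, measurable A -> nu y n A =
        gaussian (E y n *: z0 n) (Num.sqrt ((1 - E y n ^+ 2) / n%:R)) A].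
  by near: n; exact: near_regime.
split.
  rewrite /fisher; case: ifP => // _; apply: le_ereal_inf_tmp => _ [f _ <-].
  by apply: integral_ge0 => x _; rewrite lee_fin sqr_ge0.
apply: (le_trans (ou_fisher_le n0 E2 law)); rewrite lee_fin.
have L0 : 0 <= ln n%:R :> R by near: n; exact: near_ln_ge.
have h : (2 * C + 32) * expR (- ((2 * y - 3) * ln n%:R)) <= e.
  by near: n; apply: near_expR_le; [lra|].
apply: le_trans h; rewrite [leRHS](mulrDl (2 * C)) lerD//.
  rewrite -[leRHS]mulrA ler_wpM2l// natr_expR// mulrC.
  have -> : (3 - 2 * y) * ln n%:R = - ((2 * y - 3) * ln n%:R) by ring.
  by rewrite ler_wpM2r ?expR_ge0//; near: n.
(* The covariance term is n^(2 - 4y), below n^(3 - 2y). *)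
rewrite ler_wpM2l// -exprM natr_expR//.
by rewrite ler_expR -[leRHS]mulNr ler_wpM2r//; lra.
Unshelve. all: by end_near.
Qed.

End cutoff.

Theorem theorem1p1 (R : realType)
  (d : nat -> measure_display) (T : forall n, measurableType (d n))
  (P : forall n, probability (T n) R)
  (z0 : forall n, 'rV[R]_n)
  (B Z : forall n, R -> {RV (P n) >-> 'rV[R]_n})
  (hB : forall n, (1 <= n)%N -> brownian_motion (P n) (B n))
  (hZ : forall n, (1 <= n)%N -> ornstein_uhlenbeck (P n) (B n) (z0 n) (Z n))
  (hliminf : (0 < limn_einf (fun n => (enorm (z0 n) ^+ 2 / n%:R)%:E))%E)
  (hlimsup : (limn_esup (fun n => (enorm (z0 n) ^+ 2 / n%:R)%:E) < +oo)%E)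
  (k : distance) (eps : R) (heps : 0 < eps < 1) :
  (dist k (distribution (P n) (Z n ((1 - eps) * cutoff R k n)))
     (ou_invariant R n) @[n --> \oo] --> dist_max R k) /\
  (dist k (distribution (P n) (Z n ((1 + eps) * cutoff R k n)))
     (ou_invariant R n) @[n --> \oo] --> 0%E).
Proof.
have /andP[e0 e1] := heps.
have n01 : 0 < 1 - eps < 1 by apply/andP; split; lra.
have n1 : 1 < 1 + eps by lra.
(* For Wasserstein and Fisher the cutoff carries a constant [b], and the limits are known at
   [y = a * b]; reassociating the time makes the two agree. *)
have assoc (D : forall n, probability 'rV[R]_n R -> \bar R) (a b : R) (l : \bar R) :
    D n (distribution (P n) (Z n (a * b * ln n%:R))) @[n --> \oo] --> l ->
    D n (distribution (P n) (Z n (a * (b * ln n%:R)))) @[n --> \oo] --> l.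
  by under [X in X @ _ --> _ -> _]funext do rewrite -mulrA.
have y0 : 0 < (1 - eps) * 2^-1 < 2^-1 by apply/andP; split; lra.
have y1 : 2^-1 < (1 + eps) * 2^-1 by lra.
have y2 : 0 < (1 - eps) * (3 / 2) < 3 / 2 by apply/andP; split; lra.
have y3 : 3 / 2 < (1 + eps) * (3 / 2) by lra.
case: k; split; rewrite /cutoff /dist /dist_max.
- exact: (assoc (fun n nu => wasserstein nu (ou_invariant R n)) _ _ _
    (cvg_wasserstein_max hB hZ hliminf y0)).
- exact: (assoc (fun n nu => wasserstein nu (ou_invariant R n)) _ _ _
    (cvg_wasserstein_0 hB hZ hlimsup y1)).
- exact: (cvg_tv_max hB hZ hliminf n01).
- exact: (cvg_tv_0 hB hZ hlimsup n1).
- exact: (cvg_hellinger_max hB hZ hliminf n01).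
- exact: (cvg_hellinger_0 hB hZ hlimsup n1).
- exact: (cvg_kullback_max hB hZ hliminf n01).
- exact: (cvg_kullback_0 hB hZ hlimsup n1).
- exact: (cvg_chi2_max hB hZ hliminf n01).
- exact: (cvg_chi2_0 hB hZ hlimsup n1).
- exact: (assoc (fun n nu => fisher nu (ou_invariant R n)) _ _ _
    (cvg_fisher_max hB hZ hliminf y2)).
- exact: (assoc (fun n nu => fisher nu (ou_invariant R n)) _ _ _
    (cvg_fisher_0 hB hZ hlimsup y3)).
Qed.
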